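(* For all $\tau\in\mathbb{H}$, $$h\!\left(\frac{-1}{7\tau}\right)=\frac{h(\tau)-r}{(1-r)h(\tau)-1},$$ where $r=-(\zeta+\zeta^6)^2(\zeta^3+\zeta^4)^{-1}$ with $\zeta=e^{2\pi i/7}$; here $r$ and $\frac{1}{1-r}$ are roots of $x^3-8x^2+5x+1$.
   Context: Let $\tau\in\mathbb{H}$, $q=e^{2\pi i\tau}$, and $h(\tau)=q^{-1}\prod_{k\ge0}\frac{(1-q^{7k+3})(1-q^{7k+4})(1-q^{7k+2})^2(1-q^{7k+5})^2}{(1-q^{7k+1})^3(1-q^{7k+6})^3}$. *)

(* Defs.v *)
From Stdlib Require Import Reals.
From Coquelicot Require Import Coquelicot.
Open Scope C_scope.

Definition cexp (z : C) : C :=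
  (exp (Re z) * cos (Im z), exp (Re z) * sin (Im z))%R.

Definition in_H (tau : C) : Prop := (0 < Im tau)%R.

Definition qof (tau : C) : C := cexp (2 * PI * Ci * tau).

Definition hfactor (q : C) (k : nat) : C :=
  ((1 - q ^ (7 * k + 3)) * (1 - q ^ (7 * k + 4))
    * (1 - q ^ (7 * k + 2)) ^ 2 * (1 - q ^ (7 * k + 5)) ^ 2)
  / ((1 - q ^ (7 * k + 1)) ^ 3 * (1 - q ^ (7 * k + 6)) ^ 3).

Fixpoint hpartial (q : C) (N : nat) : C :=
  match N with
  | O => 1
  | S n => hpartial q n * hfactor q n
  end.

Definition hprod (q : C) : C :=
  @lim (CompleteNormedModule.CompleteSpace C_AbsRing C_CompleteNormedModule) (filtermap (hpartial q) eventually).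

Definition h (tau : C) : C := / qof tau * hprod (qof tau).

Definition zeta : C := cexp (2 * PI * Ci / 7).

Definition r : C :=
  - (zeta + zeta ^ 6) ^ 2 / (zeta ^ 3 + zeta ^ 4).

Definition cubic (x : C) : C := x ^ 3 - 8 * x ^ 2 + 5 * x + 1.

(* Main.v *)
(** Put kappa(z) = 1/(1 - e(z)) and, for a lattice parameter t,
    Lam(t; u, v) = sum over n in Z of
    kappa(v+u+nt) - kappa(u+nt) - kappa(v-u+nt) + kappa(-u+nt),
    a version of the Weierstrass combination zeta(u+v) + zeta(u-v) - 2 zeta(u).

    Its product formula (a partial fraction expansion of a finite theta quotient,
    then a dominated limit) gives, for t = 7 tau and u, v integer multiples of tau,
    Lam(1,3) = - h Lam(2,1) and Lam(1,2) = - h Lam(3,2).  Since the terms of the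
    lattice sum behind Lam decrease like the inverse cube, the order of summation
    can be exchanged, which gives Lam(-1/tau; a/tau, b/tau) = tau Lam(tau; a, b).
    Hence h(-1/(7 tau)) is a quotient of two Lam(tau; a, b) with a, b in (1/7)Z.

    Expanding in Lambert series, the values Lam(tau; j/7, k/7) are linear
    combinations, with coefficients in Q(e(1/7)), of the same three Lambert series
    that give the values Lam(7 tau; j tau, k tau), and the product formulas
    determine these three series up to a common factor as functions of h. What
    remains is an identity of polynomials in h over Q(e(1/7)). *)

Require Import Defs.
From Stdlib Require Import Reals ZArith Lra Lia.
From Coquelicot Require Import Coquelicot.
Open Scope C_scope.

(** * Limits, series and products of complex sequences *)

(** The four terms of Lam form a difference in v followed by a difference in u. One difference alone
    leaves lattice terms of size |w|^(-2), whose double sum depends on the order of summation and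
    would add a correction under t -> -1/t; the second difference removes it. No complex analysis
    enters: the partial fractions of [kappa] are obtained from an exact finite identity, the sum of
    [kappa] over division points of odd order 2N+1, by letting N grow under a summable majorant.

    The relation that closes the system is Lam(1,3) = Lam(1,2) + Lam(3,2), visible on the Lambert
    side. With the two product relations it gives Lam(2,1) = b (h - 1), Lam(3,2) = b h and Lam(1,3)
    = - b h (h - 1). The factor b is never computed, since the final identity is homogeneous in it.
    The divisions need h different from 1 and (1 - r) h different from 1; both follow from the
    nonvanishing of the theta products, the second also from the cubic equation of [r]. *)

Lemma ex_series_Rscal (c : R) (b : nat -> R) :
  ex_series b -> ex_series (fun k => c * b k)%R.
Proof. exact (ex_series_scal (V := R_NormedModule) c b). Qed.

Lemma im_le_Cmod (z : C) : (Rabs (Im z) <= Cmod z)%R.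
Proof. eapply Rle_trans; [apply Rmax_r | apply Rmax_Cmod]. Qed.

(** Stated through the real sequence of distances, so that results on real limits apply and
    squeezing under a real majorant is immediate. *)
Definition Cconv (u : nat -> C) (l : C) : Prop :=
  is_lim_seq (fun n => Cmod (u n - l)) 0.

Lemma Cconv_eps (u : nat -> C) (l : C) :
  Cconv u l <->
  forall eps : R, (0 < eps)%R ->
    exists N, forall n, (N <= n)%nat -> (Cmod (u n - l) < eps)%R.
Proof.
  split.
  - intros H eps He.
    apply is_lim_seq_spec in H. destruct (H (mkposreal eps He)) as [N HN].
    exists N. intros n Hn. specialize (HN n Hn). simpl in HN.
    rewrite Rminus_0_r, Rabs_pos_eq in HN; [exact HN | apply Cmod_ge_0].
  - intros H. apply is_lim_seq_spec. intros eps.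
    destruct (H eps (cond_pos eps)) as [N HN].
    exists N. intros n Hn. simpl.
    rewrite Rminus_0_r, Rabs_pos_eq; [auto | apply Cmod_ge_0].
Qed.

Lemma Cconv_squeeze (u : nat -> C) (l : C) (v : nat -> R) (K : nat) :
  (forall n, (K <= n)%nat -> (Cmod (u n - l) <= v n)%R) ->
  is_lim_seq v 0 -> Cconv u l.
Proof.
  intros H Hv.
  apply is_lim_seq_le_le_loc with (fun _ => 0%R) v; [ | apply is_lim_seq_const | exact Hv].
  exists K. intros n Hn. split; [apply Cmod_ge_0 | auto].
Qed.

Lemma Cconv_ext (u v : nat -> C) (l : C) :
  (forall n, u n = v n) -> Cconv u l -> Cconv v l.
Proof.
  intros H. apply is_lim_seq_ext. intros n. now rewrite H.
Qed.

Lemma Cconv_const (c : C) : Cconv (fun _ => c) c.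
Proof.
  apply Cconv_squeeze with (fun _ => 0%R) O; [ | apply is_lim_seq_const].
  intros n _. replace (c - c) with (RtoC 0) by ring. rewrite Cmod_0. lra.
Qed.

Lemma Cconv_plus (u v : nat -> C) (l m : C) :
  Cconv u l -> Cconv v m -> Cconv (fun n => u n + v n) (l + m).
Proof.
  intros Hu Hv.
  apply Cconv_squeeze with (fun n => Cmod (u n - l) + Cmod (v n - m))%R O.
  - intros n _. replace (u n + v n - (l + m)) with ((u n - l) + (v n - m)) by ring.
    apply Cmod_triangle.
  - replace 0%R with (0 + 0)%R by ring. now apply is_lim_seq_plus'.
Qed.

Lemma Cconv_scal (c : C) (u : nat -> C) (l : C) :
  Cconv u l -> Cconv (fun n => c * u n) (c * l).
Proof.
  intros Hu.
  apply Cconv_squeeze with (fun n => Cmod c * Cmod (u n - l))%R O.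
  - intros n _. replace (c * u n - c * l) with (c * (u n - l)) by ring.
    rewrite Cmod_mult. lra.
  - replace 0%R with (Cmod c * 0)%R by ring.
    now apply (is_lim_seq_scal_l _ (Cmod c) 0).
Qed.

Lemma Cconv_opp (u : nat -> C) (l : C) :
  Cconv u l -> Cconv (fun n => - u n) (- l).
Proof.
  intros H. apply (Cconv_scal (-1)) in H.
  replace (- l) with (-1 * l) by ring.
  apply Cconv_ext with (2 := H). intros n. ring.
Qed.

Lemma Cconv_minus (u v : nat -> C) (l m : C) :
  Cconv u l -> Cconv v m -> Cconv (fun n => u n - v n) (l - m).
Proof.
  intros Hu Hv. apply Cconv_plus; [exact Hu | now apply Cconv_opp].
Qed.

Lemma Cconv_mult (u v : nat -> C) (l m : C) :
  Cconv u l -> Cconv v m -> Cconv (fun n => u n * v n) (l * m).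
Proof.
  intros Hu Hv.
  apply Cconv_squeeze with
    (fun n => Cmod (u n - l) * Cmod (v n - m)
      + (Cmod m * Cmod (u n - l) + Cmod l * Cmod (v n - m)))%R O.
  - intros n _.
    replace (u n * v n - l * m)
      with ((u n - l) * (v n - m) + (m * (u n - l) + l * (v n - m))) by ring.
    eapply Rle_trans; [apply Cmod_triangle | ].
    rewrite Cmod_mult. apply Rplus_le_compat_l.
    eapply Rle_trans; [apply Cmod_triangle | ].
    rewrite !Cmod_mult. lra.
  - replace 0%R with (0 * 0 + (Cmod m * 0 + Cmod l * 0))%R by ring.
    apply is_lim_seq_plus'; [now apply is_lim_seq_mult' | ].
    apply is_lim_seq_plus'; apply is_lim_seq_mult'; auto using is_lim_seq_const.
Qed.

Lemma Cconv_away (u : nat -> C) (l : C) :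
  Cconv u l -> l <> 0 ->
  exists N, forall n, (N <= n)%nat -> (Cmod l / 2 <= Cmod (u n))%R.
Proof.
  intros Hu Hl. apply Cmod_gt_0 in Hl.
  destruct (proj1 (Cconv_eps u l) Hu (Cmod l / 2)%R) as [N HN]; [lra | ].
  exists N. intros n Hn. specialize (HN n Hn).
  assert (Cmod l <= Cmod (u n) + Cmod (u n - l))%R; [ | lra].
  replace l with (u n + - (u n - l)) at 1 by ring.
  eapply Rle_trans; [apply Cmod_triangle | ]. rewrite Cmod_opp. lra.
Qed.

Lemma Cconv_inv (u : nat -> C) (l : C) :
  Cconv u l -> l <> 0 -> Cconv (fun n => / u n) (/ l).
Proof.
  intros Hu Hl. pose proof (proj1 (Cmod_gt_0 l) Hl) as Hl'.
  destruct (Cconv_away u l Hu Hl) as [N HN].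
  (* From N on, |u n| is at least |l|/2, hence 1/|u n l| is at most 2/|l|^2. *)
  apply Cconv_squeeze with (fun n => 2 / (Cmod l * Cmod l) * Cmod (u n - l))%R N.
  - intros n Hn. specialize (HN n Hn).
    assert (Hun : u n <> 0) by (apply Cmod_gt_0; lra).
    replace (/ u n - / l) with (- (u n - l) * / (u n * l)) by (field; auto).
    rewrite Cmod_mult, Cmod_opp, Cmod_inv, Cmod_mult, Rmult_comm
      by (apply Cmult_neq_0; auto).
    apply Rmult_le_compat_r; [apply Cmod_ge_0 | ].
    replace (2 / (Cmod l * Cmod l))%R with (/ (Cmod l / 2 * Cmod l))%R by (field; lra).
    apply Rinv_le_contravar; [nra | ].
    apply Rmult_le_compat_r; lra.
  - replace 0%R with (2 / (Cmod l * Cmod l) * 0)%R by ring.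
    apply is_lim_seq_mult'; auto using is_lim_seq_const.
Qed.

Lemma Cconv_div (u v : nat -> C) (l m : C) :
  Cconv u l -> Cconv v m -> m <> 0 -> Cconv (fun n => u n / v n) (l / m).
Proof.
  intros Hu Hv Hm. apply Cconv_mult; [exact Hu | now apply Cconv_inv].
Qed.

Lemma Cconv_le (u : nat -> C) (l : C) (B : R) (K : nat) :
  Cconv u l -> (forall n, (K <= n)%nat -> (Cmod (u n) <= B)%R) -> (Cmod l <= B)%R.
Proof.
  intros Hu HB. apply Rnot_lt_le. intros Hlt.
  destruct (proj1 (Cconv_eps u l) Hu (Cmod l - B)%R) as [N HN]; [lra | ].
  specialize (HN (max N K) (Nat.le_max_l _ _)).
  specialize (HB (max N K) (Nat.le_max_r _ _)).
  set (x := u (max N K)) in *.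
  assert (Cmod l <= Cmod x + Cmod (x - l))%R; [ | lra].
  replace l with (x + - (x - l)) at 1 by ring.
  eapply Rle_trans; [apply Cmod_triangle | ]. rewrite Cmod_opp. lra.
Qed.

Lemma Cconv_unique (u : nat -> C) (l m : C) : Cconv u l -> Cconv u m -> l = m.
Proof.
  intros Hl Hm.
  assert (H : Cconv (fun _ => 0) (l - m)).
  { apply Cconv_ext with (fun n => u n - u n); [intros n; ring | now apply Cconv_minus]. }
  assert (Cmod (l - m) <= 0)%R as H0.
  { apply Cconv_le with (1 := H) (K := O). intros n _. rewrite Cmod_0. lra. }
  assert (E : l - m = 0) by (apply Cmod_eq_0; pose proof (Cmod_ge_0 (l - m)); lra).
  replace l with (l - m + m) by ring. rewrite E. ring.
Qed.

Lemma Cconv_comp (phi : nat -> nat) (u : nat -> C) (l : C) :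
  filterlim phi eventually eventually -> Cconv u l -> Cconv (fun n => u (phi n)) l.
Proof.
  intros Hphi Hu. apply (is_lim_seq_subseq (fun n => Cmod (u n - l)) 0 phi Hphi Hu).
Qed.

Lemma Cconv_bounded (u : nat -> C) (l : C) :
  Cconv u l -> exists B, (0 < B)%R /\ forall n, (Cmod (u n) <= B)%R.
Proof.
  intros Hu.
  assert (Hpre : forall N, exists B, (0 < B)%R /\ forall n, (n < N)%nat -> (Cmod (u n) <= B)%R).
  { induction N as [ | N [B [HB HN]]].
    - exists 1%R. split; [lra | lia].
    - exists (B + Cmod (u N))%R. pose proof (Cmod_ge_0 (u N)). split; [lra | ].
      intros n Hn. destruct (Nat.eq_dec n N) as [-> | Hne]; [lra | ].
      specialize (HN n ltac:(lia)). lra. }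
  destruct (proj1 (Cconv_eps u l) Hu 1%R) as [N HN]; [lra | ].
  destruct (Hpre N) as [B [HB HBN]].
  pose proof (Cmod_ge_0 l).
  exists (B + Cmod l + 1)%R. split; [lra | ]. intros n.
  destruct (Nat.lt_ge_cases n N) as [Hn | Hn].
  - specialize (HBN n Hn). lra.
  - specialize (HN n Hn).
    replace (u n) with ((u n - l) + l) by ring.
    eapply Rle_trans; [apply Cmod_triangle | lra].
Qed.

Lemma Cconv_bounded_below (u : nat -> C) (l : C) :
  Cconv u l -> l <> 0 -> (forall n, u n <> 0) ->
  exists B, (0 < B)%R /\ forall n, (/ Cmod (u n) <= B)%R.
Proof.
  intros Hu Hl H0.
  destruct (Cconv_bounded _ _ (Cconv_inv u l Hu Hl)) as [B [HB H]].
  exists B. split; [exact HB | ]. intros n. rewrite <- Cmod_inv by auto. apply H.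
Qed.

(** * Finite sums and products, and series as limits of partial sums *)

Fixpoint Csum (f : nat -> C) (n : nat) : C :=
  match n with
  | O => 0
  | S k => Csum f k + f k
  end.

Fixpoint Cprod (f : nat -> C) (n : nat) : C :=
  match n with
  | O => 1
  | S k => Cprod f k * f k
  end.

Definition Cser (f : nat -> C) (l : C) : Prop := Cconv (Csum f) l.

Lemma Csum_ext (f g : nat -> C) (n : nat) :
  (forall k, (k < n)%nat -> f k = g k) -> Csum f n = Csum g n.
Proof.
  induction n as [ | n IH]; intros H; simpl; [reflexivity | ].
  rewrite IH, (H n) by auto with arith. reflexivity.
Qed.

Lemma Csum_plus (f g : nat -> C) (n : nat) :
  Csum (fun k => f k + g k) n = Csum f n + Csum g n.
Proof. induction n as [ | n IH]; simpl; [ring | rewrite IH; ring]. Qed.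

Lemma Csum_scal (c : C) (f : nat -> C) (n : nat) :
  Csum (fun k => c * f k) n = c * Csum f n.
Proof. induction n as [ | n IH]; simpl; [ring | rewrite IH; ring]. Qed.

Lemma Csum_const (c : C) (n : nat) : Csum (fun _ => c) n = INR n * c.
Proof.
  induction n as [ | n IH]; simpl Csum; [simpl; ring | ].
  rewrite IH, S_INR, RtoC_plus. ring.
Qed.

Lemma Csum_shift (f : nat -> C) (n : nat) :
  Csum f (S n) = f O + Csum (fun k => f (S k)) n.
Proof. induction n as [ | n IH]; simpl in *; [ring | rewrite IH; ring]. Qed.

Lemma Csum_swap (f : nat -> nat -> C) (n m : nat) :
  Csum (fun i => Csum (f i) m) n = Csum (fun j => Csum (fun i => f i j) n) m.
Proof.
  induction n as [ | n IH]; simpl.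
  - induction m as [ | m IHm]; simpl; [reflexivity | rewrite <- IHm; ring].
  - rewrite IH, <- Csum_plus. reflexivity.
Qed.

Lemma Cprod_ext (f g : nat -> C) (n : nat) :
  (forall k, (k < n)%nat -> f k = g k) -> Cprod f n = Cprod g n.
Proof.
  induction n as [ | n IH]; intros H; simpl; [reflexivity | ].
  rewrite IH, (H n) by auto with arith. reflexivity.
Qed.

Lemma Cprod_mult (f g : nat -> C) (n : nat) :
  Cprod (fun k => f k * g k) n = Cprod f n * Cprod g n.
Proof. induction n as [ | n IH]; simpl; [ring | rewrite IH; ring]. Qed.

Lemma Cprod_shift (f : nat -> C) (n : nat) :
  Cprod f (S n) = f O * Cprod (fun k => f (S k)) n.
Proof. induction n as [ | n IH]; simpl in *; [ring | rewrite IH; ring]. Qed.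

Lemma Cprod_neq_0 (f : nat -> C) (n : nat) :
  (forall k, (k < n)%nat -> f k <> 0) -> Cprod f n <> 0.
Proof.
  induction n as [ | n IH]; intros H; simpl.
  - apply C1_nz.
  - apply Cmult_neq_0; auto with arith.
Qed.

Lemma Cser_ext (f g : nat -> C) (l : C) :
  (forall k, f k = g k) -> Cser f l -> Cser g l.
Proof.
  intros H. apply Cconv_ext. intros n. apply Csum_ext. auto.
Qed.

Lemma Cser_plus (f g : nat -> C) (l m : C) :
  Cser f l -> Cser g m -> Cser (fun k => f k + g k) (l + m).
Proof.
  intros Hf Hg. apply Cconv_ext with (2 := Cconv_plus _ _ _ _ Hf Hg).
  intros n. now rewrite Csum_plus.
Qed.

Lemma Cser_scal (c : C) (f : nat -> C) (l : C) :
  Cser f l -> Cser (fun k => c * f k) (c * l).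
Proof.
  intros Hf. apply Cconv_ext with (2 := Cconv_scal c _ _ Hf).
  intros n. now rewrite Csum_scal.
Qed.

Lemma Cser_minus (f g : nat -> C) (l m : C) :
  Cser f l -> Cser g m -> Cser (fun k => f k - g k) (l - m).
Proof.
  intros Hf Hg. apply (Cser_scal (-1)) in Hg.
  replace (l - m) with (l + -1 * m) by ring.
  apply Cser_ext with (2 := Cser_plus _ _ _ _ Hf Hg). intros k. ring.
Qed.

Lemma Cser_unique (f : nat -> C) (l m : C) : Cser f l -> Cser f m -> l = m.
Proof. apply Cconv_unique. Qed.

Lemma filterlim_nat (phi : nat -> nat) :
  (forall N, exists K, forall n, (K <= n)%nat -> (N <= phi n)%nat) ->
  filterlim phi eventually eventually.
Proof.
  intros H P [N HN]. destruct (H N) as [K HK]. exists K. intros n Hn. apply HN. auto.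
Qed.

Lemma Cconv_S (u : nat -> C) (l : C) : Cconv u l <-> Cconv (fun n => u (S n)) l.
Proof.
  split; intros H.
  - apply Cconv_comp; [ | exact H]. apply filterlim_nat. intros N. exists N. lia.
  - apply (Cconv_comp pred) in H.
    + apply is_lim_seq_ext_loc with (2 := H). exists 1%nat. intros n Hn.
      destruct n; [lia | reflexivity].
    + apply filterlim_nat. intros N. exists (S N). lia.
Qed.

Lemma Cser_S (f : nat -> C) (l : C) :
  Cser (fun k => f (S k)) l <-> Cser f (f O + l).
Proof.
  unfold Cser. rewrite (Cconv_S (Csum f)). split; intros H.
  - apply Cconv_ext with (fun n => f O + Csum (fun k => f (S k)) n);
      [intros n; now rewrite Csum_shift | ].
    apply Cconv_plus; [apply Cconv_const | exact H].
  - replace l with (- f O + (f O + l)) by ring.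
    apply Cconv_ext with (fun n => - f O + Csum f (S n));
      [intros n; rewrite Csum_shift; ring | ].
    apply Cconv_plus; [apply Cconv_const | exact H].
Qed.

(** * Dominated convergence, double series and infinite products *)

Lemma tail_bound (b : nat -> R) :
  (forall k, (0 <= b k)%R) -> ex_series b ->
  exists T : nat -> R, is_lim_seq T 0 /\ (forall n, (0 <= T n)%R) /\
    forall f n N, (n <= N)%nat ->
      (forall k, (n <= k < N)%nat -> (Cmod (f k) <= b k)%R) ->
      (Cmod (Csum f N - Csum f n) <= T n)%R.
Proof.
  intros Hb [L HL].
  (* [B n] adds the first n terms, as [Csum] does, whereas [sum_n b k] includes the index k. The
     tail [L - B n] depends on b alone, so it serves every dominated family at once. *)
  set (B := fun n => match n with O => 0%R | S k => sum_n b k end).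
  assert (HBS : forall n, B (S n) = (B n + b n)%R).
  { intros [ | n]; simpl; [rewrite sum_O; ring | now rewrite sum_Sn]. }
  assert (Hlim : is_lim_seq B L).
  { apply is_lim_seq_incr_1. exact HL. }
  assert (Hle : forall n, (B n <= L)%R).
  { intros n. apply (is_lim_seq_incr_compare B L Hlim). intros k. rewrite HBS.
    specialize (Hb k). lra. }
  exists (fun n => L - B n)%R. split; [ | split].
  - replace 0%R with (L - L)%R by ring.
    apply is_lim_seq_minus'; [apply is_lim_seq_const | exact Hlim].
  - intros n. specialize (Hle n). lra.
  - intros f n N HnN Hf.
    apply Rle_trans with (B N - B n)%R; [ | specialize (Hle N); lra].
    induction HnN as [ | N HnN IH].
    + replace (Csum f n - Csum f n) with (RtoC 0) by ring. rewrite Cmod_0. lra.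
    + rewrite HBS. simpl Csum.
      replace (Csum f N + f N - Csum f n) with ((Csum f N - Csum f n) + f N) by ring.
      eapply Rle_trans; [apply Cmod_triangle | ].
      assert (Cmod (Csum f N - Csum f n) <= B N - B n)%R
        by (apply IH; intros k Hk; apply Hf; lia).
      assert (Cmod (f N) <= b N)%R by (apply Hf; lia). lra.
Qed.

(** Tannery's theorem, deducing the sum of the limit series from the diagonal sums. The bound on the
    block of [F N] from n to N does not depend on N, so it survives the limit in N. Starting the
    domination at K leaves room for finitely many indices where no uniform bound is at hand. *)
Lemma Cser_tannery (F : nat -> nat -> C) (f : nat -> C) (b : nat -> R) (K : nat) (l : C) :
  (forall k, (0 <= b k)%R) -> ex_series b ->
  (forall N k, (K <= k < N)%nat -> (Cmod (F N k) <= b k)%R) ->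
  (forall k, Cconv (fun N => F N k) (f k)) ->
  Cconv (fun N => Csum (F N) N) l ->
  Cser f l.
Proof.
  intros Hb0 Hb HF Hf Hl.
  destruct (tail_bound b Hb0 Hb) as [T [HT [_ Htail]]].
  apply Cconv_squeeze with T K; [ | exact HT].
  intros n Hn. rewrite <- Cmod_opp.
  assert (Hsum : forall m, Cconv (fun N => Csum (F N) m) (Csum f m)).
  { induction m as [ | m IH]; simpl; [apply Cconv_const | now apply Cconv_plus]. }
  apply Cconv_le with (fun N => Csum (F N) N - Csum (F N) n) n.
  - replace (- (Csum f n - l)) with (l - Csum f n) by ring.
    now apply Cconv_minus.
  - intros N HN. apply Htail; [exact HN | ]. intros k Hk. apply HF. lia.
Qed.

Lemma Cser_abs (f : nat -> C) (b : nat -> R) :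
  (forall k, (Cmod (f k) <= b k)%R) -> ex_series b -> exists l, Cser f l.
Proof.
  intros Hf Hb.
  assert (HR : forall p : C -> R, (forall z, Rabs (p z) <= Cmod z)%R ->
    ex_series (fun k => p (f k))).
  { intros p Hp. apply (ex_series_le (fun k => p (f k)) b); [ | exact Hb].
    intros k. eapply Rle_trans; [apply Hp | apply Hf]. }
  destruct (HR Re) as [x Hx]; [apply re_le_Cmod | ].
  destruct (HR Im) as [y Hy]; [apply im_le_Cmod | ].
  exists (x, y). unfold Cser. rewrite Cconv_S.
  assert (Hre : forall n, Re (Csum f (S n)) = sum_n (fun k => Re (f k)) n).
  { induction n as [ | n IH]; [rewrite sum_O; change (Csum f 1) with (0 + f O); now rewrite Cplus_0_l | ].
    rewrite sum_Sn, <- IH. reflexivity. }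
  assert (Him : forall n, Im (Csum f (S n)) = sum_n (fun k => Im (f k)) n).
  { induction n as [ | n IH]; [rewrite sum_O; change (Csum f 1) with (0 + f O); now rewrite Cplus_0_l | ].
    rewrite sum_Sn, <- IH. reflexivity. }
  apply Cconv_squeeze with
    (fun n => Rabs (sum_n (fun k => Re (f k)) n - x)
            + Rabs (sum_n (fun k => Im (f k)) n - y))%R O.
  - intros n _. rewrite <- Hre, <- Him.
    set (z := Csum f (S n)).
    replace (z - (x, y)) with (RtoC (Re z - x) + Ci * RtoC (Im z - y)).
    + eapply Rle_trans; [apply Cmod_triangle | ].
      rewrite Cmod_mult, Cmod_Ci, !Cmod_R. lra.
    + destruct z as [a b']. unfold Cminus, Cplus, Copp, Cmult, Ci, RtoC. simpl.
      f_equal; ring.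
  - assert (H0 : forall (s : nat -> R) (t : R), is_lim_seq s t ->
      is_lim_seq (fun n => Rabs (s n - t)) 0).
    { intros s t Hs. apply (is_lim_seq_abs_0 (fun n => s n - t)%R).
      replace 0%R with (t - t)%R by ring.
      apply is_lim_seq_minus'; [exact Hs | apply is_lim_seq_const]. }
    replace 0%R with (0 + 0)%R by ring.
    apply is_lim_seq_plus'; apply H0; [exact Hx | exact Hy].
Qed.

(** Tannery's theorem applied to the truncated columns. The sum over the square of side N differs
    from the N-th partial sum of the row sums by N row tails, which together are at most K T(0)
    T(N). *)
Lemma Cser_double_swap (f : nat -> nat -> C) (b : nat -> R) (K : R) (R' C' : nat -> C) (l : C) :
  (forall k, (0 <= b k)%R) -> ex_series b -> (0 <= K)%R ->
  (forall n m, (Cmod (f n m) <= K * (b n * b m))%R) ->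
  (forall n, Cser (f n) (R' n)) ->
  (forall m, Cser (fun n => f n m) (C' m)) ->
  Cser R' l -> Cser C' l.
Proof.
  intros Hb0 Hb HK Hf HR HC Hl.
  destruct (tail_bound b Hb0 Hb) as [T [HT [HT0 Htail]]].
  assert (Hscal : forall c (g : nat -> C) n N, (0 <= c)%R -> (n <= N)%nat ->
    (forall k, (n <= k < N)%nat -> (Cmod (g k) <= c * b k)%R) ->
    (Cmod (Csum g N - Csum g n) <= c * T n)%R).
  { intros c g n N Hc HnN Hg.
    destruct (Req_dec c 0) as [-> | Hc0].
    - assert (E : Csum g N - Csum g n = 0).
      { induction HnN as [ | N HnN IH]; [ring | ]. simpl.
        assert (g N = 0).
        { apply Cmod_eq_0. specialize (Hg N ltac:(lia)).
          pose proof (Cmod_ge_0 (g N)). lra. }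
        replace (Csum g N + g N - Csum g n) with (Csum g N - Csum g n + g N) by ring.
        rewrite IH, H; [ring | ]. intros k Hk. apply Hg. lia. }
      rewrite E, Cmod_0. lra.
    - specialize (Htail (fun k => / RtoC c * g k) n N HnN).
      assert (Hc' : RtoC c <> 0) by (intros E; apply RtoC_inj in E; lra).
      rewrite !Csum_scal in Htail.
      replace (Csum g N - Csum g n)
        with (c * (/ c * Csum g N - / c * Csum g n)) by (field; auto).
      rewrite Cmod_mult, Cmod_R, Rabs_pos_eq by lra.
      apply Rmult_le_compat_l; [lra | ]. apply Htail.
      intros k Hk. rewrite Cmod_mult, Cmod_inv, Cmod_R, Rabs_pos_eq by (auto || lra).
      apply Rmult_le_reg_l with c; [lra | ].
      replace (c * (/ c * Cmod (g k)))%R with (Cmod (g k)) by (field; lra). auto. }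
  assert (Hbsum : forall (g : nat -> C) c N, (0 <= c)%R ->
    (forall k, (Cmod (g k) <= c * b k)%R) -> (Cmod (Csum g N) <= c * T O)%R).
  { intros g c N Hc Hg. specialize (Hscal c g O N Hc ltac:(lia) (fun k _ => Hg k)).
    simpl in Hscal. replace (Csum g N - 0) with (Csum g N) in Hscal by ring. exact Hscal. }
  apply (Cser_tannery (fun N m => Csum (fun n => f n m) N) C' (fun m => K * T O * b m)%R O).
  - intros k. apply Rmult_le_pos; [ | apply Hb0]. apply Rmult_le_pos; auto.
  - now apply ex_series_Rscal.
  - intros N k _.
    replace (K * T O * b k)%R with (K * b k * T O)%R by ring.
    apply Hbsum; [apply Rmult_le_pos; auto | ].
    intros n. eapply Rle_trans; [apply Hf | ]. lra.
  - intros k. apply HC.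
  - apply Cconv_ext with
      (fun N => Csum R' N - Csum (fun n => R' n - Csum (f n) N) N).
    { intros N. rewrite <- Csum_swap.
      rewrite (Csum_ext (fun n => R' n - Csum (f n) N)
        (fun n => R' n + -1 * Csum (f n) N)) by (intros; ring).
      rewrite Csum_plus, Csum_scal. ring. }
    replace l with (l - 0) by ring.
    apply Cconv_minus; [exact Hl | ].
    apply Cconv_squeeze with (fun N => K * T O * T N)%R O.
    + intros N _.
      replace (Csum (fun n => R' n - Csum (f n) N) N - 0)
        with (Csum (fun n => R' n - Csum (f n) N) N) by ring.
      replace (K * T O * T N)%R with (K * T N * T O)%R by ring.
      apply Hbsum; [apply Rmult_le_pos; auto | ].
      intros n.
      apply Cconv_le with (fun M => Csum (f n) M - Csum (f n) N) N.
      * apply Cconv_minus; [apply HR | apply Cconv_const].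
      * intros M HM. replace (K * T N * b n)%R with (K * b n * T N)%R by ring.
        apply Hscal; [apply Rmult_le_pos; auto | exact HM | ].
        intros k _. eapply Rle_trans; [apply Hf | ]. lra.
    + replace 0%R with (K * T O * 0)%R by ring.
      apply is_lim_seq_mult'; [apply is_lim_seq_const | exact HT].
Qed.

(** The partial products P stay bounded by the exponential of the sum of b, because 1 + x is at most
    exp x. Their increments [P n * a n] are therefore summable, and P converges as a telescoping
    series. *)
Lemma Cprod_conv (a : nat -> C) (b : nat -> R) :
  (forall k, (Cmod (a k) <= b k)%R) -> ex_series b ->
  exists l, Cconv (Cprod (fun k => 1 + a k)) l.
Proof.
  intros Ha Hb.
  assert (Hb0 : forall k, (0 <= b k)%R).
  { intros k. eapply Rle_trans; [apply Cmod_ge_0 | apply Ha]. }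
  set (P := Cprod (fun k => 1 + a k)).
  assert (HP : exists B, (0 <= B)%R /\ forall n, (Cmod (P n) <= B)%R).
  { destruct (tail_bound b Hb0 Hb) as [T [_ [HT0 HT]]].
    exists (exp (T O)). split; [left; apply exp_pos | ]. intros n.
    apply Rle_trans with (exp (Re (Csum (fun k => RtoC (b k)) n))).
    - induction n as [ | n IH].
      + simpl. rewrite exp_0. unfold P. simpl. rewrite Cmod_1. lra.
      + unfold P. simpl Cprod. rewrite Cmod_mult. simpl Csum.
        change (Re (Csum (fun k => RtoC (b k)) n + b n))
          with (Re (Csum (fun k => RtoC (b k)) n) + b n)%R.
        rewrite exp_plus.
        apply Rmult_le_compat; try apply Cmod_ge_0; [exact IH | ].
        eapply Rle_trans; [apply Cmod_triangle | ]. rewrite Cmod_1.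
        eapply Rle_trans; [ | apply exp_ineq1_le]. specialize (Ha n). lra.
    - assert (Hle : (Re (Csum (fun k => RtoC (b k)) n) <= T O)%R).
      { eapply Rle_trans; [apply Rle_abs | ].
        eapply Rle_trans; [apply re_le_Cmod | ].
        specialize (HT (fun k => RtoC (b k)) O n ltac:(lia)).
        simpl in HT. replace (Csum (fun k => RtoC (b k)) n - 0)
          with (Csum (fun k => RtoC (b k)) n) in HT by ring.
        apply HT. intros k _. rewrite Cmod_R, Rabs_pos_eq; auto. lra. }
      destruct Hle as [Hlt | ->]; [left; now apply exp_increasing | lra]. }
  destruct HP as [B [HB HP]].
  destruct (Cser_abs (fun n => P n * a n) (fun n => B * b n)%R) as [l Hl].
  - intros k. rewrite Cmod_mult.
    apply Rmult_le_compat; try apply Cmod_ge_0; auto.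
  - now apply ex_series_Rscal.
  - exists (1 + l). apply Cconv_ext with (fun n => 1 + Csum (fun n => P n * a n) n).
    + induction n as [ | n IH]; [unfold P; simpl; ring | ].
      change (P (S n)) with (P n * (1 + a n)).
      change (Csum (fun n => P n * a n) (S n))
        with (Csum (fun n => P n * a n) n + P n * a n).
      rewrite Cplus_assoc, IH. ring.
    + apply Cconv_plus; [apply Cconv_const | exact Hl].
Qed.

Lemma ex_series_term_conv (a : nat -> C) (b : nat -> R) :
  (forall k, (Cmod (a k) <= b k)%R) -> ex_series b -> Cconv a 0.
Proof.
  intros Ha Hb. apply Cconv_squeeze with b O.
  - intros n _. replace (a n - 0) with (a n) by ring. auto.
  - now apply ex_series_lim_0.
Qed.

(** The inverse factors have the same shape, 1/(1 + a) = 1 - a/(1 + a), with a/(1 + a) again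
    summable. Their product converges too, and the two limits multiply to 1. *)
Lemma Cprod_conv_neq_0 (a : nat -> C) (b : nat -> R) :
  (forall k, (Cmod (a k) <= b k)%R) -> ex_series b -> (forall k, 1 + a k <> 0) ->
  exists l : C, l <> 0 /\ Cconv (Cprod (fun k => 1 + a k)) l.
Proof.
  intros Ha Hb Hn0.
  destruct (Cprod_conv a b Ha Hb) as [l Hl].
  pose proof (Cconv_plus _ _ _ _ (Cconv_const 1) (ex_series_term_conv a b Ha Hb)) as H1.
  rewrite Cplus_0_r in H1.
  destruct (Cconv_bounded_below _ _ H1 C1_nz Hn0) as [B [HB HBn]].
  destruct (Cprod_conv (fun k => - a k / (1 + a k)) (fun k => B * b k)%R) as [m Hm].
  - intros k. rewrite Cmod_div, Cmod_opp by auto. unfold Rdiv. rewrite Rmult_comm.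
    apply Rmult_le_compat; try apply Cmod_ge_0; auto.
    left. apply Rinv_0_lt_compat. now apply Cmod_gt_0.
  - now apply ex_series_Rscal.
  - exists l. split; [ | exact Hl]. intros ->.
    apply C1_nz. apply (Cconv_unique (fun _ => 1)); [apply Cconv_const | ].
    replace (RtoC 0) with (0 * m) by ring.
    apply Cconv_ext with (2 := Cconv_mult _ _ _ _ Hl Hm).
    intros n. rewrite <- Cprod_mult. induction n as [ | n IH]; simpl; [reflexivity | ].
    rewrite IH. field. auto.
Qed.

(** * The exponential and bilateral sums *)

Lemma C_eq (z w : C) : Re z = Re w -> Im z = Im w -> z = w.
Proof. destruct z, w; simpl; intros; congruence. Qed.

Lemma qof_alt (z : C) :
  qof z = (exp (- (2 * PI * Im z)) * cos (2 * PI * Re z),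
           exp (- (2 * PI * Im z)) * sin (2 * PI * Re z))%R.
Proof.
  unfold qof, cexp. destruct z as [x y]. simpl.
  f_equal; f_equal; f_equal; ring.
Qed.

Lemma qof_plus (z w : C) : qof (z + w) = qof z * qof w.
Proof.
  rewrite !qof_alt. destruct z as [x y], w as [x' y']. simpl.
  replace (- (2 * PI * (y + y')))%R with (- (2 * PI * y) + - (2 * PI * y'))%R by ring.
  rewrite !Rmult_plus_distr_l, exp_plus, cos_plus, sin_plus.
  apply C_eq; simpl; ring.
Qed.

Lemma qof_0 : qof 0 = 1.
Proof.
  rewrite qof_alt. simpl. rewrite !Rmult_0_r, Ropp_0, exp_0, cos_0, sin_0.
  apply C_eq; simpl; ring.
Qed.

Lemma qof_1 : qof 1 = 1.
Proof.
  rewrite qof_alt. simpl. rewrite Rmult_0_r, Rmult_1_r, Ropp_0, exp_0, cos_2PI, sin_2PI.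
  apply C_eq; simpl; ring.
Qed.

Lemma qof_neq_0 (z : C) : qof z <> 0.
Proof.
  intros H. apply C1_nz. rewrite <- qof_0. replace (RtoC 0) with (z + - z) by ring.
  rewrite qof_plus, H. ring.
Qed.

Lemma qof_opp (z : C) : qof (- z) = / qof z.
Proof.
  pose proof (qof_neq_0 z).
  replace (/ qof z) with (/ qof z * qof (z + - z))
    by (replace (z + - z) with (RtoC 0) by ring; rewrite qof_0; ring).
  rewrite qof_plus. field. exact H.
Qed.

Lemma qof_pow (n : nat) (z : C) : qof (INR n * z) = qof z ^ n.
Proof.
  induction n as [ | n IH].
  - simpl. rewrite Cmult_0_l. apply qof_0.
  - rewrite S_INR, RtoC_plus. replace ((INR n + 1) * z) with (z + INR n * z) by ring.
    rewrite qof_plus, IH. reflexivity.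
Qed.

Lemma qof_IZR (k : Z) : qof (IZR k) = 1.
Proof.
  assert (H : forall n : nat, qof (INR n) = 1).
  { intros n. replace (RtoC (INR n)) with (INR n * 1) by ring.
    rewrite qof_pow, qof_1. apply Cpow_1_l. }
  destruct (Z_le_gt_dec 0 k) as [Hk | Hk].
  - replace k with (Z.of_nat (Z.to_nat k)) by lia. rewrite <- INR_IZR_INZ. apply H.
  - replace k with (- Z.of_nat (Z.to_nat (- k)))%Z by lia.
    rewrite opp_IZR, RtoC_opp, qof_opp, <- INR_IZR_INZ, H. field.
Qed.

Lemma qof_period (z : C) (k : Z) : qof (z + IZR k) = qof z.
Proof. rewrite qof_plus, qof_IZR. ring. Qed.

Lemma Cmod_qof (z : C) : Cmod (qof z) = exp (- (2 * PI * Im z)).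
Proof.
  rewrite qof_alt. unfold Cmod. simpl fst. simpl snd.
  set (r := exp _). set (t := (2 * PI * Re z)%R).
  replace ((r * cos t) ^ 2 + (r * sin t) ^ 2)%R with (r * r)%R.
  - apply sqrt_square. left. apply exp_pos.
  - pose proof (sin2_cos2 t) as H. unfold Rsqr in H.
    transitivity (r * r * (sin t * sin t + cos t * cos t))%R; [rewrite H; ring | ring].
Qed.

Lemma Cmod_qof_lt_1 (z : C) : (0 < Im z)%R -> (0 < Cmod (qof z) < 1)%R.
Proof.
  intros Hz. rewrite Cmod_qof. split; [apply exp_pos | ].
  replace 1%R with (exp 0) by apply exp_0. apply exp_increasing. pose proof PI_RGT_0. nra.
Qed.

Lemma qof_neq_1_Im (z : C) : Im z <> 0%R -> qof z <> 1.
Proof.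
  intros Hz E.
  assert (H : Cmod (qof z) = 1%R) by (rewrite E; apply Cmod_1).
  rewrite Cmod_qof, <- exp_0 in H. apply exp_inv in H.
  pose proof PI_RGT_0. apply Hz. nra.
Qed.

(** A bound uniform in the imaginary part: it measures the distance from 1 to a ray of angle 2 pi x.
    With c and s the cosine and sine, the square of the distance is (r - c)^2 + s^2, so |s| suffices
    for |x| up to 1/4; beyond that c <= 0 and the distance is at least 1. The range 3/4 is what the
    division points in [kappa_div_bound] need. *)
Lemma Re_le_Cmod_1_minus_qof (z : C) :
  (Rabs (Re z) <= 3 / 4)%R -> (Rabs (Re z) <= Cmod (1 - qof z))%R.
Proof.
  intros Hz. rewrite qof_alt.
  set (r := exp _). set (x := Rabs (Re z)) in *.
  assert (Hx : (0 <= x)%R) by apply Rabs_pos.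
  assert (Hc : cos (2 * PI * Re z) = cos (2 * PI * x)).
  { unfold x, Rabs. destruct (Rcase_abs (Re z)); [ | reflexivity].
    rewrite <- cos_neg. f_equal. ring. }
  assert (Hr : (0 < r)%R) by apply exp_pos.
  unfold Cmod. rewrite <- (sqrt_square x Hx). apply sqrt_le_1_alt.
  pose proof (sin2_cos2 (2 * PI * Re z)) as H2. unfold Rsqr in H2.
  simpl. set (s := sin (2 * PI * Re z)) in *. set (c := cos (2 * PI * Re z)) in *.
  replace ((1 + - (r * c)) * ((1 + - (r * c)) * 1)
    + (0 + - (r * s)) * ((0 + - (r * s)) * 1))%R
    with (1 - 2 * r * c + r * r)%R
    by (transitivity (1 - 2 * r * c + r * r * (s * s + c * c))%R; [rewrite H2 | ]; ring).
  pose proof PI_RGT_0 as HPI. pose proof PI_4 as HPI4. pose proof PI2_3_2 as HPI3.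
  destruct (Rle_dec x (1 / 4)) as [Hx4 | Hx4].
  - assert (Ha : (6 * x <= 2 * PI * x <= 2)%R).
    { assert (PI * x <= PI * (1 / 4))%R by (apply Rmult_le_compat_l; lra).
      assert (3 * x <= PI * x)%R by (apply Rmult_le_compat_r; lra). lra. }
    assert (Hs : (x <= sin (2 * PI * x))%R).
    { set (a := (2 * PI * x)%R) in *.
      destruct (pre_sin_bound a 0) as [Hs _]; [lra | lra | ].
      eapply Rle_trans; [ | exact Hs].
      replace (sin_approx a (2 * 0 + 1)) with (a - a * a * a / 6)%R
        by (unfold sin_approx, sin_term; simpl; field).
      assert (a * a <= 4)%R by nra. nra. }
    pose proof (sin2_cos2 (2 * PI * x)) as H3. unfold Rsqr in H3.
    rewrite <- Hc in H3. fold c in H3.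
    assert (x * x <= sin (2 * PI * x) * sin (2 * PI * x))%R
      by (apply Rmult_le_compat; assumption).
    pose proof (Rle_0_sqr (r - c)) as H4. unfold Rsqr in H4.
    nra.
  - assert (Hcn : (c <= 0)%R).
    { rewrite Hc. apply cos_le_0; nra. }
    nra.
Qed.

Lemma qof_real_neq_1 (x : R) : (0 < x < 1)%R -> qof x <> 1.
Proof.
  intros Hx E.
  destruct (Rle_dec x (3 / 4)) as [H | H].
  - pose proof (Re_le_Cmod_1_minus_qof x) as Hb. rewrite E in Hb. simpl in Hb.
    replace (1 - 1) with (RtoC 0) in Hb by ring. rewrite Cmod_0, Rabs_pos_eq in Hb by lra. lra.
  - assert (E' : qof (x - 1)%R = 1).
    { rewrite RtoC_minus. replace (x - 1) with (x + IZR (-1)) by ring.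
      now rewrite qof_period. }
    pose proof (Re_le_Cmod_1_minus_qof (x - 1)%R) as Hb. rewrite E' in Hb. simpl in Hb.
    replace (1 - 1) with (RtoC 0) in Hb by ring.
    rewrite Cmod_0, Rabs_left1 in Hb by lra. lra.
Qed.

(** The derivative of [qof] at 0 along real multiples of z; it is used with steps 1/(2N+1), once for
    the limit of the division terms and once to bound a difference of exponentials. *)
Lemma qof_derive (z : C) (h : nat -> R) :
  is_lim_seq h 0 -> (forall n, h n <> 0%R) ->
  Cconv (fun n => (1 - qof (h n * z)) / h n) (- (2 * PI * Ci * z)).
Proof.
  intros Hh Hh0.
  assert (Hlim : forall (f : R -> R) (l : R), is_derive f 0 l ->
    is_lim_seq (fun n => Rabs ((f (h n) - f 0%R) / h n - l))%R 0).
  { intros f l Hf. apply is_derive_Reals in Hf.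
    apply is_lim_seq_spec. intros eps.
    destruct (Hf eps (cond_pos eps)) as [d Hd].
    apply is_lim_seq_spec in Hh. destruct (Hh d) as [N HN]. exists N. intros n Hn.
    specialize (HN n Hn). rewrite Rminus_0_r in *. rewrite Rabs_Rabsolu.
    specialize (Hd (h n) (Hh0 n) HN). now rewrite Rplus_0_l in Hd. }
  set (a := (- (2 * PI * Im z))%R). set (b := (2 * PI * Re z)%R).
  pose proof (Hlim (fun s => exp (s * a) * cos (s * b))%R a) as H1.
  pose proof (Hlim (fun s => exp (s * a) * sin (s * b))%R b) as H2.
  cbv beta in H1, H2. rewrite !Rmult_0_l, exp_0, cos_0, sin_0 in *.
  apply Cconv_squeeze with (fun n =>
    Rabs ((exp (h n * a) * cos (h n * b) - 1 * 1) / h n - a)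
    + Rabs ((exp (h n * a) * sin (h n * b) - 1 * 0) / h n - b))%R O.
  - intros n _. rewrite <- Cmod_opp. set (s := h n).
    replace (- ((1 - qof (s * z)) / s - - (2 * PI * Ci * z)))
      with (RtoC ((exp (s * a) * cos (s * b) - 1 * 1) / s - a)
        + Ci * RtoC ((exp (s * a) * sin (s * b) - 1 * 0) / s - b)).
    + eapply Rle_trans; [apply Cmod_triangle | ].
      rewrite Cmod_mult, Cmod_Ci, !Cmod_R. lra.
    + assert (Hs : s <> 0%R) by apply Hh0.
      replace (2 * PI * Ci * z) with ((a, b) : C)
        by (unfold a, b; destruct z; apply C_eq; simpl; ring).
      rewrite qof_alt.
      replace (- (2 * PI * Im (s * z)))%R with (s * a)%R
        by (unfold a; destruct z; simpl; ring).
      replace (2 * PI * Re (s * z))%R with (s * b)%R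
        by (unfold b; destruct z; simpl; ring).
      unfold Cdiv. rewrite <- RtoC_inv by exact Hs.
      apply C_eq; simpl; field; exact Hs.
  - assert (D1 : is_derive (fun s : R => (exp (s * a) * cos (s * b))%R) 0 a)
      by (auto_derive; trivial; rewrite !Rmult_0_l, exp_0, cos_0, sin_0; ring).
    assert (D2 : is_derive (fun s : R => (exp (s * a) * sin (s * b))%R) 0 b)
      by (auto_derive; trivial; rewrite !Rmult_0_l, exp_0, cos_0, sin_0; ring).
    pose proof (is_lim_seq_plus' _ _ _ _ (H1 D1) (H2 D2)) as H.
    rewrite Rplus_0_r in H. exact H.
Qed.

(* [fold f k] groups the indices [k] and [-k], so that [Cser (fold f)] is the sum
   of [f] over [Z] by symmetric partial sums. *)
Definition fold (f : Z -> C) (k : nat) : C :=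
  match k with
  | O => f 0%Z
  | S _ => f (Z.of_nat k) + f (- Z.of_nat k)%Z
  end.

Lemma fold_ext (f g : Z -> C) (k : nat) : (forall m, f m = g m) -> fold f k = fold g k.
Proof. intros H. destruct k; simpl; now rewrite !H. Qed.

Lemma fold_plus (f g : Z -> C) (k : nat) :
  fold (fun m => f m + g m) k = fold f k + fold g k.
Proof. destruct k; simpl; ring. Qed.

Lemma fold_scal (c : C) (f : Z -> C) (k : nat) :
  fold (fun m => c * f m) k = c * fold f k.
Proof. destruct k; simpl; ring. Qed.

Lemma fold_opp_index (f : Z -> C) (k : nat) : fold (fun m => f (- m)%Z) k = fold f k.
Proof.
  destruct k; simpl; [reflexivity | ]. rewrite Cplus_comm. reflexivity.
Qed.

Lemma fold_bound (f : Z -> C) (k : nat) (B : R) :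
  (forall m, Z.abs_nat m = k -> (Cmod (f m) <= B)%R) -> (Cmod (fold f k) <= 2 * B)%R.
Proof.
  intros H. destruct k as [ | k]; unfold fold.
  - pose proof (H 0%Z eq_refl). pose proof (Cmod_ge_0 (f 0%Z)). lra.
  - pose proof (H (Z.of_nat (S k)) ltac:(lia)). pose proof (H (- Z.of_nat (S k))%Z ltac:(lia)).
    eapply Rle_trans; [apply Cmod_triangle | ]. lra.
Qed.

Lemma Cconv_fold (f : nat -> Z -> C) (g : Z -> C) (k : nat) :
  (forall m, Cconv (fun n => f n m) (g m)) -> Cconv (fun n => fold (f n) k) (fold g k).
Proof. intros H. destruct k; simpl; [apply H | apply Cconv_plus; apply H]. Qed.

Lemma Csum_fold (f : Z -> C) (N : nat) :
  Csum (fold f) (S N) = Csum (fun i => f (Z.of_nat i - Z.of_nat N)%Z) (2 * N + 1).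
Proof.
  induction N as [ | N IH]; [reflexivity | ].
  assert (HS : forall g n, Csum g (S n) = Csum g n + g n) by reflexivity.
  rewrite HS, IH. replace (2 * S N + 1)%nat with (S (S (2 * N + 1))) by lia.
  rewrite Csum_shift, HS.
  rewrite (Csum_ext (fun k => f (Z.of_nat (S k) - Z.of_nat (S N))%Z)
    (fun i => f (Z.of_nat i - Z.of_nat N)%Z)) by (intros; f_equal; lia).
  unfold fold. replace (Z.of_nat (S (2 * N + 1)) - Z.of_nat (S N))%Z
    with (Z.of_nat (S N)) by lia.
  replace (Z.of_nat 0 - Z.of_nat (S N))%Z with (- Z.of_nat (S N))%Z by lia. ring.
Qed.

(* A lattice term is bounded by a product of three inverse linear forms, each at most a
   constant times ((1 + |n|)(1 + |m|))^(-1/2); hence the exponent 3/2. *)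
Definition weight (k : nat) : R := / sqrt (INR k + 1) ^ 3.

Lemma weight_pos (k : nat) : (0 < weight k)%R.
Proof.
  apply Rinv_0_lt_compat, pow_lt, sqrt_lt_R0. pose proof (pos_INR k). lra.
Qed.

(** Comparison with a telescoping series. With x = sqrt(k+1) and y = sqrt(k+2), 1/x - 1/y = 1/(x y
    (x + y)), and y <= 2x bounds the denominator by 16 x^3. *)
Lemma weight_summable : ex_series weight.
Proof.
  set (s := fun k => sqrt (INR k + 1)).
  assert (Hs2 : forall k, (s k * s k = INR k + 1)%R).
  { intros k. apply sqrt_sqrt. pose proof (pos_INR k). lra. }
  assert (Hs : forall k, (0 < s k)%R).
  { intros k. apply sqrt_lt_R0. pose proof (pos_INR k). lra. }
  apply (ex_series_le weight (fun k => 16 * (/ s k - / s (S k)))%R).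
  - intros k. unfold norm. simpl. unfold abs. simpl.
    rewrite Rabs_pos_eq by (left; apply weight_pos).
    unfold weight. fold (s k).
    pose proof (Hs k). pose proof (Hs (S k)). pose proof (Hs2 k) as E1.
    pose proof (Hs2 (S k)) as E2. rewrite S_INR in E2. pose proof (pos_INR k).
    set (x := s k) in *. set (y := s (S k)) in *.
    assert (Hyx : (y * y - x * x = 1)%R) by lra.
    assert (Hxy : (x <= y)%R) by nra.
    assert (Hy2 : (y <= 2 * x)%R) by nra.
    replace (/ x - / y)%R with (/ (x * y * (x + y)))%R.
    + replace (/ x ^ 3)%R with (16 * / (16 * x ^ 3))%R by (field; lra).
      apply Rmult_le_compat_l; [lra | ].
      apply Rinv_le_contravar; [repeat apply Rmult_lt_0_compat; lra | ].
      replace (16 * x ^ 3)%R with (x * (2 * x) * (8 * x))%R by ring.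
      apply Rmult_le_compat; nra.
    + replace (/ x - / y)%R with ((y - x) / (x * y))%R by (field; lra).
      replace (y - x)%R with (/ (x + y))%R; [field; lra | ].
      apply Rmult_eq_reg_l with (x + y)%R; [ | lra].
      rewrite Rinv_r by lra. lra.
  - apply ex_series_Rscal.
    assert (E : forall n, sum_n (fun k => / s k - / s (S k))%R n = (/ s O - / s (S n))%R).
    { induction n as [ | n IH]; [now rewrite sum_O | ].
      rewrite sum_Sn, IH. unfold plus. simpl. ring. }
    destruct (ex_finite_lim_seq_incr (sum_n (fun k => / s k - / s (S k))%R) (/ s O)%R) as [l Hl].
    + intros n. rewrite !E. pose proof (Hs (S n)). pose proof (Hs (S (S n))).
      assert (/ s (S (S n)) <= / s (S n))%R; [ | lra].
      apply Rinv_le_contravar; [lra | ]. apply sqrt_le_1_alt. rewrite !S_INR. lra.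
    + intros n. rewrite E. pose proof (Rinv_0_lt_compat _ (Hs (S n))). lra.
    + now exists l.
Qed.

(** Lets the quadratic decay of one-variable sums use the majorant already needed for the double
    sum. *)
Lemma inv_sqr_le_weight (k : nat) : (1 <= k)%nat -> (/ (INR k * INR k) <= 4 * weight k)%R.
Proof.
  intros Hk. apply (le_INR 1) in Hk. simpl in Hk. unfold weight.
  set (s := sqrt (INR k + 1)).
  assert (Hs : (s * s = INR k + 1)%R) by (apply sqrt_sqrt; lra).
  assert (Hs0 : (0 <= s)%R) by apply sqrt_pos.
  assert (Hs1 : (1 <= s)%R) by nra.
  replace (4 * / s ^ 3)%R with (/ (s ^ 3 / 4))%R by (field; nra).
  apply Rinv_le_contravar; [simpl; nra | ].
  assert (s ^ 3 <= (s * s) * (s * s))%R by (simpl; nra).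
  rewrite Hs in H. nra.
Qed.

(** This is 1/2 + (i/2) cot(pi z). In this normalization it tends geometrically to 1 and to 0 at the
    two ends of a line w + n t with Im t > 0. *)
Definition kappa (z : C) : C := / (1 - qof z).

Lemma one_minus_qof_neq_0 (z : C) : qof z <> 1 -> 1 - qof z <> 0.
Proof.
  intros H E. apply H. replace (qof z) with (1 - (1 - qof z)) by ring. rewrite E. ring.
Qed.

Lemma qof_div_neq_1 (z : C) (m : Z) (M : nat) : (0 < M)%nat -> qof z <> 1 ->
  qof ((z + IZR m) / INR M) <> 1.
Proof.
  intros HM Hz E. apply Hz. rewrite <- (qof_period z m).
  replace (z + IZR m) with (INR M * ((z + IZR m) / INR M)).
  - rewrite qof_pow, E. apply Cpow_1_l.
  - field. apply lt_INR in HM. simpl in HM. intros H. apply RtoC_inj in H. lra.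
Qed.

Lemma Csum_geom (w : C) (n : nat) : (1 - w) * Csum (fun j => w ^ j) n = 1 - w ^ n.
Proof.
  induction n as [ | n IH]; simpl; [ring | ].
  rewrite Cmult_plus_distr_l, IH. ring.
Qed.

(* Expand each summand as a finite geometric series in an M-th root of [qof z]; the sum
   over the M roots kills all terms but the constant one. *)
Lemma kappa_distribution (z : C) (N : nat) : qof z <> 1 ->
  Csum (fold (fun m => kappa ((z + IZR m) / INR (2 * N + 1)))) (S N)
  = INR (2 * N + 1) * kappa z.
Proof.
  intros Hz. rewrite Csum_fold. set (M := (2 * N + 1)%nat).
  assert (HM : (0 < M)%nat) by lia.
  assert (HMR : (0 < INR M)%R) by (apply lt_INR in HM; exact HM).
  assert (HMC : RtoC (INR M) <> 0) by (intros E; apply RtoC_inj in E; lra).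
  set (w := fun i => qof ((z + IZR (Z.of_nat i - Z.of_nat N)) / INR M)).
  assert (Hw : forall i, w i <> 1) by (intros i; now apply qof_div_neq_1).
  assert (HwM : forall i, w i ^ M = qof z).
  { intros i. unfold w. rewrite <- qof_pow.
    replace (INR M * ((z + IZR (Z.of_nat i - Z.of_nat N)) / INR M))
      with (z + IZR (Z.of_nat i - Z.of_nat N)) by (field; exact HMC).
    apply qof_period. }
  transitivity (Csum (fun i => kappa z * Csum (fun j => w i ^ j) M) M).
  { apply Csum_ext. intros i _. unfold kappa. fold (w i).
    pose proof (one_minus_qof_neq_0 z Hz) as Hz1.
    assert (Hwi : 1 - w i <> 0) by (apply one_minus_qof_neq_0, Hw).
    transitivity (/ (1 - w i) * / (1 - qof z) * ((1 - w i) * Csum (fun j => w i ^ j) M));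
      [rewrite Csum_geom, HwM | ]; field; auto. }
  rewrite Csum_scal, Csum_swap, Cmult_comm. f_equal.
  set (om := qof (/ INR M)).
  assert (Hwi : forall i, w i = w O * om ^ i).
  { intros i. unfold w, om. rewrite <- qof_pow, <- qof_plus. f_equal.
    rewrite !minus_IZR, <- !INR_IZR_INZ, !RtoC_minus. simpl. field. exact HMC. }
  assert (HMS : M = S (2 * N)) by lia.
  transitivity (Csum (fun j => Csum (fun i => w i ^ j) M) (S (2 * N)));
    [now rewrite <- HMS | ].
  rewrite Csum_shift.
  rewrite (Csum_ext (fun k => Csum (fun i => w i ^ S k) M) (fun _ => 0)).
  - rewrite Csum_const, (Csum_ext _ (fun _ => 1)) by reflexivity.
    rewrite Csum_const. ring.
  - intros k Hk.
    rewrite (Csum_ext _ (fun i => w O ^ S k * (om ^ S k) ^ i)).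
    + rewrite Csum_scal.
      assert (Hom : 1 - om ^ S k <> 0).
      { unfold om. rewrite <- qof_pow. apply one_minus_qof_neq_0.
        rewrite <- RtoC_inv, <- RtoC_mult by lra. apply qof_real_neq_1.
        assert (H1 : (0 < INR (S k))%R) by (apply lt_0_INR; lia).
        assert (H2 : (INR (S k) < INR M)%R) by (apply lt_INR; lia).
        split.
        - apply Rmult_lt_0_compat; [lra | now apply Rinv_0_lt_compat].
        - apply Rmult_lt_reg_r with (INR M); [lra | ].
          rewrite Rmult_assoc, Rinv_l; lra. }
      assert (E : (1 - om ^ S k) * Csum (fun i => (om ^ S k) ^ i) M = 0).
      { rewrite Csum_geom, <- Cpow_mult_r, Nat.mul_comm, Cpow_mult_r.
        assert (HomM : om ^ M = 1).
        { unfold om. rewrite <- qof_pow, Cinv_r by exact HMC. apply qof_1. }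
        rewrite HomM, Cpow_1_l. ring. }
      transitivity (w O ^ S k * / (1 - om ^ S k)
        * ((1 - om ^ S k) * Csum (fun i => (om ^ S k) ^ i) M));
        [ | rewrite E; ring].
      set (s := Csum _ M). set (o := om ^ S k) in *. field. exact Hom.
    + intros i _. rewrite Hwi, Cpow_mult_l, <- !Cpow_mult_r. f_equal. f_equal. lia.
Qed.

(** * Partial fractions of [kappa] *)

Lemma Csum_fold_lin (c : C) (f g : Z -> C) (n : nat) :
  Csum (fold (fun m => c * (f m - g m))) n = c * (Csum (fold f) n - Csum (fold g) n).
Proof.
  induction n as [ | n IH]; simpl Csum; [ring | ].
  rewrite IH. destruct n; simpl; ring.
Qed.

Lemma qof_shift_neq_0 (z : C) (m : Z) : qof z <> 1 -> z + IZR m <> 0.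
Proof.
  intros Hz E. apply Hz. rewrite <- (qof_period z m), E. apply qof_0.
Qed.

Lemma two_PI_Ci_neq_0 : 2 * PI * Ci <> 0.
Proof.
  intros E. apply (f_equal Im) in E. simpl in E. pose proof PI_RGT_0. nra.
Qed.

Lemma odd_INR (N : nat) : (1 <= N)%nat -> (INR (2 * N - 1) = 2 * INR N - 1)%R.
Proof. intros H. rewrite minus_INR, mult_INR by lia. simpl. ring. Qed.

Lemma odd_INR_pos (N : nat) : (1 <= N)%nat -> (0 < INR (2 * N - 1))%R.
Proof. intros H. apply lt_0_INR. lia. Qed.

Lemma odd_INR_inv_lim : is_lim_seq (fun N => / INR (2 * S N - 1))%R 0.
Proof.
  apply is_lim_seq_le_le with (fun _ => 0%R) (fun N => / INR (S N))%R.
  - intros n. split.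
    + left. apply Rinv_0_lt_compat, lt_0_INR. lia.
    + apply Rinv_le_contravar; [apply lt_0_INR | apply le_INR]; lia.
  - apply is_lim_seq_const.
  - apply (is_lim_seq_inv (fun N => INR (S N)) p_infty).
    + apply (is_lim_seq_incr_1 INR). apply is_lim_seq_INR.
    + discriminate.
Qed.

(** The pole of [kappa] at 0 is simple with residue -1/(2 pi i), and the argument shrinks to 0 like
    1/(2N-1). *)
Lemma kappa_div_lim (z : C) (m : Z) : qof z <> 1 ->
  Cconv (fun N => / INR (2 * N - 1) * kappa ((z + IZR m) / INR (2 * N - 1)))
    (- / (2 * PI * Ci) * / (z + IZR m)).
Proof.
  (* At N = 0 truncated subtraction makes 2N - 1 equal to 0, so the sequence is taken from N = 1
     on. *)
  intros Hz. apply Cconv_S.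
  pose proof (qof_shift_neq_0 z m Hz) as Hzm. pose proof two_PI_Ci_neq_0 as Hpi.
  assert (HM : forall N, RtoC (INR (2 * S N - 1)) <> 0).
  { intros N E. apply RtoC_inj in E. pose proof (odd_INR_pos (S N) ltac:(lia)). lra. }
  assert (HMR : forall N, (INR (2 * S N - 1) <> 0)%R).
  { intros N E. apply (HM N). now rewrite E. }
  pose proof (qof_derive (z + IZR m) (fun N => / INR (2 * S N - 1))%R odd_INR_inv_lim
    (fun N => Rinv_neq_0_compat _ (HMR N))) as H.
  apply Cconv_inv in H.
  - replace (- / (2 * PI * Ci) * / (z + IZR m)) with (/ - (2 * PI * Ci * (z + IZR m))).
    + apply Cconv_ext with (2 := H). intros N. unfold kappa.
      assert (Hq : 1 - qof ((z + IZR m) / INR (2 * S N - 1)) <> 0).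
      { apply one_minus_qof_neq_0, qof_div_neq_1; [lia | exact Hz]. }
      rewrite RtoC_inv by apply HMR.
      replace (/ INR (2 * S N - 1) * (z + IZR m))
        with ((z + IZR m) / INR (2 * S N - 1)) by apply Cmult_comm.
      specialize (HM N).
      set (c := INR (2 * S N - 1)) in *. set (q := qof _) in *. field. auto.
    + set (p := 2 * PI * Ci) in *. field. auto.
  - intros E. set (p := 2 * PI * Ci) in *.
    assert (E' : p * (z + IZR m) = 0)
      by (replace (p * (z + IZR m)) with (- - (p * (z + IZR m))) by ring; rewrite E; ring).
    apply (Cmult_neq_0 p (z + IZR m)); auto.
Qed.

Lemma kappa_minus (z w : C) : qof z <> 1 -> qof w <> 1 ->
  kappa z - kappa w = (qof z - qof w) / ((1 - qof z) * (1 - qof w)).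
Proof.
  intros Hz Hw. apply one_minus_qof_neq_0 in Hz, Hw. unfold kappa. field. auto.
Qed.

(** Writing the difference as (a - b)/((1 - a)(1 - b)), the numerator is at most E D / M while both
    denominators are at least |m|/(2M). With the outer 1/M all powers of M cancel, leaving 4 E D /
    m^2 uniformly in N. *)
Lemma kappa_div_bound (z1 z2 : C) : qof z1 <> 1 -> qof z2 <> 1 ->
  exists B : R, exists K : nat, (0 <= B)%R /\ (1 <= K)%nat /\ forall N (m : Z),
    (K <= Z.abs_nat m)%nat -> (Z.abs_nat m < N)%nat ->
    (Cmod (/ INR (2 * N - 1) * (kappa ((z1 + IZR m) / INR (2 * N - 1))
        - kappa ((z2 + IZR m) / INR (2 * N - 1))))
      <= B * weight (Z.abs_nat m))%R.
Proof.
  intros Hz1 Hz2.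
  assert (HM0 : forall N, (INR (2 * S N - 1) <> 0)%R).
  { intros N. pose proof (odd_INR_pos (S N) ltac:(lia)). lra. }
  pose proof (qof_derive (z1 - z2) (fun N => / INR (2 * S N - 1))%R odd_INR_inv_lim
    (fun N => Rinv_neq_0_compat _ (HM0 N))) as HD.
  destruct (Cconv_bounded _ _ HD) as [D [HD0 HDb]].
  set (E := exp (2 * PI * Rabs (Im z2))).
  (* Beyond this K both |Re z1| and |Re z2| are at most |m|/2, so the real part of (z + m)/M lies in
     absolute value between |m|/(2M) and 3|m|/(2M), and the latter is at most 3/4. *)
  destruct (nfloor_ex (2 * Rabs (Re z1) + 2 * Rabs (Re z2))) as [K [_ HK]];
    [pose proof (Rabs_pos (Re z1)); pose proof (Rabs_pos (Re z2)); lra | ].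
  exists (16 * (E * D))%R, (S K). assert (HE : (0 < E)%R) by apply exp_pos.
  split; [pose proof (Rmult_lt_0_compat _ _ HE HD0); lra | split; [lia | ]].
  intros N m HKm HmN.
  assert (HN : (1 <= N)%nat) by lia.
  set (M := INR (2 * N - 1)).
  assert (HM : (0 < M)%R) by now apply odd_INR_pos.
  assert (HMC : RtoC M <> 0) by (intros F; apply RtoC_inj in F; lra).
  set (k := INR (Z.abs_nat m)).
  assert (Hk1 : (1 <= k)%R) by (apply (le_INR 1); lia).
  assert (Hk : (2 * Rabs (Re z1) + 2 * Rabs (Re z2) <= k)%R).
  { apply le_INR in HKm. rewrite S_INR in HKm. unfold k. lra. }
  assert (HkM : (3 / 2 * k <= 3 / 4 * M)%R).
  { unfold M, k. rewrite odd_INR by exact HN.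
    assert (INR (Z.abs_nat m) <= INR N - 1)%R; [ | lra].
    assert (INR (S (Z.abs_nat m)) <= INR N)%R by (apply le_INR; lia).
    rewrite S_INR in *. lra. }
  assert (Hkm : k = Rabs (IZR m)).
  { unfold k. rewrite INR_IZR_INZ, Zabs2Nat.id_abs. apply abs_IZR. }
  pose proof (Rabs_pos (Re z1)) as Hp1. pose proof (Rabs_pos (Re z2)) as Hp2.
  assert (Hlow : forall z, (Rabs (Re z) <= k / 2)%R ->
    (k / 2 / M <= Cmod (1 - qof ((z + IZR m) / M)))%R).
  { intros z Hz.
    assert (HRe : Re ((z + IZR m) / M) = ((Re z + IZR m) / M)%R).
    { unfold Cdiv. rewrite <- RtoC_inv by lra. destruct z as [x y]. simpl. field. lra. }
    assert (Habs : Rabs (Re ((z + IZR m) / M)) = (Rabs (Re z + IZR m) / M)%R).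
    { rewrite HRe. unfold Rdiv. rewrite Rabs_mult, (Rabs_pos_eq (/ M)); [reflexivity | ].
      left. now apply Rinv_0_lt_compat. }
    assert (Hlo : (k / 2 <= Rabs (Re z + IZR m))%R).
    { pose proof (Rabs_triang_inv (IZR m) (- Re z)) as T. rewrite Rabs_Ropp in T.
      replace (IZR m - - Re z)%R with (Re z + IZR m)%R in T by ring. lra. }
    assert (Hhi : (Rabs (Re z + IZR m) <= 3 / 2 * k)%R).
    { pose proof (Rabs_triang (Re z) (IZR m)). lra. }
    eapply Rle_trans; [ | apply Re_le_Cmod_1_minus_qof]; rewrite Habs.
    - apply Rmult_le_compat_r; [left; now apply Rinv_0_lt_compat | exact Hlo].
    - apply Rmult_le_reg_r with M; [exact HM | ].
      unfold Rdiv. rewrite Rmult_assoc, Rinv_l by lra. lra. }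
  rewrite kappa_minus by (apply qof_div_neq_1; [lia | assumption]).
  set (a := qof ((z1 + IZR m) / M)). set (b := qof ((z2 + IZR m) / M)).
  assert (Ha : (k / 2 / M <= Cmod (1 - a))%R) by (apply Hlow; lra).
  assert (Hb : (k / 2 / M <= Cmod (1 - b))%R) by (apply Hlow; lra).
  assert (Hpos : (0 < k / 2 / M)%R) by (apply Rdiv_lt_0_compat; lra).
  assert (Hna : 1 - a <> 0) by (apply Cmod_gt_0; lra).
  assert (Hnb : 1 - b <> 0) by (apply Cmod_gt_0; lra).
  assert (Hab : (Cmod (a - b) <= E * (D / M))%R).
  { set (d := qof (/ M * (z1 - z2))).
    assert (Eab : a = b * d).
    { unfold a, b, d. rewrite <- qof_plus. f_equal. field. exact HMC. }
    replace (a - b) with (- (b * (1 - d))) by (rewrite Eab; ring).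
    rewrite Cmod_opp, Cmod_mult.
    apply Rmult_le_compat; try apply Cmod_ge_0.
    - unfold b. rewrite Cmod_qof. unfold E.
      assert (HIm : Im ((z2 + IZR m) / M) = (Im z2 / M)%R).
      { unfold Cdiv. rewrite <- RtoC_inv by lra. destruct z2 as [x y]. simpl. field. lra. }
      rewrite HIm. pose proof PI_RGT_0 as HPI.
      assert (HM1 : (1 <= M)%R) by (apply (le_INR 1); lia).
      assert (H0 : (- (2 * PI * (Im z2 / M)) <= 2 * PI * Rabs (Im z2))%R).
      { replace (- (2 * PI * (Im z2 / M)))%R with (2 * PI * (- Im z2 / M))%R
          by (field; lra).
        apply Rmult_le_compat_l; [lra | ].
        apply Rmult_le_reg_r with M; [exact HM | ].
        unfold Rdiv. rewrite Rmult_assoc, Rinv_l, Rmult_1_r by lra.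
        pose proof (Rle_abs (- Im z2)) as T. rewrite Rabs_Ropp in T.
        pose proof (Rabs_pos (Im z2)). nra. }
      destruct H0 as [H0 | ->]; [left; now apply exp_increasing | lra].
    - specialize (HDb (pred N)). cbv beta in HDb.
      replace (S (pred N)) with N in HDb by lia. fold M in HDb.
      rewrite RtoC_inv in HDb by lra. fold d in HDb.
      replace ((1 - d) / / M) with (M * (1 - d)) in HDb by (field; exact HMC).
      rewrite Cmod_mult, Cmod_R, Rabs_pos_eq in HDb by lra.
      apply Rmult_le_reg_l with M; [exact HM | ].
      replace (M * (D / M))%R with D by (field; lra). exact HDb. }
  rewrite Cmod_mult, Cmod_div, Cmod_mult by (apply Cmult_neq_0; assumption).
  rewrite Cmod_inv, Cmod_R, Rabs_pos_eq by (lra || exact HMC).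
  apply Rle_trans with (/ M * (E * (D / M) * / (k / 2 / M * (k / 2 / M))))%R.
  - apply Rmult_le_compat_l; [left; now apply Rinv_0_lt_compat | ].
    apply Rmult_le_compat; [apply Cmod_ge_0 | | exact Hab | ].
    + left. apply Rinv_0_lt_compat. apply Rmult_lt_0_compat; lra.
    + apply Rinv_le_contravar; [now apply Rmult_lt_0_compat | ].
      apply Rmult_le_compat; lra.
  - replace (/ M * (E * (D / M) * / (k / 2 / M * (k / 2 / M))))%R
      with (4 * (E * D) * / (k * k))%R by (field; lra).
    replace (16 * (E * D) * weight (Z.abs_nat m))%R
      with (4 * (E * D) * (4 * weight (Z.abs_nat m)))%R by ring.
    apply Rmult_le_compat_l; [pose proof (Rmult_lt_0_compat _ _ HE HD0); lra | ].
    apply inv_sqr_le_weight. lia.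
Qed.

(** Euler's expansion of the cotangent, as the limit of [kappa_distribution]: after division by 2N+1
    the diagonal sums do not depend on N at all. Taking the difference at two points makes each
    single term, and not only each pair m, -m, decay quadratically, as the termwise majorant
    requires. *)
Lemma kappa_partial_fractions (z1 z2 : C) : qof z1 <> 1 -> qof z2 <> 1 ->
  Cser (fold (fun m => / (z1 + IZR m) - / (z2 + IZR m)))
    (- (2 * PI * Ci) * (kappa z1 - kappa z2)).
Proof.
  intros Hz1 Hz2. pose proof two_PI_Ci_neq_0 as Hpi.
  destruct (kappa_div_bound z1 z2 Hz1 Hz2) as [B [K [HB [HK Hbound]]]].
  set (G := fun (N : nat) (m : Z) =>
    / INR (2 * N - 1) * (kappa ((z1 + IZR m) / INR (2 * N - 1))
        - kappa ((z2 + IZR m) / INR (2 * N - 1)))).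
  set (g := fun m => - / (2 * PI * Ci) * (/ (z1 + IZR m) - / (z2 + IZR m))).
  assert (H : Cser (fold g) (kappa z1 - kappa z2)).
  { apply (Cser_tannery (fun N => fold (G N)) (fold g) (fun k => 2 * B * weight k)%R K).
    - intros k. pose proof (weight_pos k). apply Rmult_le_pos; lra.
    - apply ex_series_Rscal, weight_summable.
    - intros N k Hk. rewrite Rmult_assoc. apply fold_bound.
      intros m <-. now apply Hbound.
    - intros k. apply Cconv_fold. intros m. unfold G, g.
      apply Cconv_ext with (fun N =>
        / INR (2 * N - 1) * kappa ((z1 + IZR m) / INR (2 * N - 1))
        - / INR (2 * N - 1) * kappa ((z2 + IZR m) / INR (2 * N - 1)));
        [intros N; ring | ].
      replace (- / (2 * PI * Ci) * (/ (z1 + IZR m) - / (z2 + IZR m)))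
        with (- / (2 * PI * Ci) * / (z1 + IZR m) - - / (2 * PI * Ci) * / (z2 + IZR m))
        by ring.
      apply Cconv_minus; now apply kappa_div_lim.
    - apply Cconv_S. apply Cconv_ext with (fun _ => kappa z1 - kappa z2);
        [ | apply Cconv_const].
      intros N. unfold G. rewrite Csum_fold_lin.
      replace (2 * S N - 1)%nat with (2 * N + 1)%nat by lia.
      rewrite !kappa_distribution by assumption. field.
      intros E. apply RtoC_inj in E. revert E. apply not_0_INR. lia. }
  apply (Cser_scal (- (2 * PI * Ci))) in H.
  apply Cser_ext with (2 := H). intros k. rewrite <- fold_scal. apply fold_ext.
  intros m. unfold g. set (p := 2 * PI * Ci) in *. set (x := / _ - / _). field. exact Hpi.
Qed.

(** * Inversion of the lattice sum *)

Lemma Cser_fold (H : Z -> nat -> C) (r : Z -> C) (k : nat) :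
  (forall n, Cser (H n) (r n)) -> Cser (fun m => fold (fun n => H n m) k) (fold r k).
Proof. intros Hr. destruct k; simpl; [apply Hr | apply Cser_plus; apply Hr]. Qed.

Lemma fold_swap (G : Z -> Z -> C) (k l : nat) :
  fold (fun n => fold (G n) l) k = fold (fun m => fold (fun n => G n m) k) l.
Proof. destruct k, l; simpl; ring. Qed.

Lemma Rmult_lt_0_compat3 (x y z : R) : (0 < x)%R -> (0 < y)%R -> (0 < z)%R -> (0 < x * y * z)%R.
Proof. intros. repeat apply Rmult_lt_0_compat; assumption. Qed.

(* The bound 6 covers all the points [(v + u)/7], [u/7], [(v - u)/7], [-u/7] needed, and
   makes "not divisible by 7" the same as "nonzero". *)
Definition septimal (p : Z) : Prop := (Z.abs p <= 6 /\ p <> 0)%Z.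

Lemma qof_septimal (p : Z) (w : C) : septimal p -> (Im w <> 0)%R \/ w = 0 ->
  qof (IZR p / 7 + w) <> 1.
Proof.
  intros [Hp Hp0] [Hw | ->].
  - apply qof_neq_1_Im. replace (IZR p / 7) with (RtoC (IZR p / 7)%R)
      by (rewrite RtoC_div; [reflexivity | lra]).
    simpl. rewrite Rplus_0_l. exact Hw.
  - rewrite Cplus_0_r.
    assert (H : (-1 < IZR p / 7 < 1)%R).
    { assert (IZR p <= 6)%R by (apply IZR_le; lia).
      assert (-6 <= IZR p)%R by (apply IZR_le; lia). lra. }
    replace (IZR p / 7) with (RtoC (IZR p / 7)%R)
      by (rewrite RtoC_div; [reflexivity | lra]).
    destruct (Z_lt_le_dec 0 p) as [Hlt | Hle].
    + apply IZR_lt in Hlt. apply qof_real_neq_1. lra.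
    + assert (IZR p < 0)%R by (apply IZR_lt; lia).
      rewrite <- (qof_period _ 1), <- RtoC_plus. apply qof_real_neq_1. lra.
Qed.

(** Im (x conj(tau)) controls n and Im x controls m. The geometric mean of the two bounds is a
    product of one-variable factors, the shape that [Cser_double_swap] asks for. *)
Lemma lattice_bound (tau : C) : in_H tau ->
  exists c : R, (0 < c)%R /\ forall (p n m : Z), septimal p ->
    (c * (sqrt (INR (Z.abs_nat n) + 1) * sqrt (INR (Z.abs_nat m) + 1))
      <= Cmod (IZR p / 7 + (IZR m * tau - IZR n)))%R.
Proof.
  intros Hy. unfold in_H in Hy. set (y := Im tau) in *.
  assert (Ht : (0 < Cmod tau)%R).
  { apply Rlt_le_trans with (1 := Hy). eapply Rle_trans; [apply Rle_abs | apply im_le_Cmod]. }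
  set (c1 := (y / (14 * Cmod tau))%R).
  assert (Hc1 : (0 < c1)%R) by (apply Rdiv_lt_0_compat; lra).
  (* Turns the bound y (M - 1) into c M: since |x| >= c1 as well, c1 y M = c1 y (M - 1) + c1 y is at
     most (c1 + y) |x|. *)
  set (c := (c1 * y / (c1 + y))%R).
  assert (Hc : (0 < c)%R) by (apply Rdiv_lt_0_compat; [now apply Rmult_lt_0_compat | lra]).
  assert (Hcc : (c * (c1 + y) = c1 * y)%R) by (unfold c; field; lra).
  exists c. split; [exact Hc | ]. intros p n m [Hp Hp0].
  set (N := (INR (Z.abs_nat n) + 1)%R). set (M := (INR (Z.abs_nat m) + 1)%R).
  assert (HN : (1 <= N)%R) by (unfold N; pose proof (pos_INR (Z.abs_nat n)); lra).
  assert (HM : (1 <= M)%R) by (unfold M; pose proof (pos_INR (Z.abs_nat m)); lra).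
  set (A := (IZR p / 7 - IZR n)%R).
  replace (IZR p / 7 + (IZR m * tau - IZR n)) with (RtoC A + IZR m * tau)
    by (unfold A; rewrite RtoC_minus, RtoC_div by lra; ring).
  set (x := RtoC A + IZR m * tau).
  (* Here 14 |A| = 2 |p - 7n|, and |p - 7n| is at least 1 for n = 0 and at least 7|n| - 6
     otherwise. *)
  assert (HA : (N <= 14 * Rabs A)%R).
  { replace (14 * Rabs A)%R with (2 * Rabs (IZR (p - 7 * n)))%R.
    - unfold N. rewrite INR_IZR_INZ, Zabs2Nat.id_abs, Rabs_Zabs, <- plus_IZR, <- mult_IZR.
      apply IZR_le. lia.
    - rewrite minus_IZR, mult_IZR. unfold A.
      replace (IZR p - 7 * IZR n)%R with (7 * (IZR p / 7 - IZR n))%R by field.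
      rewrite Rabs_mult, (Rabs_pos_eq 7) by lra. ring. }
  assert (H1 : (c1 * N <= Cmod x)%R).
  { assert (E : (Rabs A * y <= Cmod x * Cmod tau)%R).
    { rewrite <- (Cmod_conj tau), <- Cmod_mult.
      eapply Rle_trans; [ | apply im_le_Cmod].
      replace (Im (x * Cconj tau)) with (- (A * y))%R
        by (unfold x, y; destruct tau; simpl; ring).
      rewrite Rabs_Ropp, Rabs_mult, (Rabs_pos_eq y) by lra. lra. }
    unfold c1. apply Rmult_le_reg_r with (14 * Cmod tau)%R; [lra | ].
    replace (y / (14 * Cmod tau) * N * (14 * Cmod tau))%R with (y * N)%R by (field; lra).
    nra. }
  assert (H2 : (y * (M - 1) <= Cmod x)%R).
  { eapply Rle_trans; [ | apply im_le_Cmod].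
    replace (Im x) with (IZR m * y)%R by (unfold x, y; destruct tau; simpl; ring).
    rewrite Rabs_mult, (Rabs_pos_eq y) by lra.
    replace (M - 1)%R with (Rabs (IZR m)); [lra | ].
    unfold M. rewrite INR_IZR_INZ, Zabs2Nat.id_abs, Rabs_Zabs. ring. }
  pose proof (Cmod_ge_0 x) as Hx.
  assert (HcN : (c * N <= Cmod x)%R).
  { apply Rmult_le_reg_r with (c1 + y)%R; [lra | ].
    replace (c * N * (c1 + y))%R with (c1 * N * y)%R
      by (transitivity (c * (c1 + y) * N)%R; [rewrite Hcc | ]; ring). nra. }
  assert (HcM : (c * M <= Cmod x)%R).
  { apply Rmult_le_reg_r with (c1 + y)%R; [lra | ].
    replace (c * M * (c1 + y))%R with (c1 * y * M)%R
      by (transitivity (c * (c1 + y) * M)%R; [rewrite Hcc | ]; ring).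
    assert (c1 <= Cmod x)%R by nra.
    assert (y * c1 <= y * Cmod x)%R by (apply Rmult_le_compat_l; lra).
    assert (c1 * (y * (M - 1)) <= c1 * Cmod x)%R by (apply Rmult_le_compat_l; lra).
    lra. }
  pose proof (sqrt_sqrt N ltac:(lra)) as EN. pose proof (sqrt_sqrt M ltac:(lra)) as EM.
  pose proof (sqrt_pos N). pose proof (sqrt_pos M).
  apply Rsqr_incr_0_var; [ | exact Hx]. unfold Rsqr.
  replace (c * (sqrt N * sqrt M) * (c * (sqrt N * sqrt M)))%R
    with ((c * N) * (c * M))%R by (rewrite <- EN, <- EM at 1; ring).
  apply Rmult_le_compat; try assumption; nra.
Qed.

Definition lamterm (t u v : C) (n : Z) : C :=
  kappa (v + u + IZR n * t) - kappa (u + IZR n * t)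
  - (kappa (v - u + IZR n * t) - kappa (- u + IZR n * t)).

Definition latterm (u v w : C) : C :=
  / (v + u + w) - / (u + w) - (/ (v - u + w) - / (- u + w)).

(** Exhibits the inverse cube decay in w. Over the common denominator the numerator is 2uv(v + 2w);
    splitting v + 2w = (u + w) + (v - u + w) cancels one linear factor in each part. *)
Lemma latterm_alt (u v w : C) :
  v + u + w <> 0 -> u + w <> 0 -> v - u + w <> 0 -> - u + w <> 0 ->
  latterm u v w =
    2 * u * v * (/ ((v + u + w) * (v - u + w) * (- u + w))
      + / ((v + u + w) * (u + w) * (- u + w))).
Proof. intros. unfold latterm. field. auto. Qed.

Lemma latterm_series (u v t : C) (n : Z) :
  qof (v + u + IZR n * t) <> 1 -> qof (u + IZR n * t) <> 1 ->
  qof (v - u + IZR n * t) <> 1 -> qof (- u + IZR n * t) <> 1 ->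
  Cser (fold (fun m => latterm u v (IZR m + IZR n * t)))
    (- (2 * PI * Ci) * lamterm t u v n).
Proof.
  intros H1 H2 H3 H4.
  pose proof (Cser_minus _ _ _ _ (kappa_partial_fractions _ _ H1 H2)
    (kappa_partial_fractions _ _ H3 H4)) as H.
  unfold lamterm.
  replace (- (2 * PI * Ci) * (kappa (v + u + IZR n * t) - kappa (u + IZR n * t)
    - (kappa (v - u + IZR n * t) - kappa (- u + IZR n * t))))
    with (- (2 * PI * Ci) * (kappa (v + u + IZR n * t) - kappa (u + IZR n * t))
      - - (2 * PI * Ci) * (kappa (v - u + IZR n * t) - kappa (- u + IZR n * t))) by ring.
  apply Cser_ext with (2 := H). intros k.
  rewrite <- (Cmult_1_l (fold _ k - _)).
  replace (1 * (fold (fun m : Z => / (v + u + IZR n * t + IZR m) - / (u + IZR n * t + IZR m)) k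
     - fold (fun m : Z => / (v - u + IZR n * t + IZR m) - / (- u + IZR n * t + IZR m)) k))
    with (fold (fun m : Z => / (v + u + IZR n * t + IZR m) - / (u + IZR n * t + IZR m)) k
     + -1 * fold (fun m : Z => / (v - u + IZR n * t + IZR m) - / (- u + IZR n * t + IZR m)) k)
    by ring.
  rewrite <- fold_scal, <- fold_plus. apply fold_ext. intros m. unfold latterm.
  replace (v + u + IZR n * t + IZR m) with (v + u + (IZR m + IZR n * t)) by ring.
  replace (u + IZR n * t + IZR m) with (u + (IZR m + IZR n * t)) by ring.
  replace (v - u + IZR n * t + IZR m) with (v - u + (IZR m + IZR n * t)) by ring.
  replace (- u + IZR n * t + IZR m) with (- u + (IZR m + IZR n * t)) by ring. ring.
Qed.

Section Inversion.
Variables (tau : C) (j k : Z).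
Hypothesis Htau : in_H tau.
Hypotheses (H1 : septimal (k + j)) (H2 : septimal j)
  (H3 : septimal (k - j)) (H4 : septimal (- j)).
Let a : C := IZR j / 7.
Let b : C := IZR k / 7.

Lemma tau_neq_0 : tau <> 0.
Proof. intros E. unfold in_H in Htau. rewrite E in Htau. simpl in Htau. lra. Qed.

Lemma points_alt :
  b + a = IZR (k + j) / 7 /\ b - a = IZR (k - j) / 7 /\ - a = IZR (- j) / 7.
Proof.
  unfold a, b. rewrite plus_IZR, minus_IZR, opp_IZR, RtoC_plus, RtoC_minus, RtoC_opp.
  repeat split; field.
Qed.

Lemma septimal_point (p n m : Z) : septimal p -> IZR p / 7 + (IZR m * tau - IZR n) <> 0.
Proof.
  intros Hp. apply Cmod_gt_0.
  destruct (lattice_bound tau Htau) as [c [Hc Hb]].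
  eapply Rlt_le_trans; [ | now apply Hb].
  repeat apply Rmult_lt_0_compat; trivial; apply sqrt_lt_R0;
    [pose proof (pos_INR (Z.abs_nat n)) | pose proof (pos_INR (Z.abs_nat m))]; lra.
Qed.

Lemma qof_septimal_tau (p n : Z) : septimal p -> qof (IZR p / 7 + IZR n * tau) <> 1.
Proof.
  intros Hp. apply qof_septimal; [exact Hp | ].
  destruct (Z.eq_dec n 0) as [-> | Hn]; [right; ring | left].
  replace (Im (IZR n * tau)) with (IZR n * Im tau)%R by (destruct tau; simpl; ring).
  apply Rmult_integral_contrapositive_currified; [now apply not_0_IZR | ].
  unfold in_H in Htau. lra.
Qed.

(** The argument is (p/7 - n)/tau, a nonzero real number divided by a non-real one, so it has
    nonzero imaginary part. That p/7 - n is nonzero is the case m = 0 of [septimal_point]. *)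
Lemma qof_septimal_inv (p n : Z) : septimal p ->
  qof (IZR p / 7 / tau + IZR n * (-1 / tau)) <> 1.
Proof.
  intros Hp. pose proof tau_neq_0 as Ht.
  assert (E : IZR p / 7 / tau + IZR n * (-1 / tau) = (IZR p / 7 - IZR n) / tau)
    by (field; exact Ht).
  rewrite E.
  set (A := (IZR p / 7 - IZR n)%R).
  replace (IZR p / 7 - IZR n) with (RtoC A)
    by (unfold A; rewrite RtoC_minus, RtoC_div by lra; reflexivity).
  apply qof_neq_1_Im. unfold in_H in Htau.
  assert (HA : A <> 0%R).
  { intros F. unfold A in F. apply (septimal_point p n 0 Hp).
    replace (IZR p / 7 + (IZR 0 * tau - IZR n)) with (RtoC (IZR p / 7 - IZR n)%R)
      by (rewrite RtoC_minus, RtoC_div by lra; ring).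
    now rewrite F. }
  intros F.
  assert (G : (Im (RtoC A / tau * (tau * Cconj tau)) = 0)%R).
  { replace (tau * Cconj tau) with (RtoC (Re tau * Re tau + Im tau * Im tau)%R)
      by (destruct tau; apply C_eq; simpl; ring).
    set (w := RtoC A / tau) in *. destruct w as [w1 w2]. simpl in *. rewrite F. ring. }
  replace (RtoC A / tau * (tau * Cconj tau)) with (RtoC A * Cconj tau) in G
    by (field; exact Ht).
  assert (G' : (A * Im tau = 0)%R) by (destruct tau; simpl in *; lra).
  apply Rmult_integral in G'. destruct G'; [contradiction | lra].
Qed.

Lemma latterm_bound : exists B : R, (0 <= B)%R /\ forall n m,
  (Cmod (latterm a b (IZR m * tau - IZR n))
    <= B * (weight (Z.abs_nat n) * weight (Z.abs_nat m)))%R.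
Proof.
  destruct (lattice_bound tau Htau) as [c [Hc Hb]].
  destruct points_alt as [E1 [E3 E4]].
  exists (2 * (Cmod (2 * a * b) * / (c * c * c)))%R. split.
  { apply Rmult_le_pos; [lra | ]. apply Rmult_le_pos; [apply Cmod_ge_0 | ].
    left. apply Rinv_0_lt_compat. now apply Rmult_lt_0_compat3. }
  intros n m. set (w := IZR m * tau - IZR n).
  assert (Hw : forall p, septimal p -> IZR p / 7 + w <> 0).
  { intros p Hp. now apply septimal_point. }
  assert (N1 : b + a + w <> 0) by (rewrite E1; auto).
  assert (N2 : a + w <> 0) by (apply (Hw j); auto).
  assert (N3 : b - a + w <> 0) by (rewrite E3; auto).
  assert (N4 : - a + w <> 0) by (rewrite E4; auto).
  rewrite latterm_alt by assumption.
  set (s := sqrt (INR (Z.abs_nat n) + 1)). set (t := sqrt (INR (Z.abs_nat m) + 1)).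
  assert (Hs : (0 < s)%R)
    by (apply sqrt_lt_R0; pose proof (pos_INR (Z.abs_nat n)); lra).
  assert (Ht : (0 < t)%R)
    by (apply sqrt_lt_R0; pose proof (pos_INR (Z.abs_nat m)); lra).
  assert (B1 : (c * (s * t) <= Cmod (b + a + w))%R) by (rewrite E1; now apply Hb).
  assert (B2 : (c * (s * t) <= Cmod (a + w))%R) by (now apply (Hb j)).
  assert (B3 : (c * (s * t) <= Cmod (b - a + w))%R) by (rewrite E3; now apply Hb).
  assert (B4 : (c * (s * t) <= Cmod (- a + w))%R) by (rewrite E4; now apply Hb).
  assert (Hst : (0 < c * (s * t))%R) by (repeat apply Rmult_lt_0_compat; assumption).
  assert (Hinv : forall x y z, (c * (s * t) <= Cmod x)%R -> (c * (s * t) <= Cmod y)%R ->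
    (c * (s * t) <= Cmod z)%R -> x <> 0 -> y <> 0 -> z <> 0 ->
    (Cmod (/ (x * y * z)) <= / (c * c * c) * (/ s ^ 3 * / t ^ 3))%R).
  { intros x y z Hx Hy Hz Nx Ny Nz.
    rewrite Cmod_inv, !Cmod_mult by (repeat apply Cmult_neq_0; assumption).
    replace (/ (c * c * c) * (/ s ^ 3 * / t ^ 3))%R
      with (/ (c * (s * t) * (c * (s * t)) * (c * (s * t))))%R by (field; lra).
    apply Rinv_le_contravar; [now apply Rmult_lt_0_compat3 | ].
    apply Rmult_le_compat; try lra; [apply Rmult_le_pos; lra | ].
    apply Rmult_le_compat; lra. }
  rewrite Cmod_mult. fold s t. unfold weight. fold s t.
  replace (2 * (Cmod (2 * a * b) * / (c * c * c)) * (/ s ^ 3 * / t ^ 3))%R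
    with (Cmod (2 * a * b) * (/ (c * c * c) * (/ s ^ 3 * / t ^ 3)
      + / (c * c * c) * (/ s ^ 3 * / t ^ 3)))%R by ring.
  apply Rmult_le_compat_l; [apply Cmod_ge_0 | ].
  eapply Rle_trans; [apply Cmod_triangle | ].
  apply Rplus_le_compat; apply Hinv; assumption.
Qed.

(** Both series are iterated sums of one family, [latterm a b (m tau - n)]. Summing over m first
    gives the lattice sum for -1/tau, rescaled because 1/(z/tau) = tau/z; summing over n first gives
    the one for tau. *)
Lemma lam_inversion (l : C) :
  Cser (fold (lamterm (-1 / tau) (a / tau) (b / tau))) l ->
  Cser (fold (lamterm tau a b)) (l / tau).
Proof.
  intros Hl. pose proof tau_neq_0 as Ht. pose proof two_PI_Ci_neq_0 as Hpi.
  destruct points_alt as [E1 [E3 E4]].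
  destruct latterm_bound as [B [HB Hbound]].
  set (p := - (2 * PI * Ci)).
  assert (Hp : p <> 0).
  { unfold p. intros E. apply Hpi.
    replace (2 * PI * Ci) with (- - (2 * PI * Ci)) by ring. rewrite E. ring. }
  set (G := fun n m : Z => latterm a b (IZR m * tau - IZR n)).
  assert (Hrow : forall n, Cser (fold (G n)) (p / tau * lamterm (-1 / tau) (a / tau) (b / tau) n)).
  { intros n.
    pose proof (latterm_series (a / tau) (b / tau) (-1 / tau) n) as H.
    replace (b / tau + a / tau) with (IZR (k + j) / 7 / tau) in H
      by (rewrite <- E1; field; exact Ht).
    replace (b / tau - a / tau) with (IZR (k - j) / 7 / tau) in H
      by (rewrite <- E3; field; exact Ht).
    replace (- (a / tau)) with (IZR (- j) / 7 / tau) in H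
      by (rewrite <- E4; field; exact Ht).
    specialize (H (qof_septimal_inv _ n H1) (qof_septimal_inv _ n H2)
      (qof_septimal_inv _ n H3) (qof_septimal_inv _ n H4)).
    apply (Cser_scal (/ tau)) in H.
    replace (p / tau * lamterm (-1 / tau) (a / tau) (b / tau) n)
      with (/ tau * (p * lamterm (-1 / tau) (a / tau) (b / tau) n)) by (field; exact Ht).
    apply Cser_ext with (2 := H). intros i. rewrite <- fold_scal. apply fold_ext.
    intros m. unfold G, latterm.
    pose proof (septimal_point _ n m H1) as P1. pose proof (septimal_point _ n m H2) as P2.
    pose proof (septimal_point _ n m H3) as P3. pose proof (septimal_point _ n m H4) as P4.
    rewrite <- E1 in P1. rewrite <- E3 in P3. rewrite <- E4 in P4. fold a in P2.
    set (w := IZR m * tau - IZR n) in *.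
    assert (Ew : IZR m + IZR n * (-1 / tau) = w / tau) by (unfold w; field; exact Ht).
    rewrite Ew.
    assert (Hinv : forall z, z + w <> 0 -> / tau * / (z / tau + w / tau) = / (z + w)).
    { intros z Hz. field. repeat split; assumption. }
    transitivity (/ tau * / ((b + a) / tau + w / tau) - / tau * / (a / tau + w / tau)
      - (/ tau * / ((b - a) / tau + w / tau) - / tau * / (- a / tau + w / tau))).
    - replace (b / tau + a / tau) with ((b + a) / tau) by (field; exact Ht).
      replace (b / tau - a / tau) with ((b - a) / tau) by (field; exact Ht).
      replace (- (a / tau)) with (- a / tau) by (field; exact Ht). ring.
    - rewrite !Hinv by assumption. reflexivity. }
  assert (Hcol : forall m, Cser (fold (fun n => G n m)) (p * lamterm tau a b m)).
  { intros m.
    assert (Q1 := qof_septimal_tau _ m H1). assert (Q2 := qof_septimal_tau _ m H2).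
    assert (Q3 := qof_septimal_tau _ m H3). assert (Q4 := qof_septimal_tau _ m H4).
    rewrite <- E1 in Q1. rewrite <- E3 in Q3. rewrite <- E4 in Q4. fold a in Q2.
    pose proof (latterm_series a b tau m Q1 Q2 Q3 Q4) as H.
    apply Cser_ext with (2 := H). intros i.
    (* The family contains -n where the partial fractions have +n; symmetric grouping does not see
       the sign. *)
    rewrite <- (fold_opp_index (fun n => G n m)). apply fold_ext. intros n.
    unfold G. f_equal. rewrite opp_IZR, RtoC_opp. ring. }
  replace (l / tau) with (/ p * (p / tau * l)) by (field; auto).
  apply Cser_ext with (fun i => / p * fold (fun m => p * lamterm tau a b m) i).
  { intros i. rewrite fold_scal. field. exact Hp. }
  apply Cser_scal.
  (* Each of the two foldings joins at most two terms, whence the factor 4. *)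
  apply (Cser_double_swap (fun i i' => fold (fun n => fold (G n) i') i) weight (4 * B)
    (fold (fun n => p / tau * lamterm (-1 / tau) (a / tau) (b / tau) n))).
  - intros i. left. apply weight_pos.
  - apply weight_summable.
  - lra.
  - intros n m.
    replace (4 * B * (weight n * weight m))%R
      with (2 * (2 * (B * (weight n * weight m))))%R by ring.
    apply fold_bound. intros n' <-. apply fold_bound. intros m' <-. apply Hbound.
  - intros n. apply (Cser_fold (fun n => fold (G n))). exact Hrow.
  - intros m. apply Cser_ext with (fun i => fold (fun m' => fold (fun n => G n m') i) m).
    { intros i. now rewrite fold_swap. }
    apply (Cser_fold (fun m' i => fold (fun n => G n m') i)). exact Hcol.
  - apply Cser_ext with
      (fun i => p / tau * fold (lamterm (-1 / tau) (a / tau) (b / tau)) i).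
    { intros i. now rewrite fold_scal. }
    now apply Cser_scal.
Qed.
End Inversion.

(** * Finite partial fractions *)

Lemma Cminus_neq_0 (x y : C) : x <> y -> x - y <> 0.
Proof. intros H E. apply H. replace x with (x - y + y) by ring. rewrite E. ring. Qed.

(** One factor of the theta quotient theta(v)^2 / (theta(v + u) theta(v - u)), as a rational
    function of x = [qof v]. *)
Definition rho (b a a' x : C) : C := (1 - x * b) ^ 2 / ((1 - x * a) * (1 - x * a')).

Definition residue (b a a' : C) : C := (1 - b / a) ^ 2 / (1 - a' / a).

Definition pf_coef (b a a' : nat -> C) (i m : nat) : C :=
  Cprod (fun j => if Nat.eqb j i then residue (b i) (a i) (a' i)
                  else rho (b j) (a j) (a' j) (/ a i)) m.

Lemma rho_decomp (b a a' x : C) :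
  a <> 0 -> a' <> 0 -> a <> a' -> 1 - x * a <> 0 -> 1 - x * a' <> 0 ->
  rho b a a' x = b ^ 2 / (a * a') + residue b a a' / (1 - x * a)
    + residue b a' a / (1 - x * a').
Proof.
  intros Ha Ha' Haa Hx Hx'. unfold rho, residue.
  pose proof (Cminus_neq_0 _ _ Haa). pose proof (Cminus_neq_0 _ _ (not_eq_sym Haa)).
  field. repeat split; assumption.
Qed.

(** The induction step multiplies an old pole term by a new factor. The product vanishes at
    infinity, so unlike in [rho_decomp] no constant appears. *)
Lemma rho_decomp_pole (b a a' x y : C) :
  a <> 0 -> a' <> 0 -> y <> 0 -> a <> a' -> a <> y -> a' <> y ->
  1 - x * a <> 0 -> 1 - x * a' <> 0 -> 1 - x * y <> 0 ->
  rho b a a' x / (1 - x * y) = rho b a a' (/ y) / (1 - x * y)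
    + residue b a a' / (1 - x * a) / (1 - / a * y)
    + residue b a' a / (1 - x * a') / (1 - / a' * y).
Proof.
  intros Ha Ha' Hy Haa Hay Hay' Hx Hx' Hxy. unfold rho, residue.
  pose proof (Cminus_neq_0 _ _ Haa). pose proof (Cminus_neq_0 _ _ (not_eq_sym Haa)).
  pose proof (Cminus_neq_0 _ _ Hay). pose proof (Cminus_neq_0 _ _ (not_eq_sym Hay)).
  pose proof (Cminus_neq_0 _ _ Hay'). pose proof (Cminus_neq_0 _ _ (not_eq_sym Hay')).
  field. repeat split; assumption.
Qed.

Lemma one_minus_div_neq_0 (a y : C) : a <> 0 -> a <> y -> 1 - / a * y <> 0.
Proof.
  intros Ha Hay E. apply (Cminus_neq_0 _ _ Hay).
  replace (a - y) with (a * (1 - / a * y)) by (field; exact Ha). rewrite E. ring.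
Qed.

Lemma rho_sym (b a a' x : C) : rho b a a' x = rho b a' a x.
Proof. unfold rho. f_equal. apply Cmult_comm. Qed.

Lemma pf_coef_S (b a a' : nat -> C) (i m : nat) : (i < m)%nat ->
  pf_coef b a a' i (S m) = pf_coef b a a' i m * rho (b m) (a m) (a' m) (/ a i).
Proof.
  intros H. unfold pf_coef. simpl.
  now replace (Nat.eqb m i) with false by (symmetry; apply Nat.eqb_neq; lia).
Qed.

Lemma pf_coef_diag (b a a' : nat -> C) (m : nat) :
  pf_coef b a a' m (S m)
  = Cprod (fun j => rho (b j) (a j) (a' j) (/ a m)) m * residue (b m) (a m) (a' m).
Proof.
  unfold pf_coef. simpl. rewrite Nat.eqb_refl. f_equal. apply Cprod_ext.
  intros j Hj. now replace (Nat.eqb j m) with false by (symmetry; apply Nat.eqb_neq; lia).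
Qed.

(* By induction on [m]: the coefficient of a new pole is the residue of the new factor
   times the old product at that pole, which the induction hypothesis evaluates. *)
Lemma partial_fractions (b a a' : nat -> C) (m : nat) :
  (forall i, a i <> 0) -> (forall i, a' i <> 0) ->
  (forall i j, i <> j -> a i <> a j) -> (forall i j, i <> j -> a' i <> a' j) ->
  (forall i j, a i <> a' j) ->
  exists c : C, forall x,
    (forall i, (i < m)%nat -> 1 - x * a i <> 0 /\ 1 - x * a' i <> 0) ->
    Cprod (fun j => rho (b j) (a j) (a' j) x) m
    = c + Csum (fun i => pf_coef b a a' i m / (1 - x * a i)
                       + pf_coef b a' a i m / (1 - x * a' i)) m.
Proof.
  intros Ha Ha' Haa Haa' Hne.
  induction m as [ | m [c IH]].
  { exists 1. intros x _. simpl. ring. }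
  exists (c * (b m ^ 2 / (a m * a' m))). intros x Hx.
  assert (Hx1 : forall i, (i < m)%nat -> 1 - x * a i <> 0 /\ 1 - x * a' i <> 0)
    by (intros i Hi; apply Hx; lia).
  destruct (Hx m ltac:(lia)) as [Hxm Hxm'].
  set (T := fun y i => pf_coef b a a' i m / (1 - y * a i)
                     + pf_coef b a' a i m / (1 - y * a' i)).
  set (A := residue (b m) (a m) (a' m) / (1 - x * a m)).
  set (A' := residue (b m) (a' m) (a m) / (1 - x * a' m)).
  set (T' := fun i => pf_coef b a a' i (S m) / (1 - x * a i)
                    + pf_coef b a' a i (S m) / (1 - x * a' i)).
  assert (IHa : Cprod (fun j => rho (b j) (a j) (a' j) (/ a m)) m = c + Csum (T (/ a m)) m).
  { apply IH. intros i Hi. split; apply one_minus_div_neq_0; auto. apply Haa. lia. }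
  assert (IHa' : Cprod (fun j => rho (b j) (a' j) (a j) (/ a' m)) m
    = c + Csum (T (/ a' m)) m).
  { rewrite (Cprod_ext _ (fun j => rho (b j) (a j) (a' j) (/ a' m)))
      by (intros; apply rho_sym).
    apply IH. intros i Hi. split; apply one_minus_div_neq_0; auto. apply Haa'. lia. }
  assert (Hsum : Csum T' m + (A * Csum (T (/ a m)) m + A' * Csum (T (/ a' m)) m)
    = rho (b m) (a m) (a' m) x * Csum (T x) m).
  { rewrite <- !Csum_scal, <- !Csum_plus. apply Csum_ext. intros i Hi. unfold T, T'.
    rewrite !pf_coef_S by exact Hi.
    destruct (Hx i ltac:(lia)) as [Hxi Hxi'].
    pose proof (rho_decomp_pole (b m) (a m) (a' m) x (a i) (Ha m) (Ha' m) (Ha i)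
      (Hne m m) (Haa m i ltac:(lia)) (not_eq_sym (Hne i m)) Hxm Hxm' Hxi) as E1.
    pose proof (rho_decomp_pole (b m) (a m) (a' m) x (a' i) (Ha m) (Ha' m) (Ha' i)
      (Hne m m) (Hne m i) (Haa' m i ltac:(lia)) Hxm Hxm' Hxi') as E2.
    fold A A' in E1, E2. rewrite (rho_sym (b m) (a' m)).
    set (p := pf_coef b a a' i m). set (p' := pf_coef b a' a i m).
    set (R := rho (b m) (a m) (a' m)) in *.
    transitivity (p * (R x / (1 - x * a i)) + p' * (R x / (1 - x * a' i))).
    - rewrite E1, E2. unfold Cdiv. ring.
    - unfold Cdiv. ring. }
  change (Cprod (fun j => rho (b j) (a j) (a' j) x) (S m))
    with (Cprod (fun j => rho (b j) (a j) (a' j) x) m * rho (b m) (a m) (a' m) x).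
  change (Csum _ (S m)) with (Csum T' m + T' m).
  rewrite (IH x Hx1). fold (T x).
  transitivity (c * rho (b m) (a m) (a' m) x + rho (b m) (a m) (a' m) x * Csum (T x) m);
    [ring | ].
  rewrite <- Hsum.
  change (T' m) with (pf_coef b a a' m (S m) / (1 - x * a m)
    + pf_coef b a' a m (S m) / (1 - x * a' m)).
  rewrite !pf_coef_diag, IHa, IHa'.
  rewrite rho_decomp by auto. fold A A'.
  unfold A, A', Cdiv. ring.
Qed.

(** * Truncated theta products and the finite product formula *)

Lemma Cprod_two_sided (f : Z -> C) (p n : nat) :
  Cprod (fun j => f (Z.of_nat j - Z.of_nat p)%Z) (p + 1 + n)
  = f 0%Z * Cprod (fun k => f (- Z.of_nat (S k))%Z) p
    * Cprod (fun k => f (Z.of_nat (S k))) n.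
Proof.
  induction n as [ | n IH].
  - simpl (Cprod _ 0). rewrite Cmult_1_r, Nat.add_0_r.
    induction p as [ | p IHp]; [simpl; ring | ].
    replace (S p + 1)%nat with (S (p + 1)) by lia. rewrite Cprod_shift.
    rewrite (Cprod_ext _ (fun j => f (Z.of_nat j - Z.of_nat p)%Z)) by (intros; f_equal; lia).
    rewrite IHp. simpl (Cprod _ (S p)).
    replace (Z.of_nat 0 - Z.of_nat (S p))%Z with (- Z.of_nat (S p))%Z by lia. simpl. ring.
  - replace (p + 1 + S n)%nat with (S (p + 1 + n)) by lia. simpl (Cprod _ (S _)).
    rewrite IH. replace (Z.of_nat (p + 1 + n) - Z.of_nat p)%Z with (Z.of_nat (S n)) by lia.
    simpl. ring.
Qed.

(** The index starts at 1, so that w = 0 is allowed and gives a nonzero product; [theta] adds the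
    factor of index 0 separately. *)
Definition half (t w : C) (N : nat) : C :=
  Cprod (fun k => 1 - qof (w + IZR (Z.of_nat (S k)) * t)) N.

Definition theta (t w : C) (N : nat) : C :=
  (1 - qof w) * half t w N * half t (- w) N.

Lemma one_minus_qof_opp (z : C) : 1 - qof (- z) = - qof (- z) * (1 - qof z).
Proof. rewrite qof_opp. field. apply qof_neq_0. Qed.

Lemma half_neq_0 (t w : C) (N : nat) :
  (forall n, qof (w + IZR n * t) <> 1) -> half t w N <> 0.
Proof. intros H. apply Cprod_neq_0. intros k _. apply one_minus_qof_neq_0, H. Qed.

(* [w] is not a point of the lattice [Z + Z t]. *)
Definition generic (t w : C) : Prop := forall n : Z, qof (w + IZR n * t) <> 1.

Lemma generic_opp (t w : C) : generic t w -> generic t (- w).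
Proof.
  intros H n E. apply (H (- n)%Z).
  replace (w + IZR (- n) * t) with (- (- w + IZR n * t))
    by (rewrite opp_IZR, RtoC_opp; ring).
  rewrite qof_opp, E. field.
Qed.

Lemma generic_shift (t w : C) (n : Z) : generic t w -> generic t (w + IZR n * t).
Proof.
  intros H m. replace (w + IZR n * t + IZR m * t) with (w + IZR (n + m) * t)
    by (rewrite plus_IZR, RtoC_plus; ring). apply H.
Qed.

Lemma qof_period_lattice_neq_1 (t : C) (n : Z) : in_H t -> n <> 0%Z -> qof (IZR n * t) <> 1.
Proof.
  intros Ht Hn. apply qof_neq_1_Im.
  replace (Im (IZR n * t)) with (IZR n * Im t)%R by (destruct t; simpl; ring).
  apply Rmult_integral_contrapositive_currified; [now apply not_0_IZR | ].
  unfold in_H in Ht. lra.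
Qed.

Definition ratio (t w w1 w2 : C) (n : Z) : C :=
  (1 - qof (w + IZR n * t)) ^ 2
  / ((1 - qof (w1 + IZR n * t)) * (1 - qof (w2 + IZR n * t))).

(** Each 1 - [qof] changes by an exponential under reflection; w1 + w2 = 2w is exactly the condition
    for these exponentials to cancel. *)
Lemma ratio_opp (t w w1 w2 : C) (n : Z) : w1 + w2 = w + w ->
  qof (w1 + IZR (- n) * t) <> 1 -> qof (w2 + IZR (- n) * t) <> 1 ->
  ratio t w w1 w2 (- n) = ratio t (- w) (- w1) (- w2) n.
Proof.
  intros Hw H1 H2. unfold ratio.
  set (z := w + IZR (- n) * t). set (z1 := w1 + IZR (- n) * t) in *.
  set (z2 := w2 + IZR (- n) * t) in *.
  assert (E : forall y, - y + IZR n * t = - (y + IZR (- n) * t))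
    by (intros y; rewrite opp_IZR, RtoC_opp; ring).
  rewrite !E. fold z z1 z2. rewrite !one_minus_qof_opp.
  assert (Hz : qof (- z1) * qof (- z2) = qof (- z) * qof (- z)).
  { rewrite <- !qof_plus. f_equal. unfold z, z1, z2.
    transitivity (- (w1 + w2) - 2 * (IZR (- n) * t)); [ring | rewrite Hw; ring]. }
  apply one_minus_qof_neq_0 in H1, H2.
  pose proof (qof_neq_0 (- z1)). pose proof (qof_neq_0 (- z2)). pose proof (qof_neq_0 (- z)).
  replace (- qof (- z1) * (1 - qof z1) * (- qof (- z2) * (1 - qof z2)))
    with (qof (- z1) * qof (- z2) * ((1 - qof z1) * (1 - qof z2))) by ring.
  rewrite Hz. field. repeat split; assumption.
Qed.

Lemma Cprod_ratio (t w w1 w2 : C) (N : nat) :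
  (forall n, (0 < n)%Z -> qof (w1 + IZR n * t) <> 1) ->
  (forall n, (0 < n)%Z -> qof (w2 + IZR n * t) <> 1) ->
  Cprod (fun k => ratio t w w1 w2 (Z.of_nat (S k))) N
  = half t w N ^ 2 / (half t w1 N * half t w2 N).
Proof.
  intros H1 H2.
  assert (P : forall w' n, (forall n, (0 < n)%Z -> qof (w' + IZR n * t) <> 1) ->
    half t w' n <> 0).
  { intros w' n H. apply Cprod_neq_0. intros k _. apply one_minus_qof_neq_0, H. lia. }
  induction N as [ | N IH]; [unfold half; simpl; field | ].
  change (Cprod ?f (S N)) with (Cprod f N * f N). cbv beta. rewrite IH.
  change (half t ?y (S N)) with (half t y N * (1 - qof (y + IZR (Z.of_nat (S N)) * t))).
  unfold ratio. pose proof (P w1 N H1). pose proof (P w2 N H2).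
  pose proof (one_minus_qof_neq_0 _ (H1 (Z.of_nat (S N)) ltac:(lia))).
  pose proof (one_minus_qof_neq_0 _ (H2 (Z.of_nat (S N)) ltac:(lia))).
  set (x := 1 - qof (w + _)) in *. set (x1 := 1 - qof (w1 + _)) in *.
  set (x2 := 1 - qof (w2 + _)) in *. field. repeat split; assumption.
Qed.

Lemma Cprod_ratio_opp (t w w1 w2 : C) (N : nat) : w1 + w2 = w + w ->
  (forall n, (n <> 0)%Z -> qof (w1 + IZR n * t) <> 1) ->
  (forall n, (n <> 0)%Z -> qof (w2 + IZR n * t) <> 1) ->
  Cprod (fun k => ratio t w w1 w2 (- Z.of_nat (S k))) N
  = half t (- w) N ^ 2 / (half t (- w1) N * half t (- w2) N).
Proof.
  intros Hw H1 H2.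
  assert (G : forall y, (forall n, (n <> 0)%Z -> qof (y + IZR n * t) <> 1) ->
    forall n, (0 < n)%Z -> qof (- y + IZR n * t) <> 1).
  { intros y Hy n Hn E. apply (Hy (- n)%Z); [lia | ].
    replace (y + IZR (- n) * t) with (- (- y + IZR n * t))
      by (rewrite opp_IZR, RtoC_opp; ring).
    rewrite qof_opp, E. field. }
  rewrite (Cprod_ext _ (fun k => ratio t (- w) (- w1) (- w2) (Z.of_nat (S k)))).
  - apply Cprod_ratio; apply G; assumption.
  - intros k _. apply ratio_opp; [exact Hw | apply H1 | apply H2]; lia.
Qed.

Lemma one_minus_qof_generic (t w : C) : generic t w -> 1 - qof w <> 0.
Proof.
  intros H. apply one_minus_qof_neq_0. replace w with (w + IZR 0 * t) by ring. apply H.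
Qed.

Lemma theta_partial_product (t u v : C) (N : nat) :
  generic t (v + u) -> generic t (v - u) ->
  Cprod (fun j => rho (qof (IZR (Z.of_nat j - Z.of_nat N) * t))
      (qof (u + IZR (Z.of_nat j - Z.of_nat N) * t))
      (qof (- u + IZR (Z.of_nat j - Z.of_nat N) * t)) (qof v)) (N + 1 + N)
  = theta t v N ^ 2 / (theta t (v + u) N * theta t (v - u) N).
Proof.
  intros Hp Hm.
  rewrite (Cprod_ext _ (fun j => ratio t v (v + u) (v - u) (Z.of_nat j - Z.of_nat N))).
  2:{ intros j _. unfold rho, ratio. rewrite <- !qof_plus.
      set (z := IZR _ * t).
      replace (v + (u + z)) with (v + u + z) by ring.
      replace (v + (- u + z)) with (v - u + z) by ring. reflexivity. }
  rewrite Cprod_two_sided, Cprod_ratio, Cprod_ratio_opp by (ring || (intros; apply Hp || apply Hm)).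
  unfold ratio. rewrite !Cmult_0_l, !Cplus_0_r. unfold theta.
  pose proof (half_neq_0 t (v + u) N Hp). pose proof (half_neq_0 t (v - u) N Hm).
  pose proof (half_neq_0 t (- (v + u)) N (generic_opp _ _ Hp)).
  pose proof (half_neq_0 t (- (v - u)) N (generic_opp _ _ Hm)).
  pose proof (one_minus_qof_generic _ _ Hp). pose proof (one_minus_qof_generic _ _ Hm).
  field. repeat split; assumption.
Qed.

Definition Phi (t w : C) (m : nat) : C := half t w m ^ 2 / (half t 0 m * half t (w + w) m).

(** The residue of the factor that owns the pole, the same for every index. *)
Definition lead (w : C) : C := (1 - qof w) ^ 2 / (1 - qof (w + w)).

(* The coefficient of the pole of index [n] in the product over [-N <= j <= N]: the
   factors on either side of the pole number [N + n] and [N - n]. *)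
Definition coef (t w : C) (N : nat) (n : Z) : C :=
  lead w * Phi t (- w) (Z.to_nat (Z.of_nat N + n)) * Phi t w (Z.to_nat (Z.of_nat N - n)).

Lemma zero_generic (t : C) (n : Z) : in_H t -> n <> 0%Z -> qof (0 + IZR n * t) <> 1.
Proof. intros Ht Hn. rewrite Cplus_0_l. now apply qof_period_lattice_neq_1. Qed.

(** At the pole i the factor j depends on j - i only. Re-centring the product at i therefore leaves
    i factors of negative index and 2N - i of positive index, each side a quotient of [half]
    products. *)
Lemma pf_coef_coef (t w : C) (N i : nat) :
  in_H t -> generic t (w + w) -> (i < N + 1 + N)%nat ->
  pf_coef (fun j => qof (IZR (Z.of_nat j - Z.of_nat N) * t))
    (fun j => qof (- w + IZR (Z.of_nat j - Z.of_nat N) * t))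
    (fun j => qof (w + IZR (Z.of_nat j - Z.of_nat N) * t)) i (N + 1 + N)
  = coef t w N (Z.of_nat i - Z.of_nat N).
Proof.
  intros Ht Hw Hi. unfold pf_coef.
  set (g := fun n => if Z.eqb n 0 then lead w else ratio t w 0 (w + w) n).
  rewrite (Cprod_ext _ (fun j => g (Z.of_nat j - Z.of_nat i)%Z)).
  - replace (N + 1 + N)%nat with (i + 1 + (N + N - i))%nat by lia.
    rewrite Cprod_two_sided.
    rewrite (Cprod_ext _ (fun k => ratio t w 0 (w + w) (- Z.of_nat (S k)))) by reflexivity.
    rewrite (Cprod_ext (fun k => g (Z.of_nat (S k))) (fun k => ratio t w 0 (w + w) (Z.of_nat (S k))))
      by reflexivity.
    rewrite Cprod_ratio, Cprod_ratio_opp;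
      [ | ring | intros; now apply zero_generic | intros; apply Hw
        | intros; apply zero_generic; [exact Ht | lia] | intros; apply Hw].
    unfold coef, Phi. simpl (g 0%Z).
    replace (Z.to_nat (Z.of_nat N + (Z.of_nat i - Z.of_nat N))) with i by lia.
    replace (Z.to_nat (Z.of_nat N - (Z.of_nat i - Z.of_nat N))) with (N + N - i)%nat by lia.
    replace (- RtoC 0) with (RtoC 0) by ring. replace (- w + - w) with (- (w + w)) by ring.
    reflexivity.
  - intros j _. unfold g.
    assert (Hq : forall z z', / qof z * qof z' = qof (z' - z)).
    { intros z z'. rewrite <- qof_opp, <- qof_plus. f_equal. ring. }
    destruct (Nat.eqb_spec j i) as [-> | Hji].
    + rewrite Z.sub_diag. simpl. unfold residue, lead, Cdiv.
      rewrite <- !qof_opp, <- !qof_plus.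
      set (z := IZR _ * t).
      replace (z + - (- w + z)) with w by ring.
      replace (w + z + - (- w + z)) with (w + w) by ring. reflexivity.
    + replace (Z.of_nat j - Z.of_nat i =? 0)%Z with false by (symmetry; apply Z.eqb_neq; lia).
      unfold rho, ratio. rewrite !Hq.
      replace (IZR (Z.of_nat j - Z.of_nat i))
        with (IZR (Z.of_nat j - Z.of_nat N) - IZR (Z.of_nat i - Z.of_nat N))%R
        by (rewrite <- minus_IZR; f_equal; lia).
      rewrite RtoC_minus.
      set (x := RtoC (IZR (Z.of_nat j - Z.of_nat N))).
      set (y := RtoC (IZR (Z.of_nat i - Z.of_nat N))).
      replace (x * t - (- w + y * t)) with (w + (x - y) * t) by ring.
      replace (- w + x * t - (- w + y * t)) with (0 + (x - y) * t) by ring.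
      replace (w + x * t - (- w + y * t)) with (w + w + (x - y) * t) by ring.
      reflexivity.
Qed.

(** The partial fraction expansion at [qof v] minus the one at [qof 0]. The latter value is 0
    because [theta t 0 N] has the factor 1 - [qof 0]; so the unspecified constant c drops out and
    differences of [kappa] appear. *)
Lemma finite_identity (t u v : C) (N : nat) :
  in_H t -> generic t u -> generic t (u + u) -> generic t (v + u) -> generic t (v - u) ->
  theta t v N ^ 2 / (theta t (v + u) N * theta t (v - u) N)
  = Csum (fold (fun n =>
      coef t (- u) N n * (kappa (v + u + IZR n * t) - kappa (u + IZR n * t))
      + coef t u N n * (kappa (v - u + IZR n * t) - kappa (- u + IZR n * t)))) (S N).
Proof.
  intros Ht Hu Huu Hp Hm.
  set (b := fun j => qof (IZR (Z.of_nat j - Z.of_nat N) * t)).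
  set (a := fun j => qof (u + IZR (Z.of_nat j - Z.of_nat N) * t)).
  set (a' := fun j => qof (- u + IZR (Z.of_nat j - Z.of_nat N) * t)).
  assert (Hqq : forall z z', qof (z - z') <> 1 -> qof z <> qof z').
  { intros z z' H E. apply H. unfold Cminus. rewrite qof_plus, qof_opp, E. field.
    apply qof_neq_0. }
  destruct (partial_fractions b a a' (N + 1 + N)) as [c Hc].
  - intros i. apply qof_neq_0.
  - intros i. apply qof_neq_0.
  - intros i j Hij. apply Hqq.
    replace (u + IZR (Z.of_nat i - Z.of_nat N) * t - (u + IZR (Z.of_nat j - Z.of_nat N) * t))
      with (IZR (Z.of_nat i - Z.of_nat j) * t) by (rewrite !minus_IZR, !RtoC_minus; ring).
    apply qof_period_lattice_neq_1; [exact Ht | lia].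
  - intros i j Hij. apply Hqq.
    replace (- u + IZR (Z.of_nat i - Z.of_nat N) * t - (- u + IZR (Z.of_nat j - Z.of_nat N) * t))
      with (IZR (Z.of_nat i - Z.of_nat j) * t) by (rewrite !minus_IZR, !RtoC_minus; ring).
    apply qof_period_lattice_neq_1; [exact Ht | lia].
  - intros i j. apply Hqq.
    replace (u + IZR (Z.of_nat i - Z.of_nat N) * t - (- u + IZR (Z.of_nat j - Z.of_nat N) * t))
      with (u + u + IZR (Z.of_nat i - Z.of_nat j) * t) by (rewrite !minus_IZR, !RtoC_minus; ring).
    apply Huu.
  - assert (Hx : forall x, generic t (x + u) -> generic t (x - u) ->
      theta t x N ^ 2 / (theta t (x + u) N * theta t (x - u) N)
      = c + Csum (fun i => coef t (- u) N (Z.of_nat i - Z.of_nat N)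
            * kappa (x + u + IZR (Z.of_nat i - Z.of_nat N) * t)
          + coef t u N (Z.of_nat i - Z.of_nat N)
            * kappa (x - u + IZR (Z.of_nat i - Z.of_nat N) * t)) (N + 1 + N)).
    { intros x Hxp Hxm. rewrite <- theta_partial_product by assumption.
      assert (Ea : forall i, 1 - qof x * a i = 1 - qof (x + u + IZR (Z.of_nat i - Z.of_nat N) * t)).
      { intros i. unfold a. rewrite <- qof_plus, Cplus_assoc. reflexivity. }
      assert (Ea' : forall i, 1 - qof x * a' i = 1 - qof (x - u + IZR (Z.of_nat i - Z.of_nat N) * t)).
      { intros i. unfold a'. rewrite <- qof_plus, Cplus_assoc. reflexivity. }
      etransitivity; [apply (Hc (qof x)) | ].
      - intros i Hi. rewrite Ea, Ea'. split; apply one_minus_qof_neq_0; [apply Hxp | apply Hxm].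
      - f_equal. apply Csum_ext. intros i Hi. rewrite Ea, Ea'. unfold kappa, Cdiv.
        rewrite <- pf_coef_coef with (w := u) by assumption.
        rewrite <- pf_coef_coef with (w := - u);
          [ | exact Ht | | exact Hi].
        + replace (- - u) with u by ring. reflexivity.
        + replace (- u + - u) with (- (u + u)) by ring. now apply generic_opp. }
    assert (Hu' : generic t (- u)) by now apply generic_opp.
    pose proof (Hx v Hp Hm) as Ev.
    pose proof (Hx 0) as E0. rewrite Cplus_0_l in E0.
    replace (0 - u) with (- u) in E0 by ring.
    specialize (E0 Hu Hu').
    assert (Z0 : theta t 0 N = 0) by (unfold theta; rewrite qof_0; ring).
    rewrite Csum_fold. replace (2 * N + 1)%nat with (N + 1 + N)%nat by lia.
    rewrite <- (Cplus_0_r (_ / _)), Ev.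
    replace (RtoC 0) with (- (theta t 0 N ^ 2 / (theta t u N * theta t (- u) N)))
      by (rewrite Z0; unfold Cdiv; ring).
    rewrite E0.
    match goal with |- c + Csum ?f ?n + - (c + Csum ?g _) = _ =>
      transitivity (Csum (fun i => f i + -1 * g i) n);
        [rewrite (Csum_plus f (fun i => -1 * g i)), (Csum_scal (-1) g); ring | ] end.
    apply Csum_ext. intros i _. ring.
Qed.

(** * The product formula *)

Lemma Cdiv_neq_0 (x y : C) : x <> 0 -> y <> 0 -> x / y <> 0.
Proof.
  intros Hx Hy E. apply Hx. replace x with (x / y * y) by (field; exact Hy).
  rewrite E. ring.
Qed.

Lemma Cmod_qof_lattice (t w : C) (n : nat) :
  Cmod (qof (w + IZR (Z.of_nat n) * t)) = (Cmod (qof w) * Cmod (qof t) ^ n)%R.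
Proof. now rewrite qof_plus, Cmod_mult, <- INR_IZR_INZ, qof_pow, Cmod_pow. Qed.

Lemma ex_series_nome (t : C) : in_H t -> ex_series (fun n => Cmod (qof t) ^ n)%R.
Proof.
  intros Ht. apply ex_series_geom. destruct (Cmod_qof_lt_1 t Ht).
  rewrite Rabs_pos_eq; lra.
Qed.

(** A total function, so that infinite products can be named before their convergence is proved; its
    value is meaningful only through [Clim_unique]. *)
Definition Clim (u : nat -> C) : C :=
  (real (Lim_seq (fun n => Re (u n))), real (Lim_seq (fun n => Im (u n)))).

Lemma Clim_unique (u : nat -> C) (l : C) : Cconv u l -> Clim u = l.
Proof.
  intros H.
  assert (G : forall p : C -> R, (forall z, Rabs (p z) <= Cmod z)%R ->
    (forall z w : C, p (z - w) = (p z - p w)%R) -> real (Lim_seq (fun n => p (u n))) = p l).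
  { intros p Hp Hlin.
    rewrite (is_lim_seq_unique (fun n => p (u n)) (p l)); [reflexivity | ].
    apply is_lim_seq_spec. intros eps.
    destruct (proj1 (Cconv_eps u l) H eps (cond_pos eps)) as [N HN].
    exists N. intros n Hn. change (Rabs (p (u n) - p l) < eps)%R. rewrite <- Hlin.
    eapply Rle_lt_trans; [apply Hp | auto]. }
  unfold Clim. apply C_eq.
  - exact (G Re re_le_Cmod (fun _ _ => eq_refl)).
  - exact (G Im im_le_Cmod (fun _ _ => eq_refl)).
Qed.

Definition half_inf (t w : C) : C := Clim (half t w).

Lemma half_conv (t w : C) : in_H t ->
  (forall n, (0 < n)%Z -> qof (w + IZR n * t) <> 1) ->
  Cconv (half t w) (half_inf t w) /\ half_inf t w <> 0.
Proof.
  intros Ht Hw.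
  destruct (Cprod_conv_neq_0 (fun k => - qof (w + IZR (Z.of_nat (S k)) * t))
    (fun k => Cmod (qof w) * Cmod (qof t) * Cmod (qof t) ^ k)%R) as [l [Hl0 Hl]].
  - intros k. rewrite Cmod_opp, Cmod_qof_lattice. simpl. lra.
  - apply ex_series_Rscal. now apply ex_series_nome.
  - intros k. apply one_minus_qof_neq_0, Hw. lia.
  - assert (H : Cconv (half t w) l) by exact Hl.
    unfold half_inf. rewrite (Clim_unique _ _ H). auto.
Qed.

(** [kappa z - 1] is [qof z / (1 - qof z)]: the numerator decays geometrically, and the denominators
    tend to 1 without vanishing, hence are bounded below. *)
Lemma kappa_tail (t w : C) : in_H t ->
  (forall n : nat, qof (w + IZR (Z.of_nat n) * t) <> 1) ->
  exists B, (0 <= B)%R /\ forall n : nat,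
    (Cmod (kappa (w + IZR (Z.of_nat n) * t) - 1) <= B * Cmod (qof t) ^ n)%R.
Proof.
  intros Ht Hw.
  set (a := fun n => - qof (w + IZR (Z.of_nat n) * t)).
  assert (Ha : forall n, (Cmod (a n) <= Cmod (qof w) * Cmod (qof t) ^ n)%R).
  { intros n. unfold a. rewrite Cmod_opp, Cmod_qof_lattice. lra. }
  assert (Hb : ex_series (fun n => Cmod (qof w) * Cmod (qof t) ^ n)%R)
    by (apply ex_series_Rscal; now apply ex_series_nome).
  pose proof (Cconv_plus _ _ _ _ (Cconv_const 1) (ex_series_term_conv a _ Ha Hb)) as H.
  rewrite Cplus_0_r in H.
  destruct (Cconv_bounded_below _ _ H C1_nz) as [B [HB Hbelow]].
  { intros n. apply one_minus_qof_neq_0, Hw. }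
  exists (B * Cmod (qof w))%R.
  split; [apply Rmult_le_pos; [lra | apply Cmod_ge_0] | ].
  intros n. specialize (Hbelow n). specialize (Ha n).
  pose proof (one_minus_qof_neq_0 _ (Hw n)) as Hn.
  replace (kappa (w + IZR (Z.of_nat n) * t) - 1) with (- a n * / (1 + a n))
    by (unfold kappa, a; field; exact Hn).
  rewrite Cmod_mult, Cmod_opp, Cmod_inv by exact Hn.
  rewrite Rmult_comm, Rmult_assoc.
  apply Rmult_le_compat; try assumption; try apply Cmod_ge_0.
  left. apply Rinv_0_lt_compat. now apply Cmod_gt_0.
Qed.

Lemma kappa_opp (z : C) : qof z <> 1 -> kappa (- z) = 1 - kappa z.
Proof.
  intros H. pose proof (one_minus_qof_neq_0 _ H) as H1. unfold kappa. rewrite qof_opp.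
  assert (H2 : qof z - 1 <> 0) by (now apply Cminus_neq_0).
  pose proof (qof_neq_0 z). field. repeat split; assumption.
Qed.

(** The limits of [kappa] at the two ends do not depend on the point and cancel in the difference;
    negative n is carried to positive n by kappa(-z) = 1 - kappa(z). *)
Lemma kappa_diff_bound (t w1 w2 : C) : in_H t -> generic t w1 -> generic t w2 ->
  exists B, (0 <= B)%R /\ forall n : Z,
    (Cmod (kappa (w1 + IZR n * t) - kappa (w2 + IZR n * t))
      <= B * Cmod (qof t) ^ Z.abs_nat n)%R.
Proof.
  intros Ht H1 H2.
  pose proof (generic_opp _ _ H1) as H1'. pose proof (generic_opp _ _ H2) as H2'.
  destruct (kappa_tail t w1 Ht (fun n => H1 _)) as [B1 [HB1 E1]].
  destruct (kappa_tail t w2 Ht (fun n => H2 _)) as [B2 [HB2 E2]].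
  destruct (kappa_tail t (- w1) Ht (fun n => H1' _)) as [B3 [HB3 E3]].
  destruct (kappa_tail t (- w2) Ht (fun n => H2' _)) as [B4 [HB4 E4]].
  exists (B1 + B2 + B3 + B4)%R. split; [lra | ]. intros n.
  assert (Hr : (0 <= Cmod (qof t) ^ Z.abs_nat n)%R) by (apply pow_le, Cmod_ge_0).
  set (r := (Cmod (qof t) ^ Z.abs_nat n)%R) in *.
  destruct (Z_le_gt_dec 0 n) as [Hn | Hn].
  - specialize (E1 (Z.abs_nat n)). specialize (E2 (Z.abs_nat n)).
    rewrite Zabs2Nat.id_abs, Z.abs_eq in E1, E2 by exact Hn. fold r in E1, E2.
    replace (kappa (w1 + IZR n * t) - kappa (w2 + IZR n * t))
      with ((kappa (w1 + IZR n * t) - 1) + - (kappa (w2 + IZR n * t) - 1)) by ring.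
    eapply Rle_trans; [apply Cmod_triangle | ]. rewrite Cmod_opp. nra.
  - specialize (E3 (Z.abs_nat n)). specialize (E4 (Z.abs_nat n)).
    rewrite Zabs2Nat.id_abs, Z.abs_neq in E3, E4 by lia. fold r in E3, E4.
    assert (Ek : forall w, generic t (- w) ->
      kappa (w + IZR n * t) = 1 - kappa (- w + IZR (- n) * t)).
    { intros w Hw. rewrite <- kappa_opp by apply Hw. f_equal.
      rewrite opp_IZR, RtoC_opp. ring. }
    rewrite (Ek w1 H1'), (Ek w2 H2').
    replace (1 - kappa (- w1 + IZR (- n) * t) - (1 - kappa (- w2 + IZR (- n) * t)))
      with ((kappa (- w2 + IZR (- n) * t) - 1) + - (kappa (- w1 + IZR (- n) * t) - 1)) by ring.
    eapply Rle_trans; [apply Cmod_triangle | ]. rewrite Cmod_opp. nra.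
Qed.

Definition theta_inf (t w : C) : C := (1 - qof w) * half_inf t w * half_inf t (- w).

Lemma half_generic (t w : C) : in_H t -> generic t w ->
  Cconv (half t w) (half_inf t w) /\ half_inf t w <> 0.
Proof. intros Ht Hw. apply half_conv; auto. Qed.

Lemma theta_conv (t w : C) : in_H t -> generic t w ->
  Cconv (theta t w) (theta_inf t w) /\ theta_inf t w <> 0.
Proof.
  intros Ht Hw. destruct (half_generic t w Ht Hw) as [A A0].
  destruct (half_generic t (- w) Ht (generic_opp _ _ Hw)) as [B B0].
  split.
  - apply Cconv_mult; [ | exact B]. apply Cconv_mult; [apply Cconv_const | exact A].
  - unfold theta_inf. repeat apply Cmult_neq_0; trivial. now apply one_minus_qof_generic with t.
Qed.

Definition Phi_inf (t w : C) : C :=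
  half_inf t w ^ 2 / (half_inf t 0 * half_inf t (w + w)).

Lemma Phi_conv (t w : C) : in_H t -> generic t w -> generic t (w + w) ->
  Cconv (Phi t w) (Phi_inf t w).
Proof.
  intros Ht Hw Hww.
  destruct (half_generic t w Ht Hw) as [A A0].
  destruct (half_generic t (w + w) Ht Hww) as [B B0].
  destruct (half_conv t 0 Ht) as [E E0]; [intros; apply zero_generic; trivial; lia | ].
  apply Cconv_div; [ | now apply Cconv_mult | now apply Cmult_neq_0].
  apply Cconv_ext with (fun n => half t w n * half t w n); [intros n; ring | ].
  replace (half_inf t w ^ 2) with (half_inf t w * half_inf t w) by ring.
  now apply Cconv_mult.
Qed.

(** Makes the limits of the two families of coefficients in [finite_identity] opposite, which
    produces the minus sign inside [lamterm]. *)
Lemma lead_opp (w : C) : qof (w + w) <> 1 -> lead (- w) = - lead w.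
Proof.
  intros H. unfold lead. replace (- w + - w) with (- (w + w)) by ring.
  rewrite !one_minus_qof_opp. pose proof (one_minus_qof_neq_0 _ H).
  pose proof (qof_neq_0 (- w)) as Hq.
  replace (qof (- (w + w))) with (qof (- w) * qof (- w))
    by (rewrite <- qof_plus; f_equal; ring).
  field. auto.
Qed.

(** The limit of [finite_identity]. The coefficients are bounded and tend to K and -K, independently
    of n, and the differences of [kappa] decay geometrically; dividing by K isolates [lamterm]. *)
Lemma lam_product (t u v : C) :
  in_H t -> generic t u -> generic t (u + u) -> generic t v ->
  generic t (v + u) -> generic t (v - u) ->
  Cser (fold (lamterm t u v))
    (half_inf t 0 ^ 2 * theta_inf t (- (u + u)) * theta_inf t v ^ 2
      / (theta_inf t (- u) ^ 2 * theta_inf t (v + u) * theta_inf t (v - u))).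
Proof.
  intros Ht Hu Huu Hv Hp Hm.
  pose proof (generic_opp _ _ Hu) as Hu'.
  assert (Huu' : generic t (- u + - u)).
  { replace (- u + - u) with (- (u + u)) by ring. now apply generic_opp. }
  set (d1 := fun n : Z => kappa (v + u + IZR n * t) - kappa (u + IZR n * t)).
  set (d2 := fun n : Z => kappa (v - u + IZR n * t) - kappa (- u + IZR n * t)).
  pose proof (Phi_conv t u Ht Hu Huu) as HPhi.
  pose proof (Phi_conv t (- u) Ht Hu' Huu') as HPhi'.
  set (K := lead (- u) * Phi_inf t u * Phi_inf t (- u)).
  set (R := theta_inf t v ^ 2 / (theta_inf t (v + u) * theta_inf t (v - u))).
  destruct (theta_conv t v Ht Hv) as [Tv Tv0].
  destruct (theta_conv t (v + u) Ht Hp) as [Tp Tp0].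
  destruct (theta_conv t (v - u) Ht Hm) as [Tm Tm0].
  assert (Hto : forall n : Z, filterlim (fun N => Z.to_nat (Z.of_nat (pred N) + n))
    eventually eventually).
  { intros n. apply filterlim_nat. intros N. exists (S (N + Z.abs_nat n)). lia. }
  assert (Hcoef : forall w n, generic t w -> generic t (w + w) -> generic t (- w) ->
    generic t (- w + - w) ->
    Cconv (fun N => coef t w (pred N) n) (lead w * Phi_inf t (- w) * Phi_inf t w)).
  { intros w n G1 G2 G3 G4. unfold coef. apply Cconv_mult.
    - apply Cconv_scal. apply (Cconv_comp _ (Phi t (- w))); [apply Hto | now apply Phi_conv].
    - apply (Cconv_comp _ (Phi t w)); [apply (Hto (- n)%Z) | now apply Phi_conv]. }
  assert (Hmain : Cser (fold (fun n => K * (d1 n - d2 n))) R).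
  { destruct (kappa_diff_bound t (v + u) u Ht Hp Hu) as [B1 [HB1 E1]].
    destruct (kappa_diff_bound t (v - u) (- u) Ht Hm Hu') as [B2 [HB2 E2]].
    destruct (Cconv_bounded _ _ HPhi) as [P1 [HP1 F1]].
    destruct (Cconv_bounded _ _ HPhi') as [P2 [HP2 F2]].
    set (L := (Cmod (lead u) + Cmod (lead (- u)))%R).
    pose proof (Cmod_ge_0 (lead u)) as L1. pose proof (Cmod_ge_0 (lead (- u))) as L2.
    assert (HP : (0 < P1 * P2)%R) by now apply Rmult_lt_0_compat.
    assert (C1 : forall N n, (Cmod (coef t (- u) N n) <= L * (P1 * P2))%R).
    { intros N n. unfold coef. replace (- - u) with u by ring.
      rewrite !Cmod_mult, Rmult_assoc.
      apply Rmult_le_compat; [apply Cmod_ge_0 | | unfold L; lra | ].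
      - apply Rmult_le_pos; apply Cmod_ge_0.
      - apply Rmult_le_compat; [apply Cmod_ge_0 | apply Cmod_ge_0 | apply F1 | apply F2]. }
    assert (C2 : forall N n, (Cmod (coef t u N n) <= L * (P1 * P2))%R).
    { intros N n. unfold coef. rewrite !Cmod_mult, Rmult_assoc, (Rmult_comm P1).
      apply Rmult_le_compat; [apply Cmod_ge_0 | | unfold L; lra | ].
      - apply Rmult_le_pos; apply Cmod_ge_0.
      - apply Rmult_le_compat; [apply Cmod_ge_0 | apply Cmod_ge_0 | apply F2 | apply F1]. }
    (* [Cser_tannery] sums N folded terms, while truncation at N in [finite_identity] has N + 1 of
       them; hence [pred N]. *)
    apply (Cser_tannery
      (fun N => fold (fun n => coef t (- u) (pred N) n * d1 n + coef t u (pred N) n * d2 n))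
      _ (fun k => 2 * (L * (P1 * P2) * (B1 + B2)) * Cmod (qof t) ^ k)%R O).
    - intros k. apply Rmult_le_pos; [ | apply pow_le, Cmod_ge_0].
      apply Rmult_le_pos; [lra | ]. repeat apply Rmult_le_pos; unfold L; lra.
    - apply ex_series_Rscal. now apply ex_series_nome.
    - intros N k _. rewrite Rmult_assoc. apply fold_bound. intros n <-.
      eapply Rle_trans; [apply Cmod_triangle | ]. rewrite !Cmod_mult.
      set (r := (Cmod (qof t) ^ Z.abs_nat n)%R).
      replace (L * (P1 * P2) * (B1 + B2) * r)%R
        with (L * (P1 * P2) * (B1 * r) + L * (P1 * P2) * (B2 * r))%R by ring.
      apply Rplus_le_compat.
      + apply Rmult_le_compat; [apply Cmod_ge_0 | apply Cmod_ge_0 | exact (C1 _ _) | exact (E1 n)].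
      + apply Rmult_le_compat; [apply Cmod_ge_0 | apply Cmod_ge_0 | exact (C2 _ _) | exact (E2 n)].
    - intros k. apply Cconv_fold. intros n.
      replace (K * (d1 n - d2 n))
        with (lead (- u) * Phi_inf t u * Phi_inf t (- u) * d1 n
          + lead u * Phi_inf t (- u) * Phi_inf t u * d2 n).
      + apply Cconv_plus; (apply Cconv_mult; [ | apply Cconv_const]).
        * pose proof (Hcoef (- u) n Hu' Huu') as H. replace (- - u) with u in H by ring.
          now apply H.
        * now apply Hcoef.
      + unfold K. rewrite lead_opp; [ring | ].
        replace (u + u) with (u + u + IZR 0 * t) by ring. apply Huu.
    - apply Cconv_S. cbn [pred].
      apply Cconv_ext with (fun N => theta t v N ^ 2 / (theta t (v + u) N * theta t (v - u) N)).
      + intros N. now apply finite_identity.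
      + apply Cconv_div; [ | now apply Cconv_mult | now apply Cmult_neq_0].
        apply Cconv_ext with (fun n => theta t v n * theta t v n); [intros n; ring | ].
        replace (theta_inf t v ^ 2) with (theta_inf t v * theta_inf t v) by ring.
        now apply Cconv_mult. }
  destruct (half_conv t 0 Ht) as [_ E0]; [intros; apply zero_generic; trivial; lia | ].
  destruct (half_generic t u Ht Hu) as [_ U0].
  destruct (half_generic t (- u) Ht Hu') as [_ U0'].
  destruct (half_generic t (u + u) Ht Huu) as [_ UU0].
  destruct (half_generic t (- u + - u) Ht Huu') as [_ UU0'].
  pose proof (one_minus_qof_generic _ _ Hu') as Q1.
  pose proof (one_minus_qof_generic _ _ Huu') as Q2.
  assert (EK : K = theta_inf t (- u) ^ 2 / (half_inf t 0 ^ 2 * theta_inf t (- (u + u)))).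
  { unfold K, lead, Phi_inf, theta_inf.
    replace (- - u) with u by ring. replace (- - (u + u)) with (u + u) by ring.
    replace (- (u + u)) with (- u + - u) by ring. field. repeat split; assumption. }
  destruct (theta_conv t (- u) Ht Hu') as [_ Tu0].
  destruct (theta_conv t (- (u + u)) Ht (generic_opp _ _ Huu)) as [_ Tuu0].
  assert (HK : K <> 0).
  { rewrite EK. apply Cdiv_neq_0; [now apply Cpow_nz | ].
    apply Cmult_neq_0; [now apply Cpow_nz | assumption]. }
  apply (Cser_scal (/ K)) in Hmain.
  match goal with |- Cser _ ?l => replace l with (/ K * R) end.
  - apply Cser_ext with (2 := Hmain). intros k. rewrite fold_scal, Cmult_assoc, Cinv_l by exact HK.
    apply Cmult_1_l.
  - rewrite EK. unfold R. field. repeat split; assumption.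
Qed.

(** * Theta products at the points of order seven *)

(** Convergence shows that the filter under [lim] is Cauchy, so [complete_cauchy] places [hprod q]
    close to l, and closeness in a normed module is equality. *)
Lemma hprod_unique (q l : C) : Cconv (hpartial q) l -> hprod q = l.
Proof.
  intros H. unfold hprod.
  set (F := filtermap (hpartial q) eventually).
  assert (Hev : forall eps : posreal, F (@ball C_UniformSpace l eps)).
  { intros eps. destruct (proj1 (Cconv_eps _ _) H eps (cond_pos eps)) as [N HN].
    exists N. intros n Hn. specialize (HN n Hn).
    apply C_NormedModule_mixin_compat1. exact HN. }
  assert (PF : ProperFilter F) by (apply filtermap_proper_filter, eventually_filter).
  assert (HC := @complete_cauchy
    (CompleteNormedModule.CompleteSpace C_AbsRing C_CompleteNormedModule) F PF
    (fun eps => ex_intro _ l (Hev eps))).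
  apply (@eq_close C_AbsRing C_NormedModule). intros eps.
  destruct (filter_ex _ (filter_and _ _ (HC (pos_div_2 eps)) (Hev (pos_div_2 eps))))
    as [z [Hz1 Hz2]].
  rewrite <- (Rplus_half_diag eps). apply ball_triangle with z; [exact Hz1 | now apply ball_sym].
Qed.

Lemma half_shift (t w : C) (N : nat) :
  half t w (S N) = (1 - qof (w + t)) * half t (w + t) N.
Proof.
  unfold half. rewrite Cprod_shift. f_equal.
  - do 2 f_equal. simpl. ring.
  - apply Cprod_ext. intros k _. do 2 f_equal.
    rewrite (Nat2Z.inj_succ (S k)), succ_IZR, RtoC_plus. ring.
Qed.

Lemma half_inf_shift (t w : C) : in_H t -> generic t w ->
  half_inf t w = (1 - qof (w + t)) * half_inf t (w + t).
Proof.
  intros Ht Hw.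
  assert (Hw' : generic t (w + t)).
  { replace (w + t) with (w + IZR 1 * t) by ring. now apply generic_shift. }
  destruct (half_generic t w Ht Hw) as [H _].
  destruct (half_generic t (w + t) Ht Hw') as [H' _].
  apply (Cconv_unique (fun N => half t w (S N))).
  - now apply Cconv_S in H.
  - apply Cconv_ext with (fun N => (1 - qof (w + t)) * half t (w + t) N).
    + intros N. now rewrite half_shift.
    + now apply Cconv_scal.
Qed.

Lemma theta_inf_opp (t w : C) : theta_inf t (- w) = - qof (- w) * theta_inf t w.
Proof.
  unfold theta_inf. rewrite one_minus_qof_opp. replace (- - w) with w by ring. ring.
Qed.

(** Shifting by one period moves a single factor between the two half products. With [theta_inf_opp]
    this reduces all the septic theta values needed to those of index 1, 2, 3. *)
Lemma theta_inf_reflect (t w : C) : in_H t -> generic t w ->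
  theta_inf t (t - w) = theta_inf t w.
Proof.
  intros Ht Hw.
  assert (Hw1 : generic t (- w)) by now apply generic_opp.
  assert (Hw2 : generic t (w - t)).
  { replace (w - t) with (w + IZR (-1) * t) by ring. now apply generic_shift. }
  unfold theta_inf. replace (- (t - w)) with (w - t) by ring.
  rewrite (half_inf_shift t (- w)), (half_inf_shift t (w - t)) by assumption.
  replace (w - t + t) with w by ring. replace (- w + t) with (t - w) by ring. ring.
Qed.

Section Septic.
Variable tau : C.
Hypothesis Htau : in_H tau.
Let t : C := 7 * tau.
Let q : C := qof tau.

Lemma seven_tau_in_H : in_H t.
Proof. unfold in_H, t in *. destruct tau; simpl in *. lra. Qed.

Lemma multiple_neq_1 (n : Z) : n <> 0%Z -> qof (IZR n * tau) <> 1.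
Proof. now apply qof_period_lattice_neq_1. Qed.

Lemma multiple_generic (g : Z) : (g mod 7 <> 0)%Z -> generic t (IZR g * tau).
Proof.
  intros Hg n. unfold t.
  replace (IZR g * tau + IZR n * (7 * tau)) with (IZR (g + 7 * n) * tau)
    by (rewrite plus_IZR, mult_IZR, RtoC_plus, RtoC_mult; ring).
  apply multiple_neq_1. intros E. apply Hg.
  replace g with ((- n) * 7)%Z by lia. apply Z_mod_mult.
Qed.

Definition septic_theta (g : Z) : C := theta_inf t (IZR g * tau).
Let T := septic_theta.

Lemma qof_multiple (g : nat) : qof (IZR (Z.of_nat g) * tau) = q ^ g.
Proof. now rewrite <- INR_IZR_INZ, qof_pow. Qed.

Lemma septic_theta_opp (g : nat) : T (- Z.of_nat g) = - / q ^ g * T (Z.of_nat g).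
Proof.
  unfold T, septic_theta. rewrite opp_IZR, RtoC_opp.
  replace (- IZR (Z.of_nat g) * tau) with (- (IZR (Z.of_nat g) * tau)) by ring.
  now rewrite theta_inf_opp, qof_opp, qof_multiple.
Qed.

Lemma septic_theta_reflect (g : Z) : (g mod 7 <> 0)%Z -> T (7 - g) = T g.
Proof.
  intros Hg. unfold T, septic_theta. rewrite minus_IZR, RtoC_minus.
  replace ((7 - IZR g) * tau) with (t - IZR g * tau) by (unfold t; ring).
  apply theta_inf_reflect; [apply seven_tau_in_H | now apply multiple_generic].
Qed.

Lemma septic_theta_neq_0 (g : Z) : (g mod 7 <> 0)%Z -> T g <> 0.
Proof.
  intros Hg. apply theta_conv; [apply seven_tau_in_H | now apply multiple_generic].
Qed.

Definition septic_product (g : nat) (N : nat) : C :=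
  Cprod (fun k => (1 - q ^ (7 * k + g)) * (1 - q ^ (7 * k + (7 - g)))) N.

Lemma septic_product_conv (g : nat) : (0 < g < 7)%nat ->
  Cconv (septic_product g) (T (Z.of_nat g)).
Proof.
  intros Hg. pose proof seven_tau_in_H as Ht.
  assert (Hmod : (Z.of_nat g mod 7 <> 0)%Z) by (rewrite Z.mod_small; lia).
  set (w := IZR (Z.of_nat g) * tau).
  assert (Hw : generic t w) by now apply multiple_generic.
  assert (Hw2 : generic t (w - t)).
  { replace (w - t) with (w + IZR (-1) * t) by ring. now apply generic_shift. }
  (* Moving the first half back by one period absorbs the factor 1 - [qof w], and both products then
     start at k = 0. *)
  replace (T (Z.of_nat g)) with (half_inf t (w - t) * half_inf t (- w)).
  - apply Cconv_ext with (fun N => half t (w - t) N * half t (- w) N).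
    + intros N. unfold half, septic_product. rewrite <- Cprod_mult. apply Cprod_ext.
      intros k _.
      assert (E : forall z m, z = IZR (Z.of_nat m) * tau -> 1 - qof z = 1 - q ^ m).
      { intros z m ->. now rewrite qof_multiple. }
      rewrite (E (w - t + IZR (Z.of_nat (S k)) * t) (7 * k + g)%nat).
      2:{ unfold w, t. rewrite !Nat2Z.inj_add, Nat2Z.inj_mul, plus_IZR, mult_IZR,
            Nat2Z.inj_succ, succ_IZR, !RtoC_plus, RtoC_mult.
          change (Z.of_nat 7) with 7%Z. ring. }
      rewrite (E (- w + IZR (Z.of_nat (S k)) * t) (7 * k + (7 - g))%nat).
      2:{ unfold w, t. rewrite !Nat2Z.inj_add, Nat2Z.inj_mul, Nat2Z.inj_sub, plus_IZR,
            mult_IZR, minus_IZR, Nat2Z.inj_succ, succ_IZR, !RtoC_plus, RtoC_mult, RtoC_minus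
            by lia.
          change (Z.of_nat 7) with 7%Z. ring. }
      reflexivity.
    + apply Cconv_mult; apply half_generic; trivial. now apply generic_opp.
  - unfold T, septic_theta, theta_inf. fold w. rewrite (half_inf_shift t (w - t)) by assumption.
    replace (w - t + t) with w by ring. reflexivity.
Qed.

(** The residues g and 7 - g modulo 7 occur in h with equal exponents, so they pair into theta
    values. *)
Lemma h_alt : h tau = / q * (T 3 * T 2 ^ 2 / T 1 ^ 3).
Proof.
  unfold h. fold q. f_equal. apply hprod_unique.
  pose proof (septic_product_conv 1 ltac:(lia)) as H1.
  pose proof (septic_product_conv 2 ltac:(lia)) as H2.
  pose proof (septic_product_conv 3 ltac:(lia)) as H3.
  change (Z.of_nat 1) with 1%Z in H1. change (Z.of_nat 2) with 2%Z in H2.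
  change (Z.of_nat 3) with 3%Z in H3.
  assert (Hpos : forall m, (0 < m)%nat -> 1 - q ^ m <> 0).
  { intros m Hm. unfold q. rewrite <- qof_multiple. apply one_minus_qof_neq_0, multiple_neq_1.
    lia. }
  assert (P0 : forall n, septic_product 1 n <> 0).
  { intros n. apply Cprod_neq_0. intros k _. apply Cmult_neq_0; apply Hpos; lia. }
  assert (T0 : T 1 <> 0) by (apply septic_theta_neq_0; discriminate).
  apply Cconv_ext with (fun n => septic_product 3 n
    * (septic_product 2 n * septic_product 2 n)
    / (septic_product 1 n * (septic_product 1 n * septic_product 1 n))).
  - induction n as [ | n IH]; [unfold septic_product; simpl; field | ].
    simpl hpartial. rewrite <- IH. unfold hfactor.
    change (septic_product ?g (S n)) with
      (septic_product g n * ((1 - q ^ (7 * n + g)) * (1 - q ^ (7 * n + (7 - g))))).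
    change (7 - 1)%nat with 6%nat. change (7 - 2)%nat with 5%nat. change (7 - 3)%nat with 4%nat.
    pose proof (Hpos (7 * n + 1)%nat ltac:(lia)). pose proof (Hpos (7 * n + 6)%nat ltac:(lia)).
    specialize (P0 n).
    set (x1 := 1 - q ^ (7 * n + 1)) in *. set (x6 := 1 - q ^ (7 * n + 6)) in *.
    set (x2 := 1 - q ^ (7 * n + 2)) in *. set (x5 := 1 - q ^ (7 * n + 5)) in *.
    set (x3 := 1 - q ^ (7 * n + 3)) in *. set (x4 := 1 - q ^ (7 * n + 4)) in *.
    field. repeat split; assumption.
  - replace (T 3 * T 2 ^ 2 / T 1 ^ 3) with (T 3 * (T 2 * T 2) / (T 1 * (T 1 * T 1)))
      by (field; exact T0).
    apply Cconv_div; [ | | apply Cmult_neq_0; [ | apply Cmult_neq_0]; exact T0];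
      (apply Cconv_mult; [ | apply Cconv_mult]; assumption).
Qed.

Definition septic_lam (u v : Z) : Z -> C := lamterm t (IZR u * tau) (IZR v * tau).

Lemma septic_lam_product (u v : Z) :
  (u mod 7 <> 0)%Z -> ((u + u) mod 7 <> 0)%Z -> (v mod 7 <> 0)%Z ->
  ((v + u) mod 7 <> 0)%Z -> ((v - u) mod 7 <> 0)%Z ->
  Cser (fold (septic_lam u v))
    (half_inf t 0 ^ 2 * T (- (u + u)) * T v ^ 2
      / (T (- u) ^ 2 * T (v + u) * T (v - u))).
Proof.
  intros H1 H2 H3 H4 H5.
  pose proof (lam_product t (IZR u * tau) (IZR v * tau) seven_tau_in_H) as H.
  unfold T, septic_theta. rewrite !opp_IZR, plus_IZR, plus_IZR, minus_IZR,
    !RtoC_opp, !RtoC_plus, RtoC_minus.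
  replace (- (IZR u + IZR u) * tau) with (- (IZR u * tau + IZR u * tau)) by ring.
  replace (- IZR u * tau) with (- (IZR u * tau)) by ring.
  replace ((IZR v + IZR u) * tau) with (IZR v * tau + IZR u * tau) by ring.
  replace ((IZR v - IZR u) * tau) with (IZR v * tau - IZR u * tau) by ring.
  apply H.
  - now apply multiple_generic.
  - replace (IZR u * tau + IZR u * tau) with (IZR (u + u) * tau)
      by (rewrite plus_IZR, RtoC_plus; ring). now apply multiple_generic.
  - now apply multiple_generic.
  - replace (IZR v * tau + IZR u * tau) with (IZR (v + u) * tau)
      by (rewrite plus_IZR, RtoC_plus; ring). now apply multiple_generic.
  - replace (IZR v * tau - IZR u * tau) with (IZR (v - u) * tau)
      by (rewrite minus_IZR, RtoC_minus; ring). now apply multiple_generic.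
Qed.

(** Modulo 7 and up to sign, every index in the product formula is 1, 2 or 3, and the signs
    contribute powers of q. The witnesses are the resulting monomials in the three theta values;
    both quotients A/B and C'/D reduce to the monomial of [h_alt] with a minus sign. *)
Lemma septic_lam_values : exists A B C' D : C,
  Cser (fold (septic_lam 1 3)) A /\ Cser (fold (septic_lam 2 1)) B /\
  Cser (fold (septic_lam 1 2)) C' /\ Cser (fold (septic_lam 3 2)) D /\
  A = - h tau * B /\ C' = - h tau * D /\ A <> 0 /\ B <> 0.
Proof.
  pose proof (septic_theta_opp 1) as O1. pose proof (septic_theta_opp 2) as O2.
  pose proof (septic_theta_opp 3) as O3. pose proof (septic_theta_opp 4) as O4.
  pose proof (septic_theta_opp 6) as O6.
  pose proof (septic_theta_reflect 3 ltac:(discriminate)) as R4.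
  pose proof (septic_theta_reflect 2 ltac:(discriminate)) as R5.
  pose proof (septic_theta_reflect 1 ltac:(discriminate)) as R6.
  simpl in O1, O2, O3, O4, O6, R4, R5, R6.
  pose proof (septic_theta_neq_0 1 ltac:(discriminate)) as N1.
  pose proof (septic_theta_neq_0 2 ltac:(discriminate)) as N2.
  pose proof (septic_theta_neq_0 3 ltac:(discriminate)) as N3.
  pose proof (qof_neq_0 tau) as Hq. fold q in Hq.
  destruct (half_conv t 0 seven_tau_in_H) as [_ E0].
  { intros. apply zero_generic; [apply seven_tau_in_H | lia]. }
  pose proof (septic_lam_product 1 3) as HA. pose proof (septic_lam_product 2 1) as HB.
  pose proof (septic_lam_product 1 2) as HC. pose proof (septic_lam_product 3 2) as HD.
  simpl in HA, HB, HC, HD.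
  rewrite O1, O2, ?R4 in HA. rewrite O4, O2, O1, ?R4 in HB. rewrite O2, O1 in HC.
  rewrite O6, O3, O1, ?R5, ?R6 in HD.
  set (E := half_inf t 0) in *.
  exists (- E ^ 2 * T 3 / T 1 ^ 2), (E ^ 2 * q * T 1 / T 2 ^ 2),
    (- E ^ 2 * T 2 ^ 3 / (T 1 ^ 3 * T 3)), (E ^ 2 * q * T 2 / T 3 ^ 2).
  repeat split.
  - match type of HA with _ -> _ -> _ -> _ -> _ -> Cser _ ?l =>
      replace (- E ^ 2 * T 3 / T 1 ^ 2) with l by (field; repeat split; assumption) end.
    apply HA; discriminate.
  - match type of HB with _ -> _ -> _ -> _ -> _ -> Cser _ ?l =>
      replace (E ^ 2 * q * T 1 / T 2 ^ 2) with l by (field; repeat split; assumption) end.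
    apply HB; discriminate.
  - match type of HC with _ -> _ -> _ -> _ -> _ -> Cser _ ?l =>
      replace (- E ^ 2 * T 2 ^ 3 / (T 1 ^ 3 * T 3)) with l
        by (field; repeat split; assumption) end.
    apply HC; discriminate.
  - match type of HD with _ -> _ -> _ -> _ -> _ -> Cser _ ?l =>
      replace (E ^ 2 * q * T 2 / T 3 ^ 2) with l by (field; repeat split; assumption) end.
    apply HD; discriminate.
  - rewrite h_alt. field. repeat split; assumption.
  - rewrite h_alt. field. repeat split; assumption.
  - apply Cdiv_neq_0; [ | now apply Cpow_nz].
    apply Cmult_neq_0; [ | assumption]. intros F. apply (Cpow_nz E 2 E0).
    replace (E ^ 2) with (- - E ^ 2) by ring. rewrite F. ring.
  - apply Cdiv_neq_0; [ | now apply Cpow_nz].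
    apply Cmult_neq_0; [apply Cmult_neq_0 | assumption]; [now apply Cpow_nz | assumption].
Qed.
End Septic.

(** * Lambert series *)

(* [kappa (w + n t)] tends to 1 as [n] tends to infinity; the subtracted 1 makes the
   symmetric sum converge, and cancels in [lamterm]. *)
Definition zterm (t w : C) (k : nat) : C :=
  fold (fun n => kappa (w + IZR n * t)) k - match k with O => 0 | S _ => 1 end.

Lemma fold_lamterm (t u v : C) (k : nat) :
  fold (lamterm t u v) k
  = zterm t (v + u) k - zterm t u k - zterm t (v - u) k + zterm t (- u) k.
Proof. unfold zterm, lamterm. destruct k; simpl; ring. Qed.

Lemma Cser_lamterm (t u v z1 z2 z3 z4 : C) :
  Cser (zterm t (v + u)) z1 -> Cser (zterm t u) z2 ->
  Cser (zterm t (v - u)) z3 -> Cser (zterm t (- u)) z4 ->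
  Cser (fold (lamterm t u v)) (z1 - z2 - z3 + z4).
Proof.
  intros H1 H2 H3 H4.
  apply Cser_ext with (fun k => zterm t (v + u) k - zterm t u k - zterm t (v - u) k
    + zterm t (- u) k); [intros k; now rewrite fold_lamterm | ].
  apply Cser_plus; [ | exact H4]. apply Cser_minus; [ | exact H3]. now apply Cser_minus.
Qed.

Lemma kappa_lattice_opp (t w : C) (n : Z) : generic t w ->
  kappa (- w + IZR n * t) = 1 - kappa (w + IZR (- n) * t).
Proof.
  intros Hw. rewrite <- kappa_opp by apply Hw. f_equal. rewrite opp_IZR, RtoC_opp. ring.
Qed.

(** For k > 0 the two ones produced by reflection outweigh the subtracted one by exactly what
    changes the sign of the term; only k = 0 leaves a 1. *)
Lemma zterm_opp (t w z : C) : generic t w ->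
  Cser (zterm t w) z -> Cser (zterm t (- w)) (1 - z).
Proof.
  intros Hw Hz.
  apply Cser_ext with (fun k => match k with O => 1 | S _ => 0 end - zterm t w k).
  - intros k. unfold zterm. rewrite (fold_ext _ _ k (fun n => kappa_lattice_opp t w n Hw)).
    destruct k; unfold fold.
    + change (- 0)%Z with 0%Z. ring.
    + rewrite Z.opp_involutive. ring.
  - apply Cser_minus; [ | exact Hz].
    assert (H0 : Cser (fun _ => 0) 0).
    { apply Cconv_ext with (fun _ => 0); [ | apply Cconv_const].
      intros n. rewrite Csum_const. ring. }
    apply (Cser_S (fun k => match k with O => RtoC 1 | S _ => RtoC 0 end)) in H0.
    rewrite Cplus_0_r in H0. exact H0.
Qed.

Lemma Cser_geom (y : C) : (Cmod y < 1)%R -> Cser (fun m => y ^ m) (/ (1 - y)).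
Proof.
  intros Hy.
  assert (Hy1 : 1 - y <> 0).
  { intros E. assert (Ey : y = 1) by (replace y with (1 - (1 - y)) by ring; rewrite E; ring).
    rewrite Ey, Cmod_1 in Hy. lra. }
  assert (Hlim : Cconv (fun n => y ^ n) 0).
  { apply (ex_series_term_conv _ (fun n => Cmod y ^ n)%R).
    - intros k. rewrite Cmod_pow. lra.
    - apply ex_series_geom. rewrite Rabs_pos_eq; [exact Hy | apply Cmod_ge_0]. }
  apply Cconv_ext with (fun n => / (1 - y) * (1 - y ^ n)).
  - intros n. rewrite <- Csum_geom. field. exact Hy1.
  - replace (/ (1 - y)) with (/ (1 - y) * (1 - 0)) at 1 by ring.
    apply Cconv_scal. apply Cconv_minus; [apply Cconv_const | exact Hlim].
Qed.

Section Lambert.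
Variable tau : C.
Hypothesis Htau : in_H tau.
Let q : C := qof tau.

Definition aterm (j m : nat) : C :=
  kappa (IZR (Z.of_nat j) * tau + IZR (Z.of_nat m) * (7 * tau)) - 1.

Lemma nome_bounds : (0 < Cmod q < 1)%R.
Proof. now apply Cmod_qof_lt_1. Qed.

Lemma nome_pow_lt_1 (n : nat) : (0 < n)%nat -> (Cmod (q ^ n) < 1)%R.
Proof.
  intros Hn. rewrite Cmod_pow. destruct nome_bounds.
  apply pow_lt_1_compat; [lra | exact Hn].
Qed.

Lemma one_minus_nome_pow (n : nat) : (0 < n)%nat -> 1 - q ^ n <> 0.
Proof.
  intros Hn E. pose proof (nome_pow_lt_1 n Hn) as H.
  assert (Eq : q ^ n = 1) by (replace (q ^ n) with (1 - (1 - q ^ n)) by ring; rewrite E; ring).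
  rewrite Eq, Cmod_1 in H. lra.
Qed.

Lemma aterm_alt (j m : nat) : (0 < j)%nat ->
  aterm j m = q ^ (j + 7 * m) / (1 - q ^ (j + 7 * m)).
Proof.
  intros Hj. unfold aterm, kappa.
  replace (IZR (Z.of_nat j) * tau + IZR (Z.of_nat m) * (7 * tau))
    with (INR (j + 7 * m) * tau).
  - rewrite qof_pow. fold q. field. apply one_minus_nome_pow. lia.
  - rewrite plus_INR, mult_INR, !INR_IZR_INZ, RtoC_plus, RtoC_mult.
    change (Z.of_nat 7) with 7%Z. ring.
Qed.

Lemma aterm_ex_series (j : nat) : (0 < j < 7)%nat -> exists a, Cser (aterm j) a.
Proof.
  intros Hj. pose proof (seven_tau_in_H tau Htau) as Ht.
  destruct (kappa_tail (7 * tau) (IZR (Z.of_nat j) * tau) Ht) as [B [HB Hb]].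
  - intros n. apply multiple_generic; [exact Htau | ]. rewrite Z.mod_small; lia.
  - apply Cser_abs with (1 := Hb). apply ex_series_Rscal. now apply ex_series_nome.
Qed.

(** Reflection sends the point (g - 7(m+1)) tau to ((7 - g) + 7m) tau, so the negative half of the
    lattice is the series of the residue 7 - g. The 1 comes from k = 0, where [aterm] subtracts 1
    and [zterm] does not. *)
Lemma zterm_septic (g : nat) (a a' : C) : (0 < g < 7)%nat ->
  Cser (aterm g) a -> Cser (aterm (7 - g)) a' ->
  Cser (zterm (7 * tau) (IZR (Z.of_nat g) * tau)) (1 + a - a').
Proof.
  intros Hg Ha Ha'.
  assert (Hgen : generic (7 * tau) (- (IZR (Z.of_nat g) * tau))).
  { apply generic_opp, multiple_generic; [exact Htau | ]. rewrite Z.mod_small; lia. }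
  replace (1 + a - a') with (a + (1 + -1 * a')) by ring.
  apply Cser_ext with
    (fun k => aterm g k + match k with O => 1 | S m => -1 * aterm (7 - g) m end).
  - intros [ | m]; unfold zterm, fold, aterm.
    + simpl. ring.
    + pose proof (kappa_lattice_opp _ _ (- Z.of_nat (S m)) Hgen) as E.
      rewrite Z.opp_involutive in E.
      replace (- - (IZR (Z.of_nat g) * tau)) with (IZR (Z.of_nat g) * tau) in E by ring.
      rewrite E.
      replace (- (IZR (Z.of_nat g) * tau) + IZR (Z.of_nat (S m)) * (7 * tau))
        with (IZR (Z.of_nat (7 - g)) * tau + IZR (Z.of_nat m) * (7 * tau)).
      * ring.
      * rewrite Nat2Z.inj_sub by lia. change (Z.of_nat 7) with 7%Z.
        rewrite minus_IZR, Nat2Z.inj_succ, succ_IZR, RtoC_minus, RtoC_plus. ring.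
  - apply Cser_plus; [exact Ha | ].
    apply (Cser_S (fun k => match k with O => 1 | S m => -1 * aterm (7 - g) m end)).
    now apply Cser_scal.
Qed.

(** The classical rearrangement of a Lambert series: expand each term geometrically, then sum over m
    first. The new denominators 1 - q^(7n) are those that occur at the points p/7. *)
Lemma aterm_swap (j : nat) (a : C) : (0 < j)%nat -> Cser (aterm j) a ->
  Cser (fun n => q ^ (S n * j) / (1 - q ^ (7 * S n))) a.
Proof.
  intros Hj Ha. pose proof nome_bounds as Hq.
  apply (Cser_double_swap (fun m n => q ^ (S n * (j + 7 * m))) (fun k => Cmod q ^ k)%R 1 (aterm j)).
  - intros k. apply pow_le. lra.
  - now apply ex_series_nome.
  - lra.
  - intros m n. rewrite Cmod_pow, Rmult_1_l, <- pow_add.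
    replace (S n * (j + 7 * m))%nat with (m + n + (S n * (j + 7 * m) - (m + n)))%nat by nia.
    rewrite (pow_add _ (m + n)). rewrite <- (Rmult_1_r (Cmod q ^ (m + n))) at 2.
    apply Rmult_le_compat_l; [apply pow_le; lra | ].
    rewrite <- (pow1 (S n * (j + 7 * m) - (m + n))). apply pow_incr. lra.
  - intros m. rewrite aterm_alt by exact Hj.
    apply Cser_ext with (fun n => q ^ (j + 7 * m) * (q ^ (j + 7 * m)) ^ n).
    + intros n. now rewrite <- Cpow_S, <- Cpow_mult_r, Nat.mul_comm.
    + apply Cser_scal, Cser_geom, nome_pow_lt_1. lia.
  - intros n.
    apply Cser_ext with (fun m => q ^ (S n * j) * (q ^ (7 * S n)) ^ m).
    + intros m. rewrite <- Cpow_mult_r, <- Cpow_add_r. f_equal. ring.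
    + apply Cser_scal, Cser_geom, nome_pow_lt_1. lia.
  - exact Ha.
Qed.

(** With x = xi y, extend x/(1 - x) to the denominator 1 - x^7 = 1 - y^7, which no longer depends on
    xi. *)
Lemma lambert_root_of_unity (xi y : C) : xi ^ 7 = 1 -> 1 - xi * y <> 0 -> 1 - y ^ 7 <> 0 ->
  xi * y / (1 - xi * y)
  = (xi * y + xi ^ 2 * y ^ 2 + xi ^ 3 * y ^ 3 + xi ^ 4 * y ^ 4 + xi ^ 5 * y ^ 5
     + xi ^ 6 * y ^ 6 + y ^ 7) / (1 - y ^ 7).
Proof.
  intros Hxi H1 H2.
  assert (E : y ^ 7 = (xi * y) ^ 7) by (rewrite Cpow_mult_l, Hxi; ring).
  rewrite E in *. set (x := xi * y) in *.
  replace (xi ^ 2 * y ^ 2) with (x ^ 2) by (unfold x; ring).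
  replace (xi ^ 3 * y ^ 3) with (x ^ 3) by (unfold x; ring).
  replace (xi ^ 4 * y ^ 4) with (x ^ 4) by (unfold x; ring).
  replace (xi ^ 5 * y ^ 5) with (x ^ 5) by (unfold x; ring).
  replace (xi ^ 6 * y ^ 6) with (x ^ 6) by (unfold x; ring).
  field. auto.
Qed.

(** The terms of index n and -n combine to the value at xi minus the value at xi^(-1). The y^7 parts
    cancel and the coefficient xi^j - xi^(-j) is odd in j, so the six Lambert series enter only
    through three differences. *)
Lemma zterm_root_of_unity (p : Z) (a1 a2 a3 a4 a5 a6 : C) : septimal p ->
  Cser (aterm 1) a1 -> Cser (aterm 2) a2 -> Cser (aterm 3) a3 ->
  Cser (aterm 4) a4 -> Cser (aterm 5) a5 -> Cser (aterm 6) a6 ->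
  let xi := qof (IZR p / 7) in
  Cser (zterm tau (IZR p / 7))
    (/ (1 - xi) + ((xi - xi ^ 6) * (a1 - a6) + (xi ^ 2 - xi ^ 5) * (a2 - a5)
      + (xi ^ 3 - xi ^ 4) * (a3 - a4))).
Proof.
  intros Hp H1 H2 H3 H4 H5 H6 xi.
  apply aterm_swap in H1, H2, H3, H4, H5, H6; try lia.
  assert (Hxi : xi ^ 7 = 1).
  { unfold xi. rewrite <- qof_pow. rewrite INR_IZR_INZ. change (Z.of_nat 7) with 7%Z.
    replace (7 * (IZR p / 7)) with (RtoC (IZR p)) by field. apply qof_IZR. }
  assert (Hgen : generic tau (IZR p / 7)) by (intros n; now apply qof_septimal_tau).
  assert (E0 : zterm tau (IZR p / 7) 0 = / (1 - xi)).
  { unfold zterm, fold, kappa, xi. replace (IZR p / 7 + IZR 0 * tau) with (IZR p / 7) by ring.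
    ring. }
  rewrite <- E0. apply Cser_S.
  apply Cser_ext with (fun n =>
    (xi - xi ^ 6) * (q ^ (S n * 1) / (1 - q ^ (7 * S n)) - q ^ (S n * 6) / (1 - q ^ (7 * S n)))
    + (xi ^ 2 - xi ^ 5) * (q ^ (S n * 2) / (1 - q ^ (7 * S n)) - q ^ (S n * 5) / (1 - q ^ (7 * S n)))
    + (xi ^ 3 - xi ^ 4) * (q ^ (S n * 3) / (1 - q ^ (7 * S n)) - q ^ (S n * 4) / (1 - q ^ (7 * S n)))).
  - intros n. unfold zterm, fold.
    set (N := Z.of_nat (S n)).
    replace (IZR p / 7 + IZR (- N) * tau) with (- (- (IZR p / 7) + IZR N * tau))
      by (rewrite opp_IZR, RtoC_opp; ring).
    rewrite kappa_opp by (apply generic_opp; exact Hgen).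
    pose proof (Hgen N) as G1. pose proof (generic_opp _ _ Hgen N) as G2.
    unfold kappa.
    assert (EN : qof (IZR N * tau) = q ^ S n)
      by (unfold N; now rewrite <- INR_IZR_INZ, qof_pow).
    assert (Ei : qof (- (IZR p / 7)) = xi ^ 6).
    { rewrite qof_opp. fold xi. pose proof (qof_neq_0 (IZR p / 7)) as Hx. fold xi in Hx.
      transitivity (xi ^ 7 * / xi); [rewrite Hxi; ring | field; exact Hx]. }
    apply one_minus_qof_neq_0 in G1, G2.
    rewrite qof_plus, EN in G1, G2. rewrite Ei in G2. fold xi in G1.
    rewrite !qof_plus, EN, Ei. fold xi.
    rewrite (Nat.mul_comm 7), !Cpow_mult_r, Cpow_1_r.
    assert (Hy7 : 1 - (q ^ S n) ^ 7 <> 0).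
    { rewrite <- Cpow_mult_r. apply one_minus_nome_pow. lia. }
    set (y := q ^ S n) in *.
    pose proof (lambert_root_of_unity xi y Hxi G1 Hy7) as L1.
    assert (Hxi6 : (xi ^ 6) ^ 7 = 1)
      by (rewrite <- Cpow_mult_r, Nat.mul_comm, Cpow_mult_r, Hxi; apply Cpow_1_l).
    pose proof (lambert_root_of_unity (xi ^ 6) y Hxi6 G2 Hy7) as L2.
    assert (P2 : (xi ^ 6) ^ 2 = xi ^ 5) by (transitivity (xi ^ 7 * xi ^ 5); [ring | rewrite Hxi; ring]).
    assert (P3 : (xi ^ 6) ^ 3 = xi ^ 4)
      by (transitivity (xi ^ 7 * xi ^ 7 * xi ^ 4); [ring | rewrite Hxi; ring]).
    assert (P4 : (xi ^ 6) ^ 4 = xi ^ 3)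
      by (transitivity ((xi ^ 7) ^ 3 * xi ^ 3); [ring | rewrite Hxi; ring]).
    assert (P5 : (xi ^ 6) ^ 5 = xi ^ 2)
      by (transitivity ((xi ^ 7) ^ 4 * xi ^ 2); [ring | rewrite Hxi; ring]).
    assert (P6 : (xi ^ 6) ^ 6 = xi)
      by (transitivity ((xi ^ 7) ^ 5 * xi); [ring | rewrite Hxi; ring]).
    rewrite P2, P3, P4, P5, P6 in L2.
    transitivity (xi * y / (1 - xi * y) - xi ^ 6 * y / (1 - xi ^ 6 * y)).
    + rewrite L1, L2. unfold Cdiv. ring.
    + set (z := xi ^ 6 * y) in *. set (x := xi * y) in *. field. auto.
  - apply Cser_plus; [apply Cser_plus | ]; apply Cser_scal; apply Cser_minus; assumption.
Qed.
End Lambert.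

(** * The identity over the seventh cyclotomic field *)

Lemma zeta_qof : zeta = qof (1 / 7).
Proof. unfold zeta, qof. f_equal. field. Qed.

Lemma zeta_pow_7 : zeta ^ 7 = 1.
Proof.
  rewrite zeta_qof, <- qof_pow. rewrite INR_IZR_INZ. change (Z.of_nat 7) with 7%Z.
  replace (7 * (1 / 7)) with (RtoC 1) by field. apply qof_1.
Qed.

Lemma zeta_pow_neq_1 (k : nat) : (0 < k < 7)%nat -> zeta ^ k <> 1.
Proof.
  intros Hk. rewrite zeta_qof, <- qof_pow, INR_IZR_INZ.
  replace (IZR (Z.of_nat k) * (1 / 7)) with (IZR (Z.of_nat k) / 7 + 0) by field.
  apply qof_septimal; [split; lia | now right].
Qed.

Lemma cyclotomic_7 (z : C) : z ^ 7 = 1 -> z <> 1 ->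
  z ^ 6 = - (1 + z + z ^ 2 + z ^ 3 + z ^ 4 + z ^ 5).
Proof.
  intros H7 H1. assert (Hz : 1 - z <> 0) by (now apply Cminus_neq_0, not_eq_sym).
  transitivity ((1 - z ^ 7) / (1 - z) - (1 + z + z ^ 2 + z ^ 3 + z ^ 4 + z ^ 5)).
  - field. exact Hz.
  - rewrite H7. field. exact Hz.
Qed.

(** Solved for the top power, so that [ring] can use it to reduce polynomials in [zeta]. *)
Lemma zeta_cyclotomic : zeta ^ 6 = - (1 + zeta + zeta ^ 2 + zeta ^ 3 + zeta ^ 4 + zeta ^ 5).
Proof.
  apply cyclotomic_7; [apply zeta_pow_7 | ].
  rewrite <- (Cpow_1_r zeta). apply zeta_pow_neq_1. lia.
Qed.

Lemma qof_seventh (k : nat) (m : Z) :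
  qof (IZR (Z.of_nat k + 7 * m) / 7) = zeta ^ k.
Proof.
  replace (IZR (Z.of_nat k + 7 * m) / 7) with (INR k * (1 / 7) + IZR m)
    by (rewrite plus_IZR, mult_IZR, INR_IZR_INZ, RtoC_plus, RtoC_mult; field).
  now rewrite qof_period, qof_pow, zeta_qof.
Qed.

(** The three real periods zeta^j + zeta^(-j) have product 1, so the denominator of [r] is inverted
    by the product of the other two. *)
Lemma r_alt : r = 4 + 3 * (zeta ^ 2 + zeta ^ 5) + (zeta ^ 3 + zeta ^ 4).
Proof.
  pose proof zeta_cyclotomic as Hz. unfold r. set (z := zeta) in *.
  assert (H : (z + z ^ 6) * (z ^ 2 + z ^ 5) * (z ^ 3 + z ^ 4) = 1) by ring [Hz].
  assert (H0 : z ^ 3 + z ^ 4 <> 0).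
  { intros E. rewrite E in H. apply C1_nz. rewrite <- H. ring. }
  transitivity (- (z + z ^ 6) ^ 3 * (z ^ 2 + z ^ 5)); [ | ring [Hz]].
  transitivity (- (z + z ^ 6) ^ 2 / (z ^ 3 + z ^ 4)
    * ((z + z ^ 6) * (z ^ 2 + z ^ 5) * (z ^ 3 + z ^ 4))).
  - rewrite H. ring.
  - field. exact H0.
Qed.

Lemma cubic_r : cubic r = 0.
Proof.
  pose proof zeta_cyclotomic as Hz. rewrite r_alt. unfold cubic. ring [Hz].
Qed.

Definition septic_sum (xi d1 d2 d3 : C) : C :=
  / (1 - xi) + ((xi - xi ^ 6) * d1 + (xi ^ 2 - xi ^ 5) * d2 + (xi ^ 3 - xi ^ 4) * d3).

(** Multiplying the numerator by 1 - xi gives 7 - (1 + xi + ... + xi^6), which is 7. This turns the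
    inverses in [septic_sum] into polynomials. *)
Lemma inv_one_minus_zeta_pow (k : nat) : (0 < k < 7)%nat ->
  let xi := zeta ^ k in
  / (1 - xi) = (6 + 5 * xi + 4 * xi ^ 2 + 3 * xi ^ 3 + 2 * xi ^ 4 + xi ^ 5) / 7.
Proof.
  intros Hk xi.
  assert (Hxi : 1 - xi <> 0) by (apply Cminus_neq_0, not_eq_sym; now apply zeta_pow_neq_1).
  assert (H7 : xi ^ 7 = 1)
    by (unfold xi; rewrite <- Cpow_mult_r, Nat.mul_comm, Cpow_mult_r, zeta_pow_7; apply Cpow_1_l).
  assert (H6 : 1 + xi + xi ^ 2 + xi ^ 3 + xi ^ 4 + xi ^ 5 + xi ^ 6 = 0).
  { transitivity ((1 - xi ^ 7) / (1 - xi)); [field; exact Hxi | rewrite H7; field; exact Hxi]. }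
  transitivity ((7 - (1 + xi + xi ^ 2 + xi ^ 3 + xi ^ 4 + xi ^ 5 + xi ^ 6)) / (1 - xi) / 7).
  - rewrite H6. field. exact Hxi.
  - field. exact Hxi.
Qed.

Lemma zeta_pow_mod (n : nat) : zeta ^ n = zeta ^ (n mod 7).
Proof.
  rewrite (Nat.div_mod_eq n 7) at 1.
  rewrite Cpow_add_r, Cpow_mult_r, zeta_pow_7, Cpow_1_l. ring.
Qed.

(** Reducing exponents modulo 7 first keeps the polynomials given to [ring] small. *)
Ltac reduce_zeta_powers :=
  rewrite <- ?Cpow_mult_r; cbn [Nat.mul Nat.add];
  repeat match goal with
  | |- context [zeta ^ ?n] =>
    let m := eval compute in (n mod 7)%nat in
    tryif constr_eq n m then fail else
      replace (zeta ^ n) with (zeta ^ m) by (symmetry; apply (zeta_pow_mod n))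
  end.

(** The exponents 3, 6, 5, 1 are -4, -1, -2, 1 modulo 7: the numerators of v + u, u, v - u, -u for u
    = -1/7, v = -3/7. In [septic_sum_B] they come from u = -2/7, v = -1/7. *)
Lemma septic_sum_A (d1 d2 d3 : C) : let z := zeta in
  septic_sum (z ^ 3) d1 d2 d3 - septic_sum (z ^ 6) d1 d2 d3
    - septic_sum (z ^ 5) d1 d2 d3 + septic_sum (z ^ 1) d1 d2 d3
  = (3 + 6 * z + 9 * z ^ 2 + 5 * z ^ 3 + 1 * z ^ 4 - 3 * z ^ 5) * / 7
    + (2 + 4 * z + 3 * z ^ 2 + 3 * z ^ 3 + 1 * z ^ 4 + 1 * z ^ 5) * d1
    + (-1 - 2 * z + 1 * z ^ 2 - 2 * z ^ 3 - 3 * z ^ 5) * d2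
    + (-1 - 2 * z + 1 * z ^ 3 - 3 * z ^ 4 - 2 * z ^ 5) * d3.
Proof.
  intros z. subst z. pose proof zeta_cyclotomic as Hz. unfold septic_sum.
  rewrite !inv_one_minus_zeta_pow by lia. unfold Cdiv.
  reduce_zeta_powers. set (z := zeta) in *. ring [Hz].
Qed.

Lemma septic_sum_B (d1 d2 d3 : C) : let z := zeta in
  septic_sum (z ^ 4) d1 d2 d3 - septic_sum (z ^ 5) d1 d2 d3
    - septic_sum (z ^ 1) d1 d2 d3 + septic_sum (z ^ 2) d1 d2 d3
  = (-2 - 4 * z + 1 * z ^ 2 - 8 * z ^ 3 + 4 * z ^ 4 - 5 * z ^ 5) * / 7
    + (-1 - 2 * z + 1 * z ^ 2 - 2 * z ^ 3 - 3 * z ^ 5) * d1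
    + (1 + 2 * z - 1 * z ^ 3 + 3 * z ^ 4 + 2 * z ^ 5) * d2
    + (-2 - 4 * z - 3 * z ^ 2 - 3 * z ^ 3 - 1 * z ^ 4 - 1 * z ^ 5) * d3.
Proof.
  intros z. subst z. pose proof zeta_cyclotomic as Hz. unfold septic_sum.
  rewrite !inv_one_minus_zeta_pow by lia. unfold Cdiv.
  reduce_zeta_powers. set (z := zeta) in *. ring [Hz].
Qed.

(** Once the d's are eliminated, the constants coming from 1/(1 - xi) cancel and both combinations
    are b times a polynomial in x over Q([zeta]); hence b may be arbitrary. *)
Lemma septic_identity (x b d1 d2 d3 : C) :
  - 1 - 2 * d1 - d2 - d3 = - x * (b * (x - 1)) ->
  d1 - 2 * d2 + d3 = b * (x - 1) ->
  d1 - d2 - 2 * d3 = b * x ->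
  (septic_sum (zeta ^ 3) d1 d2 d3 - septic_sum (zeta ^ 6) d1 d2 d3
    - septic_sum (zeta ^ 5) d1 d2 d3 + septic_sum (zeta ^ 1) d1 d2 d3) * ((1 - r) * x - 1)
  = - (septic_sum (zeta ^ 4) d1 d2 d3 - septic_sum (zeta ^ 5) d1 d2 d3
    - septic_sum (zeta ^ 1) d1 d2 d3 + septic_sum (zeta ^ 2) d1 d2 d3) * (x - r).
Proof.
  intros HA HB HD. pose proof zeta_cyclotomic as Hz.
  set (A := - x * (b * (x - 1))) in *. set (B := b * (x - 1)) in *. set (D := b * x) in *.
  (* Cramer's rule for the three hypotheses, whose determinant is -14. *)
  assert (E1 : d1 = (-5 * A - 5 + B + 3 * D) / 14) by (rewrite <- HA, <- HB, <- HD; field).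
  assert (E2 : d2 = - (3 * A + 3 + 5 * B + D) / 14) by (rewrite <- HA, <- HB, <- HD; field).
  assert (E3 : d3 = (- A - 1 + 3 * B - 5 * D) / 14) by (rewrite <- HA, <- HB, <- HD; field).
  rewrite septic_sum_A, septic_sum_B, E1, E2, E3, r_alt. unfold A, B, D.
  clear - Hz. set (z := zeta) in *.
  replace (/ 7) with (2 / 14) by field. unfold Cdiv. ring [Hz].
Qed.

(** * The inversion formula for [h] *)

(** A point at a positive multiple of tau contributes 1 to the constant and a negative one 0, so the
    constant is -1 when v > u and 0 when v < u. *)
Lemma septic_lam_sums (tau a1 a2 a3 a4 a5 a6 : C) : in_H tau ->
  Cser (aterm tau 1) a1 -> Cser (aterm tau 2) a2 -> Cser (aterm tau 3) a3 ->
  Cser (aterm tau 4) a4 -> Cser (aterm tau 5) a5 -> Cser (aterm tau 6) a6 ->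
  let d1 := a1 - a6 in let d2 := a2 - a5 in let d3 := a3 - a4 in
  Cser (fold (septic_lam tau 1 3)) (- 1 - 2 * d1 - d2 - d3) /\
  Cser (fold (septic_lam tau 2 1)) (d1 - 2 * d2 + d3) /\
  Cser (fold (septic_lam tau 1 2)) (- 1 - 3 * d1 + d3) /\
  Cser (fold (septic_lam tau 3 2)) (d1 - d2 - 2 * d3).
Proof.
  intros Ht H1 H2 H3 H4 H5 H6 d1 d2 d3.
  pose proof (zterm_septic tau Ht 1 _ _ ltac:(lia) H1 H6) as P1.
  pose proof (zterm_septic tau Ht 2 _ _ ltac:(lia) H2 H5) as P2.
  pose proof (zterm_septic tau Ht 3 _ _ ltac:(lia) H3 H4) as P3.
  pose proof (zterm_septic tau Ht 4 _ _ ltac:(lia) H4 H3) as P4.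
  pose proof (zterm_septic tau Ht 5 _ _ ltac:(lia) H5 H2) as P5.
  pose proof (zterm_opp _ _ _ (multiple_generic tau Ht 1 ltac:(discriminate)) P1) as N1.
  pose proof (zterm_opp _ _ _ (multiple_generic tau Ht 2 ltac:(discriminate)) P2) as N2.
  pose proof (zterm_opp _ _ _ (multiple_generic tau Ht 3 ltac:(discriminate)) P3) as N3.
  simpl Z.of_nat in P1, P2, P3, P4, P5.
  repeat split.
  - replace (- 1 - 2 * d1 - d2 - d3)
      with ((1 + a4 - a3) - (1 + a1 - a6) - (1 + a2 - a5) + (1 - (1 + a1 - a6)))
      by (unfold d1, d2, d3; ring).
    apply Cser_lamterm; trivial.
    + replace (3 * tau + 1 * tau) with (4 * tau) by ring. exact P4.
    + replace (3 * tau - 1 * tau) with (2 * tau) by ring. exact P2.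
  - replace (d1 - 2 * d2 + d3)
      with ((1 + a3 - a4) - (1 + a2 - a5) - (1 - (1 + a1 - a6)) + (1 - (1 + a2 - a5)))
      by (unfold d1, d2, d3; ring).
    apply Cser_lamterm; trivial.
    + replace (1 * tau + 2 * tau) with (3 * tau) by ring. exact P3.
    + replace (1 * tau - 2 * tau) with (- (1 * tau)) by ring. exact N1.
  - replace (- 1 - 3 * d1 + d3)
      with ((1 + a3 - a4) - (1 + a1 - a6) - (1 + a1 - a6) + (1 - (1 + a1 - a6)))
      by (unfold d1, d2, d3; ring).
    apply Cser_lamterm; trivial.
    + replace (2 * tau + 1 * tau) with (3 * tau) by ring. exact P3.
    + replace (2 * tau - 1 * tau) with (1 * tau) by ring. exact P1.
  - replace (d1 - d2 - 2 * d3)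
      with ((1 + a5 - a2) - (1 + a3 - a4) - (1 - (1 + a1 - a6)) + (1 - (1 + a3 - a4)))
      by (unfold d1, d2, d3; ring).
    apply Cser_lamterm; trivial.
    + replace (2 * tau + 3 * tau) with (5 * tau) by ring. exact P5.
    + replace (2 * tau - 3 * tau) with (- (1 * tau)) by ring. exact N1.
Qed.

Lemma inversion_in_H (tau : C) : in_H tau -> in_H (-1 / (7 * tau)).
Proof.
  intros Ht. pose proof (tau_neq_0 tau Ht) as H0.
  set (N := (Re tau * Re tau + Im tau * Im tau)%R).
  assert (HN : (0 < N)%R).
  { unfold N, in_H in *. pose proof (Rle_0_sqr (Re tau)) as H. unfold Rsqr in H. nra. }
  assert (E : tau * Cconj tau = RtoC N)
    by (unfold N; destruct tau; apply C_eq; simpl; ring).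
  assert (HNC : RtoC N <> 0) by (intros F; apply RtoC_inj in F; lra).
  replace (-1 / (7 * tau)) with (RtoC (- / (7 * N)) * Cconj tau).
  - unfold in_H in *.
    assert (0 < / (7 * N))%R by (apply Rinv_0_lt_compat; lra).
    destruct tau as [x y]. simpl in *. nra.
  - assert (Hc : Cconj tau <> 0).
    { intros F. apply HNC. rewrite <- E, F. ring. }
    rewrite RtoC_opp, RtoC_inv, RtoC_mult, <- E by lra. field. split; assumption.
Qed.

(** The integers m1 to m4 bring possibly negative numerators to natural exponents of [zeta]. *)
Lemma septimal_lam_sum (tau : C) (d1 d2 d3 : C) (u v : Z) (p1 p2 p3 p4 : nat) (m1 m2 m3 m4 : Z) :
  (forall p, septimal p ->
    Cser (zterm tau (IZR p / 7)) (septic_sum (qof (IZR p / 7)) d1 d2 d3)) ->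
  septimal (v + u) -> septimal u -> septimal (v - u) -> septimal (- u) ->
  (v + u = Z.of_nat p1 + 7 * m1)%Z -> (u = Z.of_nat p2 + 7 * m2)%Z ->
  (v - u = Z.of_nat p3 + 7 * m3)%Z -> (- u = Z.of_nat p4 + 7 * m4)%Z ->
  Cser (fold (lamterm tau (IZR u / 7) (IZR v / 7)))
    (septic_sum (zeta ^ p1) d1 d2 d3 - septic_sum (zeta ^ p2) d1 d2 d3
      - septic_sum (zeta ^ p3) d1 d2 d3 + septic_sum (zeta ^ p4) d1 d2 d3).
Proof.
  intros HZ H1 H2 H3 H4 E1 E2 E3 E4.
  rewrite <- (qof_seventh p1 m1), <- (qof_seventh p2 m2), <- (qof_seventh p3 m3),
    <- (qof_seventh p4 m4), <- E1, <- E2, <- E3, <- E4.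
  destruct (points_alt u v) as [F1 [F3 F4]].
  apply Cser_lamterm; [rewrite F1 | | rewrite F3 | rewrite F4]; now apply HZ.
Qed.

Lemma h_inversion (tau : C) : in_H tau ->
  h (-1 / (7 * tau)) = (h tau - r) / ((1 - r) * h tau - 1).
Proof.
  intros Ht. pose proof (tau_neq_0 tau Ht) as H0.
  destruct (aterm_ex_series tau Ht 1 ltac:(lia)) as [a1 H1].
  destruct (aterm_ex_series tau Ht 2 ltac:(lia)) as [a2 H2].
  destruct (aterm_ex_series tau Ht 3 ltac:(lia)) as [a3 H3].
  destruct (aterm_ex_series tau Ht 4 ltac:(lia)) as [a4 H4].
  destruct (aterm_ex_series tau Ht 5 ltac:(lia)) as [a5 H5].
  destruct (aterm_ex_series tau Ht 6 ltac:(lia)) as [a6 H6].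
  destruct (septic_lam_sums tau a1 a2 a3 a4 a5 a6 Ht H1 H2 H3 H4 H5 H6)
    as [SA [SB [SC SD]]].
  set (d1 := a1 - a6) in *. set (d2 := a2 - a5) in *. set (d3 := a3 - a4) in *.
  destruct (septic_lam_values tau Ht)
    as [A [B [C' [D [LA [LB [LC [LD [EA [EC [A0 B0]]]]]]]]]]].
  pose proof (Cser_unique _ _ _ SA LA) as UA. pose proof (Cser_unique _ _ _ SB LB) as UB.
  pose proof (Cser_unique _ _ _ SC LC) as UC. pose proof (Cser_unique _ _ _ SD LD) as UD.
  set (x := h tau) in *.
  (* The four values depend on three Lambert series only: this is their linear relation. *)
  assert (EACD : A = C' + D) by (rewrite <- UA, <- UC, <- UD; ring).
  assert (ED : D * (1 - x) = A) by (rewrite EACD, EC; ring).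
  assert (Hx : x - 1 <> 0).
  { intros F. apply A0. rewrite <- ED. replace (1 - x) with (- (x - 1)) by ring.
    rewrite F. ring. }
  (* The common factor: with it, D (1 - x) = A = - x B forces D = b x. *)
  set (b := B / (x - 1)).
  assert (Eb : B = b * (x - 1)) by (unfold b; field; exact Hx).
  assert (EDb : D = b * x).
  { transitivity (- (D * (1 - x)) / (x - 1)); [field; exact Hx | ].
    rewrite ED, EA. unfold b. field. exact Hx. }
  assert (HA : - 1 - 2 * d1 - d2 - d3 = - x * (b * (x - 1))) by (rewrite UA, EA, Eb; ring).
  pose proof (septic_identity x b d1 d2 d3 HA (eq_trans UB Eb) (eq_trans UD EDb)) as HI.
  set (s := -1 / (7 * tau)).
  pose proof (inversion_in_H tau Ht) as Hs. fold s in Hs.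
  destruct (septic_lam_values s Hs)
    as [A' [B' [_ [_ [LA' [LB' [_ [_ [EA' [_ [_ B0']]]]]]]]]]].
  assert (HZ : forall p, septimal p ->
    Cser (zterm tau (IZR p / 7)) (septic_sum (qof (IZR p / 7)) d1 d2 d3)).
  { intros p Hp. exact (zterm_root_of_unity tau Ht p a1 a2 a3 a4 a5 a6 Hp H1 H2 H3 H4 H5 H6). }
  (* At s the multiples of the parameter become division points over tau with opposite sign; this is
     the origin of the pairs (-1, -3) and (-2, -1) below. *)
  assert (E7 : forall u : Z, IZR u * s = IZR (- u) / 7 / tau).
  { intros u. unfold s. rewrite opp_IZR, RtoC_opp. field. exact H0. }
  assert (Es : 7 * s = -1 / tau) by (unfold s; field; exact H0).
  unfold septic_lam in LA', LB'. rewrite Es, !E7 in LA', LB'.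
  assert (S1 : septimal 1) by (split; lia). assert (S2 : septimal 2) by (split; lia).
  assert (S3 : septimal (-1)) by (split; lia). assert (S4 : septimal (-2)) by (split; lia).
  assert (S5 : septimal (-3)) by (split; lia). assert (S6 : septimal (-4)) by (split; lia).
  apply (lam_inversion tau (-1) (-3) Ht S6 S3 S4 S1) in LA'.
  apply (lam_inversion tau (-2) (-1) Ht S5 S4 S1 S2) in LB'.
  pose proof (septimal_lam_sum tau d1 d2 d3 (-1) (-3) 3 6 5 1 (-1) (-1) (-1) 0
    HZ S6 S3 S4 S1 eq_refl eq_refl eq_refl eq_refl) as MA.
  pose proof (septimal_lam_sum tau d1 d2 d3 (-2) (-1) 4 5 1 2 (-1) (-1) 0 0
    HZ S5 S4 S1 S2 eq_refl eq_refl eq_refl eq_refl) as MB.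
  (* The two evaluations of Lam at seventh points agree: by Lambert series and by inversion from s.
     The factor 1/tau is common to both sides. *)
  rewrite (Cser_unique _ _ _ MA LA'), (Cser_unique _ _ _ MB LB') in HI.
  assert (HI' : A' * ((1 - r) * x - 1) = - B' * (x - r)).
  { transitivity (tau * (A' / tau * ((1 - r) * x - 1))); [field; exact H0 | ].
    rewrite HI. field. exact H0. }
  pose proof cubic_r as Hr. unfold cubic in Hr.
  assert (HK : (1 - r) * x - 1 <> 0).
  { intros F. rewrite F in HI'.
    assert (Fx : x = r).
    { replace x with (r + - / B' * (- B' * (x - r))) by (field; exact B0').
      rewrite <- HI'. ring. }
    rewrite Fx in F.
    (* r would be a root of both x^2 - x + 1 and the cubic. *)
    assert (G : 3 * r - 8 = 0).
    { transitivity (- (r ^ 3 - 8 * r ^ 2 + 5 * r + 1) - (r - 7) * ((1 - r) * r - 1));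
        [ring | rewrite Hr, F; ring]. }
    assert (Er : r = 8 / 3) by (transitivity ((3 * r - 8 + 8) / 3); [field | rewrite G; field]).
    rewrite Er in F. apply (f_equal Re) in F. revert F.
    replace ((1 - 8 / 3) * (8 / 3) - 1) with (RtoC (- 49 / 9)).
    - simpl. lra.
    - rewrite RtoC_div by lra. field. }
  transitivity (- A' / B').
  - rewrite EA'. field. exact B0'.
  - transitivity (- (A' * ((1 - r) * x - 1)) / (B' * ((1 - r) * x - 1))).
    + field. split; assumption.
    + rewrite HI'. field. split; assumption.
Qed.

(** The substitution x -> 1/(1 - x), of order three, multiplies the cubic by -1/(1 - x)^3; and 1 is
    not a root, the value there being -1. *)
Lemma cubic_inv : cubic (/ (1 - r)) = 0.
Proof.
  pose proof cubic_r as Hr. unfold cubic in *.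
  assert (H : 1 - r <> 0).
  { intros F. assert (Er : r = 1) by (replace r with (1 - (1 - r)) by ring; rewrite F; ring).
    rewrite Er in Hr. apply (f_equal Re) in Hr. revert Hr.
    replace (1 ^ 3 - 8 * 1 ^ 2 + 5 * 1 + 1) with (RtoC (-1)) by ring. simpl. lra. }
  transitivity (- (r ^ 3 - 8 * r ^ 2 + 5 * r + 1) / (1 - r) ^ 3).
  - field. exact H.
  - rewrite Hr. unfold Cdiv. ring.
Qed.

Theorem theorem4 :
  (forall tau : C, in_H tau ->
     h (-1 / (7 * tau)) = (h tau - r) / ((1 - r) * h tau - 1))
  /\ cubic r = 0 /\ cubic (/ (1 - r)) = 0.
Proof.
  exact (conj h_inversion (conj cubic_r cubic_inv)).
Qed.
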